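(* Let $L$ be a positive-definite even lattice of rank $\ge1$. Conic-type subVOAs of the lattice VOA $V_L$ are not simple and not rational.
   Context: A submonoid of $L$ is a subset containing $0$ and closed under addition. A submonoid $C\le L$ is of conic-type if $C=\mathbb{Z}_{\ge 0}\alpha_1\oplus\cdots\oplus\mathbb{Z}_{\ge 0}\alpha_r$ for some $\mathbb{Z}$-basis $\{\alpha_1,\dots,\alpha_r\}$ of $L$. Lattice VOA. For a positive-definite even lattice $L$ (form $(\cdot|\cdot)$ integer valued, $(\alpha|\alpha)\in2\mathbb{Z}$) put $\mathfrak{h}=\mathbb{C}\otimes_{\mathbb{Z}}L$ with the $\mathbb{C}$-bilinear extension of $(\cdot|\cdot)$, and $\hat{\mathfrak{h}}=\mathfrak{h}\otimes\mathbb{C}[t,t^{-1}]\oplus\mathbb{C}K$ with $K$ central, $h(m)=h\otimes t^m$, $[h_1(m),h_2(n)]=m\delta_{m+n,0}(h_1|h_2)K$. For $\lambda\in\mathfrak{h}$, $M_{\hat{\mathfrak{h}}}(1,\lambda)=U(\hat{\mathfrak{h}})\otimes_{U(\hat{\mathfrak{h}}_{\ge 0})}\mathbb{C}e^\lambda$, where $\hat{\mathfrak{h}}_{\ge 0}=\mathfrak{h}\otimes\mathbb{C}[t]\oplus\mathbb{C}K$ acts by $K=1$, $h(0)e^\lambda=(h|\lambda)e^\lambda$, $h(n)e^\lambda=0$ for $n>0$. Let $\epsilon:L\times L\to\{\pm1\}$ be a 2-cocycle with $\epsilon(\alpha,\beta)\epsilon(\beta,\alpha)=(-1)^{(\alpha|\beta)}$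 and $\epsilon(0,\alpha)=\epsilon(\alpha,0)=1$. The lattice VOA is $V_L=\bigoplus_{\alpha\in L}M_{\hat{\mathfrak{h}}}(1,\alpha)=M_{\hat{\mathfrak{h}}}(1,0)\otimes\mathbb{C}^\epsilon[L]$ with vacuum $\mathbf{1}=e^0$, $Y(h(-1)\mathbf{1},z)=\sum_{n}h(n)z^{-n-1}$, $Y(e^\alpha,z)=\exp\big(\sum_{n>0}\frac{\alpha(-n)}{n}z^n\big)\exp\big(-\sum_{n>0}\frac{\alpha(n)}{n}z^{-n}\big)e_\alpha z^\alpha$, where $e_\alpha(w\otimes e^\beta)=\epsilon(\alpha,\beta)w\otimes e^{\alpha+\beta}$ and $z^\alpha$ acts on $M_{\hat{\mathfrak{h}}}(1,\beta)$ as $z^{(\alpha|\beta)}$; $Y$ of a general $h_1(-n_1-1)\cdots h_k(-n_k-1)e^\alpha$ is the normally ordered product of the $\frac{1}{n_i!}\partial_z^{n_i}h_i(z)$ and $Y(e^\alpha,z)$. The Virasoro element is $\omega=\frac12\sum_i u_i(-1)^2\mathbf{1}$ for an orthonormal basis $\{u_i\}$ of $\mathfrak{h}$. For a submonoid $M\le L$, $V_M=\bigoplus_{\gamma\in M}M_{\hat{\mathfrak{h}}}(1,\gamma)$ is a subVOA of $V_L$ with the same vacuum and Virasoro element; for $C$ of conic-type, $V_C$ is called a conic-type subVOA. A VOA is rational if every admissible (i.e. $\mathbb{Z}_{\ge0}$-graded) module is semisimple (a direct sum of irreducible admissible modules); it is simple if it has no nonzero proper ideal. *)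

(* Defs.v *)
From HB Require Import structures.
From mathcomp Require Import all_boot all_order all_algebra.
From mathcomp Require Import finmap multiset.
From mathcomp Require Import monalg.
From mathcomp Require Import boolp classical_sets cardinality fsbigop.
Set Implicit Arguments.
Unset Strict Implicit.
Unset Printing Implicit Defensive.
Import Order.TTheory GRing.Theory Num.Theory.
Local Open Scope classical_set_scope.
Local Open Scope ring_scope.

(* [vmode u n v] is u_(n) v, the coefficient of z^(-n-1) in Y(u,z)v. The axioms
   of a VOA are not part of the record: none of the notions below uses them. *)
Record voa_data (K : fieldType) := VoaData {
  vcar :> lmodType K;
  vmode : vcar -> int -> vcar -> vcar;
  vvac : vcar;
  vconf : vcar }.

Section Generic.
Variable K : fieldType.

(* The binomial coefficient C(a, i) for a in Z; K is meant to have
   characteristic 0. *)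
Definition binz (a : int) (i : nat) : K :=
  (\prod_(j < i) (a - (j : nat)%:Z)%:~R) / (i`!)%:R.

Section Subspaces.
Variable W : lmodType K.

Definition subspace (N : set W) : Prop :=
  N 0 /\ forall (a : K) x y, N x -> N y -> N (a *: x + y).

Definition direct_sum (I : choiceType) (N : I -> set W) (U : set W) : Prop :=
  (forall i, N i `<=` U) /\
  forall w, U w -> exists! f : I -> W,
    [/\ forall i, N i (f i), finite_set [set i | f i != 0]
      & w = \sum_(i \in [set: I]) f i].

End Subspaces.

Variable V : voa_data K.

Definition voa_ideal (J : set V) : Prop :=
  subspace J /\
  forall (u v : V) n, J v -> J (vmode u n v) /\ J (vmode v n u).

Definition voa_simple : Prop :=
  forall J : set V, voa_ideal J -> J = [set 0] \/ J = [set: V].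

(* Eigenspaces of L(0) = omega_(1). *)
Definition has_weight (k : int) (u : V) : Prop :=
  vmode (vconf V) 1 u = k%:~R *: u.

Section Modules.
Variables (W : lmodType K) (Y : V -> int -> W -> W).

(* The Jacobi identity is stated through its coefficients; all the sums in it
   have finitely many nonzero terms by truncation. *)
Record weak_module : Prop := WeakModule {
  wm_linl : forall n w, linear (fun u => Y u n w);
  wm_linr : forall u n, linear (Y u n);
  wm_trunc : forall u w, exists N : int, forall n, N <= n -> Y u n w = 0;
  wm_vac : forall n w, Y (vvac V) n w = if n == -1 then w else 0;
  wm_jacobi : forall (u v : V) (w : W) (l m n : int),
    \sum_(i \in [set: nat])
       binz m i *: Y (vmode u (l + i%:Z) v) (m + n - i%:Z) w =
    \sum_(i \in [set: nat])
       ((-1) ^+ i * binz l i) *: Y u (l + m - i%:Z) (Y v (n + i%:Z) w)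
    - \sum_(i \in [set: nat])
       ((-1) ^ l * (-1) ^+ i * binz l i) *:
          Y v (l + n - i%:Z) (Y u (m + i%:Z) w) }.

Definition submodule (N : set W) : Prop :=
  subspace N /\ forall u n w, N w -> N (Y u n w).

Definition irreducible (N : set W) : Prop :=
  [/\ submodule N, N <> [set 0]
    & forall N', submodule N' -> N' `<=` N -> N' = [set 0] \/ N' = N].

Definition grade (G : nat -> set W) (k : int) : set W :=
  if k is Posz n then G n else [set 0].

(* u_(m) maps G n to G (n + wt u - m - 1), where G k = 0 for k < 0. The grading
   of N is its own: it is not required to come from a grading of W. *)
Definition admissible (N : set W) : Prop :=
  exists G : nat -> set W,
  [/\ forall n, subspace (G n), direct_sum G N
    & forall (u : V) (k m : int) (n : nat) (w : W),
        has_weight k u -> G n w -> grade G (n%:Z + k - m - 1) (Y u m w)].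

Definition semisimple : Prop :=
  exists (I : choiceType) (N : I -> set W),
    (forall i, irreducible (N i) /\ admissible (N i)) /\
    direct_sum N [set: W].

End Modules.

Definition voa_rational : Prop :=
  forall (W : lmodType K) (Y : V -> int -> W -> W),
    weak_module Y -> admissible Y [set: W] -> semisimple Y.

End Generic.

(* A lattice is given by the Gram matrix of a Z-basis; its elements are the
   integer row vectors of coordinates. *)
Record even_lattice := EvenLattice {
  lrank : nat;
  gram : 'M[int]_lrank;
  gram_sym : gram^T = gram;
  gram_even : forall x : 'rV[int]_lrank, (2 %| ((x *m gram *m x^T) 0 0)%R)%Z;
  gram_posdef : forall x : 'rV[int]_lrank,
    x != 0 -> 0 < (x *m gram *m x^T) 0 0 }.

Notation lvec L := 'rV[int]_(lrank L).

Definition lform (L : even_lattice) (x y : lvec L) : int :=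
  (x *m gram L *m y^T) 0 0.

Definition zbasis (L : even_lattice) (a : 'I_(lrank L) -> lvec L) : Prop :=
  forall x : lvec L, exists! c : {ffun 'I_(lrank L) -> int},
    x = \sum_i a i *~ c i.

Definition conic_type (L : even_lattice) (C : {pred lvec L}) : Prop :=
  exists2 a : 'I_(lrank L) -> lvec L, zbasis a &
    forall x : lvec L,
      x \in C <-> exists c : 'I_(lrank L) -> nat, x = \sum_i a i *+ c i.

Definition lattice_cocycle (L : even_lattice) (eps : lvec L -> lvec L -> int) :
    Prop :=
  [/\ forall a b, eps a b = 1 \/ eps a b = -1,
      forall a b c, eps a b * eps (a + b) c = eps b c * eps a (b + c),
      forall a b, eps a b * eps b a = (-1) ^ lform a b
    & forall a, eps 0 a = 1 /\ eps a 0 = 1].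

Section LatticeVOA.
Variables (K : fieldType) (L : even_lattice).

(* h = K (x) L, in the coordinates given by the basis of L. *)
Definition cartan := 'rV[K]_(lrank L).

Definition cform (h k : cartan) : K :=
  (h *m map_mx intr (gram L) *m k^T) 0 0.

Definition tocartan (a : lvec L) : cartan := map_mx intr a.

Definition orthonormal_basis (u : 'I_(lrank L) -> cartan) : Prop :=
  forall i j, cform (u i) (u j) = (i == j)%:R.

(* By PBW, M(1,a) has a basis of monomials in the d_i(-n-1), n >= 0, applied to
   e^a, where d_i is the i-th basis vector of L. The monomial is the multiset of
   the pairs (i, n) and (m, a) stands for the basis vector m e^a. *)
Definition var : choiceType := ('I_(lrank L) * nat)%type.
Definition fock_index : choiceType := ({mset var}%mset * lvec L)%type.
Definition VL := {malg K[fock_index]}.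
HB.instance Definition _ := GRing.Lmodule.on VL.

Definition bvec (k : fock_index) : VL := << k >>.

Definition lext (T : lmodType K) (f : fock_index -> T) (v : VL) : T :=
  \sum_(k <- msupp v) v@_k *: f k.

Definition creation (x : var) : VL -> VL :=
  lext (fun k => bvec (x +` k.1, k.2)%mset).

(* d/dx: the multiplicity of x times the monomial with one x removed. *)
Definition annihilation (x : var) : VL -> VL :=
  lext (fun k => (k.1 x)%:R *: bvec (k.1 `\ x, k.2)%mset).

(* h(m), m < 0, multiplies by sum_i h_i d_i(m); for m > 0 it is the derivation
   with [h(m), k(-m)] = m (h|k). *)
Definition heis (h : cartan) (m : int) (v : VL) : VL :=
  match m with
  | Negz n => \sum_i h 0 i *: creation (i, n) v
  | Posz 0 => lext (fun k => cform h (tocartan k.2) *: bvec k) v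
  | Posz n.+1 =>
      n.+1%:R *: \sum_i cform h (delta_mx 0 i) *: annihilation (i, n) v
  end.

(* Coefficient of t^k in (sum_(n > 0) A_n t^n)^j / in its exponential. *)
Fixpoint pow_coef (A : nat -> VL -> VL) (j k : nat) (v : VL) : VL :=
  if j is j'.+1 then \sum_(1 <= i < k.+1) A i (pow_coef A j' (k - i) v)
  else if k == 0%N then v else 0.

Definition exp_coef (A : nat -> VL -> VL) (k : nat) (v : VL) : VL :=
  \sum_(j < k.+1) (j`!%:R)^-1 *: pow_coef A j k v.

(* Coefficients of z^k, resp. z^(-k), in the two exponentials of Y(e^a,z). *)
Definition exp_minus (a : lvec L) : nat -> VL -> VL :=
  exp_coef (fun n v => n%:R^-1 *: heis (tocartan a) (- n%:Z) v).
Definition exp_plus (a : lvec L) : nat -> VL -> VL :=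
  exp_coef (fun n v => - (n%:R^-1 *: heis (tocartan a) n%:Z v)).

Variable eps : lvec L -> lvec L -> int.

(* The mode (e^a)_(n): on M(1,b) the coefficient of z^(-n-1) collects the
   z^p * z^(-q) * z^(a|b) with p - q + (a|b) = - n - 1. *)
Definition Yexp (a : lvec L) (n : int) : VL -> VL :=
  lext (fun k =>
    \sum_(pq \in [set pq : nat * nat |
                   pq.1%:Z - pq.2%:Z + lform a k.2 = - n - 1])
      exp_minus a pq.1 (exp_plus a pq.2
        ((eps a k.2)%:~R *: bvec (k.1, a + k.2)))).

(* The n-th mode of the normally ordered product of (1/j!) d^j h(z) with a field
   B(z): the coefficient of h(m) in (1/j!) d^j h(z) is C(-m-1, j) z^(-m-j-1). *)
Definition normal_order (h : cartan) (j : nat) (B : int -> VL -> VL)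
    (n : int) (v : VL) : VL :=
  \sum_(m \in [set: int]) binz K (- m - 1) j *:
    (if m < 0 then heis h m (B (n - m - j%:Z - 1) v)
     else B (n - m - j%:Z - 1) (heis h m v)).

(* The result does not depend on the enumeration of the factors. *)
Definition Ybasis (k : fock_index) : int -> VL -> VL :=
  foldr (fun x : var => normal_order (delta_mx 0 x.1) x.2)
        (Yexp k.2) (enum_mset k.1).

Definition VLmode (u : VL) (n : int) (v : VL) : VL :=
  lext (fun k => Ybasis k n v) u.

Definition VLvac : VL := bvec (mset0, 0).

Definition VLconf (u : 'I_(lrank L) -> cartan) : VL :=
  2%:R^-1 *: \sum_i heis (u i) (-1) (heis (u i) (-1) VLvac).

Definition lattice_voa (u : 'I_(lrank L) -> cartan) : voa_data K :=
  VoaData VLmode VLvac (VLconf u).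

Definition VM_pred (M : {pred lvec L}) : {pred VL} :=
  [pred v : VL | all (fun k : fock_index => k.2 \in M) (msupp v)].

Section Closed.
Implicit Types M : {pred lvec L}.

Lemma VM_predP M v :
  reflect (forall k, v@_k != 0 -> k.2 \in M) (v \in VM_pred M).
Proof.
apply: (iffP allP) => [H k|H k]; first by rewrite mcoeff_neq0; apply: H.
by rewrite -mcoeff_neq0; apply: H.
Qed.

Fact VM_submod M : submod_closed (VM_pred M).
Proof.
split=> [|a x y /VM_predP Hx /VM_predP Hy].
  by apply/VM_predP => k; rewrite mcoeff0 eqxx.
apply/VM_predP => k; rewrite mcoeffD mcoeffZ => H.
have [x0|/Hx//] := eqVneq x@_k 0.
by apply: Hy; move: H; rewrite x0 mulr0 add0r.
Qed.

HB.instance Definition _ M :=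
  GRing.isSubmodClosed.Build K VL (VM_pred M) (VM_submod M).

Lemma VM_bvec M k : k.2 \in M -> bvec k \in VM_pred M.
Proof.
move=> kM; apply/VM_predP => k'; rewrite mcoeffU.
by case: (k =P k') => [<-//|_]; rewrite mulr0n eqxx.
Qed.

Lemma VM_lext M M' f v : (forall k, k.2 \in M -> f k \in VM_pred M') ->
  v \in VM_pred M -> lext f v \in VM_pred M'.
Proof.
move=> Hf /allP Hv; rewrite /lext big_seq; apply: rpred_sum => k kv.
by apply: rpredZ; apply: Hf; apply: Hv.
Qed.

Lemma VM_heis M h m v : v \in VM_pred M -> heis h m v \in VM_pred M.
Proof.
move=> Hv; case: m => [[|n]|n] /=.
- by apply: VM_lext Hv => k kM; apply/rpredZ/VM_bvec.
- apply/rpredZ/rpred_sum => i _; apply: rpredZ.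
  by apply: VM_lext Hv => k kM; apply/rpredZ/VM_bvec.
- apply: rpred_sum => i _; apply: rpredZ.
  by apply: VM_lext Hv => k kM; apply/VM_bvec.
Qed.

Lemma VM_exp_coef M A k v :
    (forall n x, x \in VM_pred M -> A n x \in VM_pred M) ->
  v \in VM_pred M -> exp_coef A k v \in VM_pred M.
Proof.
move=> HA Hv; apply: rpred_sum => j _; apply: rpredZ.
move: (nat_of_ord j) => {j} j; elim: j k => [|j IH] k /=.
  by case: ifP => // _; apply: rpred0.
by apply: rpred_sum => i _; apply/HA/IH.
Qed.

Lemma VM_Yexp (M : addrClosed (lvec L)) a n v : a \in M ->
  v \in VM_pred M -> Yexp a n v \in VM_pred M.
Proof.
move=> aM; apply: VM_lext => k kM; apply: rpred_sum => pq _.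
apply: VM_exp_coef => [i x Hx|]; first exact/rpredZ/VM_heis.
apply: VM_exp_coef => [i x Hx|]; first by rewrite rpredN; apply/rpredZ/VM_heis.
by apply/rpredZ/VM_bvec; rewrite /= rpredD.
Qed.

Lemma VM_mode (M : addrClosed (lvec L)) u n v :
  u \in VM_pred M -> v \in VM_pred M -> VLmode u n v \in VM_pred M.
Proof.
move=> Hu Hv; apply: VM_lext Hu => -[s a] /= aM; rewrite /Ybasis /=.
elim: (enum_mset s) n v Hv => [|x t IH] n v Hv /=; first exact: VM_Yexp.
apply: rpred_sum => m _; apply: rpredZ.
by case: ifP => _; [apply/VM_heis/IH | apply/IH/VM_heis].
Qed.

Lemma VM_vac (M : addrClosed (lvec L)) : VLvac \in VM_pred M.
Proof. by apply: VM_bvec; apply: rpred0. Qed.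

Lemma VM_conf (M : addrClosed (lvec L)) u : VLconf u \in VM_pred M.
Proof. by apply/rpredZ/rpred_sum => i _; do 2!apply: VM_heis; apply: VM_vac. Qed.

End Closed.

Record VM (M : {pred lvec L}) := MkVM { VMval : VL; _ : VMval \in VM_pred M }.

HB.instance Definition _ M := [isSub for @VMval M].
HB.instance Definition _ M := [Choice of VM M by <:].
HB.instance Definition _ M := [SubChoice_isSubLmodule of VM M by <:].

Definition VMmode (M : addrClosed (lvec L)) (x : VM M) (n : int) (y : VM M) :
  VM M := MkVM (VM_mode n (valP x) (valP y)).

Definition submonoid_voa (u : 'I_(lrank L) -> cartan)
    (M : addrClosed (lvec L)) : voa_data K :=
  VoaData (@VMmode M) (MkVM (VM_vac M)) (MkVM (VM_conf M u)).

End LatticeVOA.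

(* Main.v *)
Require Import Defs.
From HB Require Import structures.
From mathcomp Require Import all_boot all_order all_algebra.
From mathcomp Require Import finmap multiset monalg.
From mathcomp Require Import boolp classical_sets cardinality fsbigop.
From mathcomp Require Import reals complex.
From mathcomp Require Import ring zify.
Set Implicit Arguments.
Unset Strict Implicit.
Unset Printing Implicit Defensive.
Import Order.TTheory GRing.Theory Num.Theory.
Local Open Scope ring_scope.

(** Let C be a submonoid of conic type and V = V_C. Nonnegative coordinates that
    sum to zero are zero, so two elements of C have sum zero only if both are zero
    ([conic_pointed]). Hence the part of V of nonzero charge is an ideal. It
    contains e^a for every nonzero a in C but not the vacuum, so V is not simple.

    The quotient of V by this ideal is the Heisenberg VOA M(1,0), the projection
    being [proj] ([proj_mode]). Every M(1,0)-module is therefore a V-module, and V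
    is not rational as soon as M(1,0) has an admissible module that is not
    semisimple. Such a module is the self-extension W of M(1,0) on which the zero
    mode of the Cartan subalgebra acts by nilpotent operators: W is M(1,0) tensored
    with K[t]/(t^2), and the adjoint action is deformed to first order in t
    ([Yext]). The zero mode of a_i(-1)1 acts on W as a nonzero multiple of t. On an
    irreducible submodule N the kernel of t is a submodule, and it is nonzero since
    t^2 = 0; so t kills N. If W were a direct sum of irreducible submodules, then t
    would be zero on W, which it is not.

    Most of the work is the Borcherds identity for the adjoint module M(1,0)
    ([borcherds]). The vertex operators of M(1,0) are normally ordered products of
    Heisenberg fields, and their commutators with the Heisenberg modes a_i(p) are
    computed from this description ([am_Y_comm]). Consider the defect of the
    identity for a pair of states u, v, the difference of its two sides. Its
    commutator with a_i(p) is a combination of defects of the pairs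
    (a_i(q)u, v) and (u, a_i(q)v) with q > 0, of lower total weight ([am_defect]),
    so by induction it commutes with all a_i(p) and it suffices that it vanishes on
    the vacuum. Since it is a three-index family, compatible with multiplication by
    z - w ([defect_shift]) and with translation ([defect_transl]), the creation
    property reduces this to the indices m = -1, n >= 0. There the value is a
    homogeneous vector killed by the annihilation operators, so zero except in
    weight zero ([killed_eq0]), where it vanishes because the pairing of states
    given by the vacuum component of u_(N-1) v is symmetric up to the sign (-1)^N
    ([skew_lead]).

    The identity for W follows from the one for M(1,0): the coefficient of t in it
    is its derivative along the deformation. The computation for the commutator
    with a_i(p) uses only one property of the binomial coefficients C(p, q)
    as functions of q ([weights]), which their derivatives with respect to p
    at p = 0 share ([weights_dbinz]), and these are the coefficients in [Yext]. *)

(** * Binomial coefficients with integer upper index *)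

Section Binomials.
Variable K : numFieldType.
Implicit Types (a b p : int) (i j k q : nat).

Let natr_neq0 i : (i.+1%:R : K) != 0. Proof. by rewrite pnatr_eq0. Qed.

Lemma binz0 a : binz K a 0 = 1.
Proof. by rewrite /binz big_ord0 fact0 divr1. Qed.

Lemma binzSE a i : i.+1%:R * binz K a i.+1 = (a - i%:Z)%:~R * binz K a i.
Proof.
rewrite /binz big_ord_recr /= factS natrM invfM.
set P := \prod_(_ < _) _.
have h : (i`!%:R : K) != 0 by rewrite pnatr_eq0 -lt0n fact_gt0.
by field; rewrite h /= nat1r natr_neq0.
Qed.

Lemma binz_absorb a i : i.+1%:R * binz K a i.+1 = a%:~R * binz K (a - 1) i.
Proof.
rewrite /binz big_ord_recl /= factS natrM invfM subr0.
under eq_bigr => j _.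
  have -> : a - (bump 0 j)%:Z = a - 1 - j%:Z by rewrite /bump /=; lia.
  over.
rewrite /=.
set P := \prod_(_ < _) _.
have h : (i`!%:R : K) != 0 by rewrite pnatr_eq0 -lt0n fact_gt0.
by field; rewrite h /= nat1r natr_neq0.
Qed.

(** Pascal's rule follows from the two absorption identities above. *)
Lemma binz_pascal a i :
  binz K (a + 1) i.+1 = binz K a i.+1 + binz K a i.
Proof.
apply: (mulfI (natr_neq0 i)); rewrite mulrDr binz_absorb binzSE addrK.
by rewrite -mulrDl !intrD rmorphN /= -(pmulrn 1 i) -[i.+1]addn1 natrD; congr (_ * _);
  ring.
Qed.

Lemma binz_nat i j : binz K i%:Z j = 'C(i, j)%:R.
Proof.
elim: i j => [|i IH] [|j]; rewrite ?binz0 ?bin0 //.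
  by rewrite bin0n /binz big_ord_recl /= subr0 mulr0z !mul0r.
by rewrite -[i.+1]addn1 PoszD binz_pascal !IH addn1 binS natrD.
Qed.

(** The coefficients of the annihilation half of a derivative of a Heisenberg
    field, written with a natural upper index. *)
Lemma binz_neg k j : binz K (- k%:Z - 1) j = (-1) ^+ j * 'C(k + j, j)%:R.
Proof.
elim: j => [|j IH]; first by rewrite binz0 bin0 mulr1.
apply: (mulfI (natr_neq0 j)); rewrite binzSE IH.
have -> : (- k%:Z - 1 - j%:Z)%:~R = - (k + j).+1%:R :> K.
  by rewrite pmulrn -mulrNz; congr (_%:~R); lia.
have e : (j.+1%:R * 'C((k + j).+1, j.+1)%:R : K) = (k + j).+1%:R * 'C(k + j, j)%:R.
  by rewrite -!natrM -mul_bin_diag.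
by rewrite addnS [RHS]mulrCA e exprS; ring.
Qed.

Lemma binzN1 j : binz K (-1) j = (-1) ^+ j.
Proof. by have := binz_neg 0 j; rewrite oppr0 add0r add0n binn mulr1. Qed.

(** Both sides count a [k]-subset followed by a disjoint [q]-subset. *)
Lemma binz_trinomial p q k :
  binz K p (q + k) * 'C(q + k, k)%:R = binz K p k * binz K (p - k%:Z) q.
Proof.
rewrite /binz addnC big_split_ord /=.
under [\prod_(i < q) (p - (k + i)%:Z)%:~R]eq_bigr => i _.
  have -> : p - (k + i)%:Z = p - k%:Z - i%:Z by lia.
  over.
rewrite /=.
have := bin_fact (leq_addr q k); rewrite addKn => <-.
rewrite !natrM.
have hk : (k`!%:R : K) != 0 by rewrite pnatr_eq0 -lt0n fact_gt0.
have hq : (q`!%:R : K) != 0 by rewrite pnatr_eq0 -lt0n fact_gt0.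
have hC : ('C(k + q, k)%:R : K) != 0.
  by rewrite pnatr_eq0 -lt0n bin_gt0 leq_addr.
by field; rewrite hk hq hC.
Qed.

(** Induction through [binz_absorb]: weighting the summand [i] by [j + 1 =
    i + (j + 1 - i)] lowers one of the two upper indices. *)
Lemma binz_vandermonde a b j :
  \sum_(i < j.+1) binz K a i * binz K b (j - i) = binz K (a + b) j.
Proof.
elim: j a b => [|j IH] a b; first by rewrite big_ord1 !binz0 mulr1.
apply: (mulfI (natr_neq0 j)); rewrite binz_absorb.
have -> : (a + b)%:~R * binz K (a + b - 1) j =
  a%:~R * binz K (a - 1 + b) j + b%:~R * binz K (a + (b - 1)) j.
  by rewrite intrD mulrDl; congr (_ * binz K _ j + _ * binz K _ j); lia.
rewrite -!IH !mulr_sumr.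
have -> : \sum_(i < j.+2) j.+1%:R * (binz K a i * binz K b (j.+1 - i)) =
  \sum_(i < j.+2) i%:R * (binz K a i * binz K b (j.+1 - i)) +
  \sum_(i < j.+2) (j.+1 - i)%:R * (binz K a i * binz K b (j.+1 - i)).
  rewrite -big_split; apply: eq_bigr => i _ /=.
  by rewrite -mulrDl -natrD subnKC // -ltnS.
congr (_ + _).
  rewrite big_ord_recl mul0r add0r; apply: eq_bigr => i _.
  by rewrite /= /bump leq0n add1n subSS [LHS]mulrA binz_absorb -mulrA.
rewrite big_ord_recr /= subnn mul0r addr0; apply: eq_bigr => i _.
by rewrite subSn -1?ltnS // mulrCA binz_absorb mulrCA.
Qed.

End Binomials.

(** * Sums over the natural numbers with finitely many nonzero terms *)

(** All sums over the mode index in the definition of a module have this form;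
    they are only meaningful when finitely many terms are nonzero. *)
HB.lock Definition nsum (K : pzRingType) (V : lmodType K) (f : nat -> V) : V :=
  (\sum_(i \in classical_sets.setT) f i)%R.

Section NatSums.
Variable K : pzRingType.
Implicit Types (V W : lmodType K).

(** Eventually zero: the condition under which [nsum] is linear. *)
Definition ev0 V (f : nat -> V) := exists N, forall i, (N <= i)%N -> f i = 0.

Lemma nsumE V (f : nat -> V) N :
  (forall i, (N <= i)%N -> f i = 0) -> nsum f = \sum_(i < N) f i.
Proof.
move=> h; rewrite nsum.unlock fsbig_ord; apply/esym/fsbig_widen => // i [_ /= /negP].
by rewrite -leqNgt; apply: h.
Qed.

Lemma eq_nsum V (f g : nat -> V) : f =1 g -> nsum f = nsum g.
Proof. by move=> fg; rewrite nsum.unlock; apply: eq_fsbigr => i _; apply: fg. Qed.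

Lemma nsum_recl V (f : nat -> V) : ev0 f ->
  nsum f = f 0%N + nsum (fun i => f i.+1).
Proof.
move=> [N h]; rewrite (@nsumE _ _ N.+1); last by move=> i /ltnW; apply: h.
by rewrite big_ord_recl (@nsumE _ _ N) // => i hi; apply/h/leqW.
Qed.

Lemma nsum0 V (f : nat -> V) : (forall i, f i = 0) -> nsum f = 0.
Proof. by move=> h; rewrite (@nsumE _ _ 0) ?big_ord0. Qed.

Lemma nsum1 V (f : nat -> V) k : (forall i, i != k -> f i = 0) -> nsum f = f k.
Proof.
move=> h; rewrite (@nsumE _ _ k.+1); last by move=> i hi; apply: h; rewrite gtn_eqF.
by rewrite (bigD1 ord_max) //= big1 ?addr0 // => i hi; apply: h.
Qed.

Lemma ev0D V (f g : nat -> V) : ev0 f -> ev0 g -> ev0 (fun i => f i + g i).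
Proof.
move=> [M hf] [N hg]; exists (maxn M N) => i; rewrite geq_max => /andP[h1 h2].
by rewrite hf // hg // addr0.
Qed.

Lemma nsumD V (f g : nat -> V) : ev0 f -> ev0 g ->
  nsum (fun i => f i + g i) = nsum f + nsum g.
Proof.
move=> [M hf] [N hg].
have h i : (maxn M N <= i)%N -> f i = 0 /\ g i = 0.
  by rewrite geq_max => /andP[h1 h2]; rewrite hf ?hg.
rewrite !(@nsumE _ _ (maxn M N)) ?big_split //.
- by move=> i /h[].
- by move=> i /h[].
- by move=> i /h[-> ->]; rewrite addr0.
Qed.

Section Lin.
Variables (V W : lmodType K) (A : V -> W).
Hypothesis hA : linear A.
Lemma lin0 : A 0 = 0.
Proof. by have := hA (-1) 0 0; rewrite scaleN1r oppr0 addr0 scaleN1r addNr. Qed.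
Lemma linD x y : A (x + y) = A x + A y.
Proof. by have := hA 1 x y; rewrite !scale1r. Qed.
Lemma linZ c x : A (c *: x) = c *: A x.
Proof. by have := hA c x 0; rewrite lin0 !addr0. Qed.
Lemma linN x : A (- x) = - A x.
Proof. by rewrite -scaleN1r linZ scaleN1r. Qed.
Lemma linB x y : A (x - y) = A x - A y.
Proof. by rewrite linD linN. Qed.
Lemma lin_sum (I : Type) (r : seq I) (P : pred I) (F : I -> V) :
  A (\sum_(i <- r | P i) F i) = \sum_(i <- r | P i) A (F i).
Proof. exact: (big_morph A linD lin0). Qed.
Lemma lin_nsum f : ev0 f -> A (nsum f) = nsum (fun i => A (f i)).
Proof.
move=> [N h]; rewrite !(@nsumE _ _ N) ?lin_sum // => i /h ->.
exact: lin0.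
Qed.
Lemma lin_ev0 f : ev0 f -> ev0 (fun i => A (f i)).
Proof. by move=> [N h]; exists N => i /h ->; apply: lin0. Qed.
End Lin.

Lemma ev0_le V (f g : nat -> V) : (forall i, f i = 0 -> g i = 0) ->
  ev0 f -> ev0 g.
Proof. by move=> h [N hf]; exists N => i /hf /h. Qed.

Lemma ev0_sum V N (g : nat -> nat -> V) : (forall k, ev0 (g k)) ->
  ev0 (fun q => \sum_(k < N) g k q).
Proof.
move=> hg; elim: N => [|N IH]; first by exists 0%N => i _; rewrite big_ord0.
by have [M hM] := ev0D IH (hg N); exists M => i /hM; rewrite big_ord_recr.
Qed.

Lemma nsum_sum V N (g : nat -> nat -> V) : (forall k, ev0 (g k)) ->
  nsum (fun q => \sum_(k < N) g k q) = \sum_(k < N) nsum (g k).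
Proof.
move=> hg; elim: N => [|N IH].
  by rewrite big_ord0; apply: nsum0 => i; rewrite big_ord0.
rewrite [RHS]big_ord_recr -IH -[RHS]nsumD; [|exact: ev0_sum|exact: hg].
by apply: eq_nsum => i; rewrite big_ord_recr.
Qed.

Lemma eq_add V (a b c d : V) : a = c -> b = d -> a + b = c + d.
Proof. by move=> -> ->. Qed.

Lemma eq_scale V (a b : K) (u v : V) : a = b -> u = v -> a *: u = b *: v.
Proof. by move=> -> ->. Qed.

(** Joint finiteness of the support of a double family. *)
Definition ev02 V (f : nat -> nat -> V) :=
  exists N, forall i j, (N <= i)%N || (N <= j)%N -> f i j = 0.

(** A common bound exists as soon as one index is bounded uniformly and the
    other for each value of the first: only finitely many bounds are involved. *)
Lemma ev02P V (f : nat -> nat -> V) N :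
  (forall i j, (N <= j)%N -> f i j = 0) ->
  (forall j, ev0 (fun i => f i j)) -> ev02 f.
Proof.
move=> h1 h2.
have [M hM] : exists M, forall j, (j < N)%N -> forall i, (M <= i)%N -> f i j = 0.
  elim: N {h1} => [|N [M IH]]; first by exists 0%N.
  have [M' hM'] := h2 N; exists (maxn M M') => j; rewrite ltnS leq_eqVlt.
  move=> /orP[/eqP->|jN] i; rewrite geq_max => /andP[i1 i2]; first exact: hM'.
  exact: IH.
exists (maxn M N) => i j; have [jN|Nj] := ltnP j N; last by rewrite h1.
rewrite !geq_max [(N <= j)%N]leqNgt jN andbF orbF => /andP[Mi _].
exact: (hM _ jN).
Qed.

Lemma ev02_swap V (f : nat -> nat -> V) : ev02 f -> ev02 (fun i j => f j i).
Proof. by move=> [N h]; exists N => i j; rewrite orbC; apply: h. Qed.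

Lemma ev02_nsum V (f : nat -> nat -> V) : ev02 f ->
  ev0 (fun i => nsum (f i)).
Proof.
move=> [N h]; exists N => i Ni; apply: nsum0 => j; apply: h; by rewrite Ni.
Qed.

Lemma nsum2E V (f : nat -> nat -> V) N :
  (forall i j, (N <= i)%N || (N <= j)%N -> f i j = 0) ->
  nsum (fun i => nsum (f i)) = \sum_(i < N) \sum_(j < N) f i j.
Proof.
move=> h; rewrite (@nsumE _ _ N).
  apply: eq_bigr => i _; apply: nsumE => j Nj; apply: h; by rewrite Nj orbT.
by move=> i Ni; apply: nsum0 => j; apply: h; rewrite Ni.
Qed.

Lemma nsum_exchange V (f : nat -> nat -> V) : ev02 f ->
  nsum (fun i => nsum (fun j => f i j)) = nsum (fun j => nsum (fun i => f i j)).
Proof.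
move=> [N h]; rewrite (nsum2E h) (@nsum2E _ (fun j i => f i j) N).
  exact: exchange_big.
by move=> i j; rewrite orbC; apply: h.
Qed.

Lemma nsum_antidiag V (g : nat -> nat -> V) N :
  (forall j q, (N <= j + q)%N -> g j q = 0) ->
  nsum (fun j => nsum (fun q => g j q)) =
  nsum (fun t => \sum_(j < t.+1) g j (t - j)%N).
Proof.
move=> h; rewrite (@nsum2E _ _ N); last first.
  by move=> i j /orP[H|H]; apply: h; apply: (leq_trans H); rewrite ?leq_addr ?leq_addl.
rewrite (@nsumE _ _ N); last first.
  move=> t Nt; apply: big1 => j _; apply: h; rewrite subnKC // -ltnS //.
transitivity (\sum_(j < N) \sum_(q < N - j) g j q).
  apply: eq_bigr => j _.
  rewrite [RHS](big_ord_widen N (g j)) ?leq_subr // [LHS](bigID (fun q : 'I_N =>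
    (q < N - j)%N)) /=.
  rewrite [X in _ + X]big1 ?addr0 // => q; rewrite -leqNgt leq_subLR; exact: h.
elim: N {h} => [|N IH]; first by rewrite !big_ord0.
rewrite [RHS]big_ord_recr /= -IH [LHS]big_ord_recr /= subSnn big_ord1.
rewrite [X in _ = _ + X]big_ord_recr /= subnn addrA -big_split; congr (_ + _).
apply: eq_bigr => j _ /=; rewrite subSn; last exact: ltnW.
by rewrite big_ord_recr.
Qed.

End NatSums.

(** * Linear extension from a basis *)

(** A vector space with a distinguished basis [basis_vec], coordinate functions
    [coef] and finite supports [bsupp]. The Fock space enters below only through
    its basis of monomials. *)
Record based (K : numFieldType) (I : choiceType) := Based {
  bcar :> lmodType K;
  basis_vec : I -> bcar;
  coef : I -> bcar -> K;
  bsupp : bcar -> seq I;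
  coef_linear : forall k, linear (coef k : bcar -> K^o);
  coef_basis : forall k k', coef k' (basis_vec k) = (k == k')%:R;
  bsupp_uniq : forall v, uniq (bsupp v);
  coef_neq0 : forall v k, (coef k v != 0) = (k \in bsupp v);
  basis_span : forall v, v = \sum_(k <- bsupp v) coef k v *: basis_vec k }.

Notation "''v_' k" := (basis_vec _ k) (at level 8, k at level 2, format "''v_' k").

Section LinearExtension.
Variables (K : numFieldType) (I : choiceType) (F : based K I) (W : lmodType K).
Implicit Types (f : I -> W) (v : F).

Definition mext f v : W := \sum_(k <- bsupp v) coef k v *: f k.

Lemma coef0 k : coef k (0 : F) = 0.
Proof. exact: (lin0 (@coef_linear _ _ F k)). Qed.

Lemma coefD k (u v : F) : coef k (u + v) = coef k u + coef k v.
Proof. exact: (linD (@coef_linear _ _ F k)). Qed.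

Lemma coefZ k c (v : F) : coef k (c *: v) = c * coef k v.
Proof. exact: (linZ (@coef_linear _ _ F k)). Qed.

Lemma coef_inj (u v : F) : (forall k, coef k u = coef k v) -> u = v.
Proof.
move=> h; rewrite (basis_span u) (basis_span v).
rewrite (perm_big (bsupp v)) /=; first by apply: eq_bigr => k _; rewrite h.
by apply: uniq_perm; rewrite ?bsupp_uniq // => k; rewrite -!coef_neq0 h.
Qed.

Lemma mextEw f v (D : seq I) : uniq D -> {subset bsupp v <= D} ->
  mext f v = \sum_(k <- D) coef k v *: f k.
Proof.
move=> uD sD; rewrite [RHS](bigID (mem (bsupp v))) /= [X in _ + X]big1.
  rewrite addr0 -big_filter; apply: perm_big; apply: uniq_perm.
  - exact: bsupp_uniq.
  - exact: filter_uniq.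
  by move=> k; rewrite mem_filter; case: (boolP (k \in bsupp v)) => // /sD ->.
by move=> k; rewrite -coef_neq0 negbK => /eqP ->; rewrite scale0r.
Qed.

Lemma mext_linear f : linear (mext f).
Proof.
move=> c x y; set D := undup (bsupp (c *: x + y) ++ bsupp x ++ bsupp y).
have uD : uniq D by exact: undup_uniq.
rewrite !(@mextEw f _ D uD); try by move=> k; rewrite mem_undup !mem_cat => ->;
  rewrite ?orbT.
rewrite scaler_sumr -big_split.
by apply: eq_bigr => k _; rewrite coefD coefZ scalerDl scalerA.
Qed.

Lemma mextU f k : mext f (basis_vec F k) = f k.
Proof.
rewrite (@mextEw f _ [:: k]) //; first by rewrite big_seq1 coef_basis eqxx scale1r.
move=> k'; rewrite -coef_neq0 coef_basis inE [k' == k]eq_sym.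
by case: (k == k') => //; rewrite eqxx.
Qed.

Lemma mext_fun_linear v c f g :
  mext (fun k => c *: f k + g k) v = c *: mext f v + mext g v.
Proof.
rewrite /mext scaler_sumr -big_split; apply: eq_bigr => k _ /=.
by rewrite scalerDr !scalerA mulrC.
Qed.

Lemma eq_mext f g v : f =1 g -> mext f v = mext g v.
Proof. by move=> fg; apply: eq_bigr => k _; rewrite fg. Qed.

Lemma based_ind (P : F -> Prop) :
  P 0 -> (forall c x y, P x -> P y -> P (c *: x + y)) ->
  (forall k, P 'v_k) -> forall v, P v.
Proof.
move=> P0 PD PU v; rewrite (basis_span v); elim: (bsupp v) => [|k s IH].
  by rewrite big_nil.
by rewrite big_cons; apply: PD.
Qed.

Lemma linear_ext (A B : F -> W) : linear A -> linear B ->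
  (forall k, A 'v_k = B 'v_k) -> forall v, A v = B v.
Proof.
move=> hA hB h; apply: based_ind => [|c x y Ex Ey|//]; first by rewrite !lin0.
by rewrite hA hB Ex Ey.
Qed.

End LinearExtension.

Section LinearMaps.
Variables (K : numFieldType) (V W : lmodType K).

Lemma sum_linear (J : finType) (A : J -> V -> W) :
  (forall j, linear (A j)) -> linear (fun v => \sum_j A j v).
Proof.
by move=> h c x y; rewrite scaler_sumr -big_split; apply: eq_bigr => j _; apply: h.
Qed.

Lemma scaled_linear (c : K) (A : V -> W) : linear A -> linear (fun v => c *: A v).
Proof. by move=> h d x y; rewrite h scalerDr !scalerA mulrC. Qed.

Lemma add_linear (A B : V -> W) : linear A -> linear B -> linear (fun v => A v + B v).
Proof. by move=> hA hB c x y; rewrite hA hB scalerDr addrACA. Qed.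

End LinearMaps.

(** * The Fock space of the Heisenberg algebra *)

Section Fock.
Variables (K : numFieldType) (r : nat) (G : 'I_r -> 'I_r -> K).
Hypothesis G_sym : forall i j, G i j = G j i.
Let var : choiceType := ('I_r * nat)%type.
Let mon : choiceType := {mset var}%mset.
Variable F : based K mon.
Implicit Types (i : 'I_r) (s : mon) (x y : var) (u v w : F).
Notation "''v_' k" := (basis_vec F k).
Open Scope mset_scope.

Definition fcreate x : F -> F := mext (fun s => 'v_(x +` s)).
Definition fannih x : F -> F := mext (fun s => (s x)%:R *: 'v_(s `\ x)).

(** The mode a_i(m) of the [i]-th basis vector of the Cartan space on M(1,0):
    a creation operator for [m < 0], a derivation for [m > 0], and zero for
    [m = 0] because M(1,0) has charge zero. *)
Definition am i (m : int) v : F :=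
  match m with
  | Negz n => fcreate (i, n) v
  | Posz 0 => 0
  | Posz n.+1 => n.+1%:R *: \sum_j G i j *: fannih (j, n) v
  end.

Arguments am : simpl never.

Lemma am0 i v : am i 0 v = 0. Proof. by []. Qed.

Lemma amP i (n : nat) v :
  am i n.+1 v = n.+1%:R *: \sum_j G i j *: fannih (j, n) v.
Proof. by []. Qed.

Lemma amN i n v : am i (Negz n) v = fcreate (i, n) v. Proof. by []. Qed.

Definition fvac : F := 'v_(mset0).

Lemma scale_lin (c : K) : linear (fun v : F => c *: v).
Proof. exact: (@scaled_linear _ _ _ c id (fun _ _ _ => erefl)). Qed.

Lemma am_linear i m : linear (am i m).
Proof.
case: m => [[|n]|n] /=; last exact: mext_linear.
  by move=> c x y; rewrite scaler0 addr0.
apply/scaled_linear/sum_linear => j; apply/scaled_linear/mext_linear.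
Qed.

Lemma comp_linear (A B : F -> F) : linear A -> linear B -> linear (A \o B).
Proof. by move=> hA hB c x y; rewrite /= hB hA. Qed.

Lemma fannih_linear x : linear (fannih x). Proof. exact: mext_linear. Qed.

Lemma fcreateC x y v : fcreate x (fcreate y v) = fcreate y (fcreate x v).
Proof.
apply: (linear_ext (A := fcreate x \o fcreate y) (B := fcreate y \o fcreate x)).
- apply: comp_linear; exact: mext_linear.
- apply: comp_linear; exact: mext_linear.
by move=> s; rewrite /= /fcreate !mextU msetDCA.
Qed.

Lemma fannihC x y v : fannih x (fannih y v) = fannih y (fannih x v).
Proof.
have L z : linear (fannih z) by exact: mext_linear.
apply: (linear_ext (A := fannih x \o fannih y) (B := fannih y \o fannih x)).
- exact: comp_linear.
- exact: comp_linear.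
move=> s; rewrite /= /fannih !mextU !(linZ (mext_linear _)) !mextU !scalerA.
have -> : s `\ y `\ x = s `\ x `\ y.
  by apply/msetP => z; rewrite !msetB1E subnAC.
congr (_ *: _); rewrite -!natrM !msetB1E eq_sym; congr (_%:R).
by case: eqP => [->//|_]; rewrite !subn0 mulnC.
Qed.

Lemma fannih_create x y v :
  fannih x (fcreate y v) = fcreate y (fannih x v) + (x == y)%:R *: v.
Proof.
apply: (linear_ext (A := fannih x \o fcreate y)
   (B := fun v => (fcreate y \o fannih x) v + (x == y)%:R *: v)).
- apply: comp_linear; exact: mext_linear.
- apply: add_linear; first by apply: comp_linear; exact: mext_linear.
  exact: scale_lin.
move=> s; rewrite /= /fannih /fcreate !mextU (linZ (mext_linear _)) mextU.
rewrite mset1DE; case: (eqVneq x y) => [<-|xy].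
  rewrite msetD1K natrD scalerDl addrC; congr (_ + _).
  have [->|sx] := eqVneq (s x) 0%N; first by rewrite !scale0r.
  by rewrite msetB1K // -mset_neq0.
rewrite add0n scale0r addr0; congr (_ *: basis_vec _ _).
apply/msetP => z; rewrite !(msetB1E, mset1DE).
by have [->|_] := eqVneq z x; rewrite ?(negbTE xy) // !subn0.
Qed.

Lemma am_neg_comm i j m n v :
  am i (Negz m) (am j (Negz n) v) = am j (Negz n) (am i (Negz m) v).
Proof. exact: fcreateC. Qed.

Lemma am_annihC i (m : nat) y v : am i m (fannih y v) = fannih y (am i m v).
Proof.
have L z : linear (fannih z) by exact: mext_linear.
case: m => [|m]; first by rewrite !am0 (lin0 (L _)).
rewrite !amP (linZ (L _)) (lin_sum (L _)); congr (_ *: _).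
by apply: eq_bigr => k _; rewrite (linZ (L _)) fannihC.
Qed.

Lemma am_pos_comm i j (m n : nat) v : am i m (am j n v) = am j n (am i m v).
Proof.
case: n => [|n]; first exact: (lin0 (am_linear _ _)).
have L := am_linear i m.
rewrite !amP (linZ L) (lin_sum L); congr (_ *: _).
by apply: eq_bigr => k _; rewrite (linZ L) am_annihC.
Qed.

Lemma am_pos_neg i j (m n : nat) v :
  am i m (am j (Negz n) v) =
  am j (Negz n) (am i m v) + (if m == n.+1 then m%:R * G i j else 0) *: v.
Proof.
have L : linear (fcreate (j, n)) by exact: mext_linear.
case: m => [|m]; first by rewrite !amN !am0 (lin0 L) scale0r addr0.
rewrite !amN !amP (linZ L) (lin_sum L).
under eq_bigr => k _ do rewrite fannih_create scalerDr -(linZ L) scalerA.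
rewrite big_split scalerDr -scaler_suml; congr (_ + _).
rewrite scalerA; congr (_ *: _); rewrite (bigD1 j) //= big1 ?addr0.
  by rewrite xpair_eqE eqxx eqSS; case: (m == n); rewrite ?mulr1 ?mulr0.
by move=> k kj; rewrite xpair_eqE (negbTE kj) mulr0.
Qed.

(** The defining relations of the Heisenberg algebra. *)
Lemma am_comm i j (m n : int) v :
  am i m (am j n v) =
  am j n (am i m v) + (if m + n == 0 then m%:~R * G i j else 0) *: v.
Proof.
case: m n => [m|m] [n|n].
- rewrite am_pos_comm; case: ifP; last by rewrite scale0r addr0.
  by case: m => [|m //]; rewrite mul0r scale0r addr0.
- have e : (m == n.+1) = (m%:Z + Negz n == 0) by apply/eqP/eqP; lia.
  by rewrite am_pos_neg e.
- rewrite am_pos_neg -addrA -scalerDl.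
  have e : (n == m.+1) = (Negz m + n%:Z == 0) by apply/eqP/eqP; lia.
  rewrite e {e}.
  case: eqP => [e|_]; last by rewrite addr0 scale0r addr0.
  have -> : n = m.+1 by lia.
  by rewrite G_sym NegzE mulrNz -pmulrn -mulrDl subrr mul0r scale0r addr0.
by rewrite am_neg_comm scale0r addr0.
Qed.

(** ** The weight grading *)

Lemma perm_enum_mset1D x s : perm_eq (enum_mset (x +` s)) (x :: enum_mset s).
Proof. by apply/allP => y _; rewrite /= !count_mem_mset mset1DE [y == x]eq_sym. Qed.

(** The variable [(i, n)] stands for a_i(-n-1), of weight [n + 1]. *)
Definition weight s : nat := \sum_(x <- enum_mset s) x.2.+1.

Lemma weight0 : weight mset0 = 0%N.
Proof. by rewrite /weight enum_mset0 big_nil. Qed.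

Lemma weight1D x s : weight (x +` s) = (x.2.+1 + weight s)%N.
Proof. by rewrite /weight (perm_big _ (perm_enum_mset1D x s)) big_cons. Qed.

(** Monomials are built from 1 by multiplication with one variable at a time. *)
Lemma mset_ind (P : mon -> Prop) :
  P mset0 -> (forall x s, P s -> P (x +` s)) -> forall s, P s.
Proof.
move=> P0 PD s; have [n] := ubnP (weight s); elim: n s => // n IH s ws.
have [->//|/eqP s0] := eqVneq s mset0.
have [x] : exists x, s x != 0%N.
  apply/not_existsP => h; apply: s0; apply/msetP => x; rewrite mset0E.
  by apply/eqP/negPn/negP/h.
rewrite mset_neq0 => xs.
by rewrite -(msetB1K xs); apply/PD/IH; move: ws; rewrite -{1}(msetB1K xs) weight1D; lia.
Qed.

Definition hom (d : int) v := all (fun s => (weight s)%:Z == d) (bsupp v).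

Lemma homP d v :
  reflect (forall s, coef s v != 0 -> (weight s)%:Z = d) (hom d v).
Proof.
apply: (iffP allP) => h s; first by rewrite coef_neq0 => /h /eqP.
by rewrite -coef_neq0 => /h ->.
Qed.

Lemma hom0 d : hom d 0.
Proof. by apply/homP => s; rewrite coef0 eqxx. Qed.

Lemma homD d u v : hom d u -> hom d v -> hom d (u + v).
Proof.
move=> /homP hu /homP hv; apply/homP => s; rewrite coefD.
have [u0|/hu//] := eqVneq (coef s u) 0; by rewrite u0 add0r => /hv.
Qed.

Lemma homZ d c v : hom d v -> hom d (c *: v).
Proof.
move=> /homP hv; apply/homP => s; rewrite coefZ.
have [v0|/hv//] := eqVneq (coef s v) 0; by rewrite v0 mulr0 eqxx.
Qed.

Lemma hom_sum d (J : Type) (l : seq J) (P : pred J) (f : J -> F) :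
  (forall j, P j -> hom d (f j)) -> hom d (\sum_(j <- l | P j) f j).
Proof. by move=> h; elim/big_rec: _ => [|j x Pj hx]; [exact: hom0|apply: homD => //;
  exact: h]. Qed.

Lemma hom_nsum d (f : nat -> F) : (forall j, hom d (f j)) -> hom d (nsum f).
Proof. by move=> h; rewrite nsum.unlock; apply: hom_sum. Qed.

Lemma hom_lt0 d v : d < 0 -> hom d v -> v = 0.
Proof.
move=> d0 /homP hv; apply/coef_inj => s; rewrite coef0.
by apply/eqP/negPn/negP => /hv; lia.
Qed.

Lemma homU s : hom (weight s) 'v_s.
Proof. by apply/homP => t; rewrite coef_basis; case: (s =P t) => [->//|_];
  rewrite eqxx. Qed.

Lemma hom_mext d e (f : mon -> F) v :
  (forall s, (weight s)%:Z = d -> hom e (f s)) -> hom d v -> hom e (mext f v).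
Proof.
move=> hf /homP hv; rewrite /mext big_seq; apply: hom_sum => s.
by rewrite -coef_neq0 => /hv /hf; apply: homZ.
Qed.

Lemma hom_am i m d v : hom d v -> hom (d - m) (am i m v).
Proof.
case: m => [[|m]|m] hv.
- exact: hom0.
- rewrite amP; apply/homZ/hom_sum => j _; apply/homZ; apply: hom_mext hv => s ws.
  have [->|sx] := eqVneq (s (j, m)) 0%N; first by rewrite scale0r; apply: hom0.
  have e : (weight (s `\ (j, m)))%:Z = d - m.+1%:Z.
    move: (weight1D (j, m) (s `\ (j, m))); rewrite msetB1K -?mset_neq0 //= => w'.
    by lia.
  by rewrite -e; apply/homZ/homU.
- rewrite amN; apply: hom_mext hv => s ws; have -> : d - Negz m = (weight ((i,
  m) +` s))%:Z.
    by rewrite weight1D /=; lia.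
  exact: homU.
Qed.

(** High modes lower the weight below zero. *)
Lemma am_ev0 i v : exists N, forall k : nat, (N <= k)%N -> am i k v = 0.
Proof.
elim/based_ind: v => [|c u v [M hM] [N hN]|s].
- by exists 0%N => k _; rewrite (lin0 (am_linear _ _)).
- exists (maxn M N) => k; rewrite geq_max => /andP[Mk Nk].
  by rewrite am_linear hM // hN // scaler0 addr0.
- exists (weight s).+1 => k kw.
  by apply: (hom_lt0 _ (@hom_am i k _ _ (homU s))); lia.
Qed.

(** ** Fields and normally ordered products *)

(** The modes of a state of weight [d] shift weights in this way. *)
Definition hfield d (B : int -> F -> F) :=
  (forall n, linear (B n)) /\
  (forall n e v, hom e v -> hom (e + d - n - 1) (B n v)).

Definition field (B : int -> F -> F) :=
  (forall n, linear (B n)) /\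
  (forall v, exists N : int, forall n, N <= n -> B n v = 0).

Lemma hfield_field d B : hfield d B -> field B.
Proof.
move=> [L h]; split=> // v; elim/based_ind: v => [|c u v [M hM] [N hN]|s].
- by exists 0 => n _; apply: lin0.
- exists (Order.max M N) => n; rewrite ge_max => /andP[Mn Nn].
  by rewrite L hM // hN // scaler0 addr0.
- exists ((weight s)%:Z + d) => n hn; apply: hom_lt0 (h n _ _ (homU s)); lia.
Qed.

(** The normally ordered product of (1/j!) d^j a_i(z) with a field, with the
    creation modes (first sum) to the left and the others to the right. *)
Definition NO i (j : nat) (B : int -> F -> F) (n : int) v : F :=
  nsum (fun k => 'C(k, j)%:R *: am i (Negz k) (B (n + k%:Z - j%:Z) v)) +
  nsum (fun k => binz K (- k%:Z - 1) j *: B (n - k%:Z - j%:Z - 1) (am i k%:Z v)).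

Lemma ev0Z (c : K) (f : nat -> F) : ev0 f -> ev0 (fun k => c *: f k).
Proof. exact: (lin_ev0 (@scale_lin c)). Qed.

Lemma nsumZ (c : K) (f : nat -> F) : ev0 f -> c *: nsum f = nsum (fun k => c *: f k).
Proof. exact: (lin_nsum (@scale_lin c)). Qed.

Section NormalOrder.
Variables (i : 'I_r) (j : nat) (B : int -> F -> F).
Hypothesis hB : field B.

Lemma field_ev0 v (g : nat -> int) (a : int) : (forall k, k%:Z + a <= g k) ->
  ev0 (fun k => B (g k) v).
Proof.
move=> hg; have [N hN] := hB.2 v; exists `|N - a|%N => k Nk.
by apply: hN; have := hg k; lia.
Qed.

Lemma NO_ev1 n v :
  ev0 (fun k => 'C(k, j)%:R *: am i (Negz k) (B (n + k%:Z - j%:Z) v)).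
Proof.
apply: (@ev0_le _ _ (fun k => B (n + k%:Z - j%:Z) v)).
  by move=> k ->; rewrite (lin0 (am_linear _ _)) scaler0.
apply: (@field_ev0 _ _ (n - j%:Z)) => k; lia.
Qed.

Lemma NO_ev2 n v :
  ev0 (fun k => binz K (- k%:Z - 1) j *: B (n - k%:Z - j%:Z - 1) (am i k%:Z v)).
Proof.
have [N hN] := am_ev0 i v; exists N => k /hN ->.
by rewrite (lin0 (hB.1 _)) scaler0.
Qed.

Lemma NO_linear n : linear (NO i j B n).
Proof.
have L := am_linear; have LB := hB.1.
move=> c u v; rewrite /NO scalerDr addrACA.
have [e1 e2] := (NO_ev1, NO_ev2).
rewrite !nsumZ //; congr (_ + _); (rewrite -nsumD //; last exact: ev0Z);
  apply: eq_nsum => k.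
  by rewrite LB L scalerDr !scalerA mulrC.
by rewrite L LB scalerDr !scalerA mulrC.
Qed.

End NormalOrder.

Lemma NO_hfield i j d B : hfield d B -> hfield (d + j%:Z + 1) (NO i j B).
Proof.
move=> hB; split=> [n|n e v hv]; first exact/NO_linear/hfield_field/hB.
have h m a w : hom a w -> hom (a + d - m - 1) (B m w) by apply: hB.2.
apply: homD; apply: hom_nsum => k; apply: homZ.
  have := @hom_am i (Negz k) _ _ (h (n + k%:Z - j%:Z) _ _ hv).
  by congr (hom _ _); lia.
by have := h (n - k%:Z - j%:Z - 1) _ _ (@hom_am i k _ _ hv); congr (hom _ _); lia.
Qed.
End Fock.

Arguments am : simpl never.

Section Commute.
Variables (K : numFieldType) (r : nat) (G : 'I_r -> 'I_r -> K).
Hypothesis G_sym : forall i j, G i j = G j i.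
Let var : choiceType := ('I_r * nat)%type.
Let mon : choiceType := {mset var}%mset.
Variable F : based K mon.
Implicit Types (i : 'I_r) (s : mon) (x y : var) (u v w : F).
Local Notation am := (@am K r G F).
Local Notation NO := (@NO K r G F).
Local Notation L := (@am_linear K r G F).

Section Swap.
Variables (i i' : 'I_r) (j j' : nat) (B : int -> F -> F) (n : int) (v : F).
Hypothesis hB : field B.

(* The four parts of a double normally ordered product, according to the signs
   of the two Heisenberg modes. *)
Let t11 (k k' : nat) : F := ('C(k, j)%:R * 'C(k', j')%:R) *:
  am i (Negz k) (am i' (Negz k') (B (n + k%:Z - j%:Z + k'%:Z - j'%:Z) v)).
Let t12 (k k' : nat) : F := ('C(k, j)%:R * binz K (- k'%:Z - 1) j') *:
  am i (Negz k) (B (n + k%:Z - j%:Z - k'%:Z - j'%:Z - 1) (am i' k' v)).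
Let t21 (k k' : nat) : F := (binz K (- k%:Z - 1) j * 'C(k', j')%:R) *:
  am i' (Negz k') (B (n - k%:Z - j%:Z - 1 + k'%:Z - j'%:Z) (am i k v)).
Let t22 (k k' : nat) : F := (binz K (- k%:Z - 1) j * binz K (- k'%:Z - 1) j') *:
  B (n - k%:Z - j%:Z - 1 - k'%:Z - j'%:Z - 1) (am i' k' (am i k v)).

Lemma t11_ev : ev02 t11.
Proof.
have [N hN] := hB.2 v; exists (absz (N - n + j%:Z + j'%:Z)) => k k' hk.
by rewrite /t11 hN ?(lin0 (L _ _)) ?scaler0 //; lia.
Qed.

Lemma t12_ev : ev02 t12.
Proof.
have [N hN] := am_ev0 G i' v; apply: (@ev02P _ _ _ N) => [k k'|k'].
  by move=> /hN; rewrite /t12 => ->; rewrite (lin0 (hB.1 _)) (lin0 (L _ _)) scaler0.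
apply: (@ev0_le _ _ (fun k : nat => B (n + k%:Z - j%:Z - k'%:Z - j'%:Z - 1)
  (am i' k' v))).
  by move=> k; rewrite /t12 => ->; rewrite (lin0 (L _ _)) scaler0.
by apply: (field_ev0 hB) (n - j%:Z - k'%:Z - j'%:Z - 1) _ => k; lia.
Qed.

Lemma t21_ev : ev02 t21.
Proof.
have [N hN] := am_ev0 G i v; apply: ev02_swap; apply: (@ev02P _ _ _ N) => [k k'|k'].
  by move=> /hN; rewrite /t21 => ->; rewrite (lin0 (hB.1 _)) (lin0 (L _ _)) scaler0.
apply: (@ev0_le _ _ (fun k : nat => B (n - k'%:Z - j%:Z - 1 + k%:Z - j'%:Z)
  (am i k' v))).
  by move=> k; rewrite /t21 => ->; rewrite (lin0 (L _ _)) scaler0.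
by apply: (field_ev0 hB) (n - k'%:Z - j%:Z - 1 - j'%:Z) _ => k; lia.
Qed.

Lemma t22_ev : ev02 t22.
Proof.
have [N hN] := am_ev0 G i v; apply: ev02_swap; apply: (@ev02P _ _ _ N) => [k k'|k'].
  by move=> /hN; rewrite /t22 => ->; rewrite (lin0 (L _ _)) (lin0 (hB.1 _)) scaler0.
have [M hM] := am_ev0 G i' (am i k' v); exists M => k /hM.
by rewrite /t22 => ->; rewrite (lin0 (hB.1 _)) scaler0.
Qed.

Lemma NO_expand : NO i j (NO i' j' B) n v =
  nsum (fun k => nsum (t11 k)) + nsum (fun k => nsum (t12 k)) +
  (nsum (fun k => nsum (t21 k)) + nsum (fun k => nsum (t22 k))).
Proof.
rewrite {1}/NO; congr (_ + _).
  rewrite -nsumD; [|exact: (ev02_nsum t11_ev)|exact: (ev02_nsum t12_ev)].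
  apply: eq_nsum => k; have [e1 e2] := (NO_ev1 G i' j' hB, NO_ev2 G i' j' hB).
  rewrite /NO (linD (L _ _)) !(lin_nsum (L _ _)) // scalerDr !nsumZ //;
    try exact: (lin_ev0 (L _ _)).
  by congr (_ + _); apply: eq_nsum => k'; rewrite (linZ (L _ _)) scalerA.
rewrite -nsumD; [|exact: (ev02_nsum t21_ev)|exact: (ev02_nsum t22_ev)].
apply: eq_nsum => k; have [e1 e2] := (NO_ev1 G i' j' hB, NO_ev2 G i' j' hB).
rewrite /NO scalerDr !nsumZ //.
by congr (_ + _); apply: eq_nsum => k'; rewrite scalerA.
Qed.

End Swap.

(** Creation operators commute with each other, and so do annihilation
    operators; hence the factors of a normally ordered product may be permuted. *)
Lemma NO_comm i i' j j' B n v : field B ->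
  NO i j (NO i' j' B) n v = NO i' j' (NO i j B) n v.
Proof.
move=> hB; rewrite [LHS]NO_expand // [RHS]NO_expand // [LHS]addrACA.
apply: eq_add; apply: eq_add.
- rewrite [LHS]nsum_exchange; last exact: t11_ev.
  apply: eq_nsum => k; apply: eq_nsum => k'; rewrite am_neg_comm [X in X *: _]mulrC.
  by congr (_ *: am _ _ (am _ _ (B _ v))); lia.
- rewrite [LHS]nsum_exchange; last exact: t21_ev.
  apply: eq_nsum => k; apply: eq_nsum => k'; rewrite [X in X *: _]mulrC.
  by congr (_ *: am _ _ (B _ _)); lia.
- rewrite [LHS]nsum_exchange; last exact: t12_ev.
  apply: eq_nsum => k; apply: eq_nsum => k'; rewrite [X in X *: _]mulrC.
  by congr (_ *: am _ _ (B _ _)); lia.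
- rewrite [LHS]nsum_exchange; last exact: t22_ev.
  apply: eq_nsum => k; apply: eq_nsum => k'; rewrite am_pos_comm [X in X *: _]mulrC.
  by congr (_ *: B _ _); lia.
Qed.
End Commute.

(** * The vertex operators of the Fock space *)

Section VertexOperators.
Variables (K : numFieldType) (r : nat) (G : 'I_r -> 'I_r -> K).
Hypothesis G_sym : forall i j, G i j = G j i.
Let var : choiceType := ('I_r * nat)%type.
Let mon : choiceType := {mset var}%mset.
Variable F : based K mon.
Implicit Types (i : 'I_r) (s : mon) (x y : var) (u v w : F).
Local Notation am := (@am K r G F).
Local Notation NO := (@NO K r G F).
Local Notation L := (@am_linear K r G F).
Local Notation fvac := (@fvac K r F).

(** The vertex operator of the vacuum. *)
Definition Y1 (n : int) (v : F) : F := if n == -1 then v else 0.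

Definition Ymon s : int -> F -> F :=
  foldr (fun x => NO x.1 x.2) Y1 (enum_mset s).

Definition Y u (n : int) v : F := mext (fun s => Ymon s n v) u.

Lemma Y1_hfield : hfield 0 Y1.
Proof.
split=> [n|n e v hv]; rewrite /Y1; case: eqP => // en.
- by move=> c x y; rewrite scaler0 addr0.
- by rewrite (_ : e + 0 - n - 1 = e) //; lia.
- exact: hom0.
Qed.

Lemma foldr_NO_hfield (l : seq var) :
  hfield ((\sum_(x <- l) x.2.+1)%N)%:Z (foldr (fun x => NO x.1 x.2) Y1 l).
Proof.
elim: l => [|x l IH]; first by rewrite big_nil; exact: Y1_hfield.
have := NO_hfield G x.1 x.2 IH; rewrite big_cons /=; congr hfield; lia.
Qed.

Lemma Ymon_hfield s : hfield (weight s)%:Z (Ymon s).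
Proof. exact: foldr_NO_hfield. Qed.

(** Since the factors may be permuted, the enumeration of a monomial that
    [Ymon] uses is immaterial; this gives the recursion [Ymon1D]. *)
Lemma foldr_NO_rem (l : seq var) x : x \in l ->
  foldr (fun x => NO x.1 x.2) Y1 l =
  NO x.1 x.2 (foldr (fun x => NO x.1 x.2) Y1 (rem x l)).
Proof.
elim: l => // y l IH; rewrite inE /= eq_sym.
have [->//|_ /= xl] := eqVneq y x; rewrite IH //.
apply/funext => n; apply/funext => v; apply: NO_comm.
exact: hfield_field (foldr_NO_hfield _).
Qed.

Lemma foldr_NO_perm (l l' : seq var) : perm_eq l l' ->
  foldr (fun x => NO x.1 x.2) Y1 l = foldr (fun x => NO x.1 x.2) Y1 l'.
Proof.
elim: l l' => [|x l IH] l' h; first by move: h; rewrite perm_sym => /perm_nilP ->.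
have xl' : x \in l' by rewrite -(perm_mem h) mem_head.
rewrite [RHS](foldr_NO_rem xl') /= (IH (rem x l')) //.
by move: h; rewrite (permPr (perm_to_rem xl')) perm_cons.
Qed.

Lemma Ymon0 : Ymon mset0 = Y1.
Proof. by rewrite /Ymon enum_mset0. Qed.

Lemma Ymon1D x s : Ymon (x +` s)%mset = NO x.1 x.2 (Ymon s).
Proof. exact: (foldr_NO_perm (perm_enum_mset1D x s)). Qed.

Lemma Y_basis s : Y 'v_s = Ymon s.
Proof. by apply/funext => n; apply/funext => v; rewrite /Y mextU. Qed.

Lemma Y_linl n v : linear (fun u => Y u n v).
Proof. exact: mext_linear. Qed.

Lemma Y_linr u n : linear (Y u n).
Proof.
move=> c v w; rewrite /Y -mext_fun_linear; apply: eq_mext => s.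
exact: (Ymon_hfield s).1.
Qed.

Lemma Y_trunc u v : exists N : int, forall n, N <= n -> Y u n v = 0.
Proof.
elim/based_ind: u => [|c u w [M hM] [N hN]|s]; last first.
- by rewrite Y_basis; exact: (hfield_field (Ymon_hfield s)).2.
- exists (Order.max M N) => n; rewrite ge_max => /andP[Mn Nn].
  by rewrite (Y_linl n v) hM // hN // scaler0 addr0.
- by exists 0 => n _; exact: (lin0 (Y_linl n v)).
Qed.

Lemma Y_field u : field (Y u).
Proof. by split; [exact: Y_linr|exact: Y_trunc]. Qed.

Lemma Y_hom d e u v n : hom d u -> hom e v -> hom (e + d - n - 1) (Y u n v).
Proof.
move=> hu hv; apply: hom_mext hu => s <-; exact: (Ymon_hfield s).2.
Qed.

(** M(1,0) is generated from the vacuum by the creation operators. *)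
Lemma fock_ind (P : F -> Prop) :
  P 0 -> (forall c u v, P u -> P v -> P (c *: u + v)) -> P fvac ->
  (forall i j u, P u -> P (am i (Negz j) u)) -> forall u, P u.
Proof.
move=> P0 PD Pv PS; apply: based_ind => //.
elim/mset_ind => // -[i j] s /(PS i j); by rewrite /am /fcreate mextU.
Qed.

(** ** Linearity of normally ordered products in the field *)

Lemma NO_linB i j c (B C : int -> F -> F) n v : field B -> field C ->
  NO i j (fun n v => c *: B n v + C n v) n v = c *: NO i j B n v + NO i j C n v.
Proof.
move=> hB hC; rewrite /NO scalerDr addrACA !nsumZ; last 2 first.
- exact: NO_ev2.
- exact: NO_ev1.
apply: eq_add; (rewrite -nsumD;
  [|by apply: ev0Z; first [exact: NO_ev1|exact: NO_ev2]
   |by first [exact: NO_ev1|exact: NO_ev2]]); apply: eq_nsum => k.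
  by rewrite L scalerDr !scalerA mulrC.
by rewrite scalerDr !scalerA mulrC.
Qed.

Lemma eq_NO i j (B C : int -> F -> F) n v :
  (forall n v, B n v = C n v) -> NO i j B n v = NO i j C n v.
Proof.
move=> h; rewrite /NO; apply: eq_add; apply: eq_nsum => k; by rewrite h.
Qed.

Lemma NO_shift i j (B : int -> F -> F) (a : int) n v :
  NO i j (fun n => B (n + a)) n v = NO i j B (n + a) v.
Proof.
rewrite /NO; apply: eq_add; apply: eq_nsum => k.
  by have -> : n + k%:Z - j%:Z + a = n + a + k%:Z - j%:Z by lia.
by have -> : n - k%:Z - j%:Z - 1 + a = n + a - k%:Z - j%:Z - 1 by lia.
Qed.

Lemma field0 : field (fun (_ : int) (_ : F) => 0 : F).
Proof. by split=> [n c x y|v]; [rewrite scaler0 addr0|exists 0]. Qed.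

Lemma field_lin c (B C : int -> F -> F) : field B -> field C ->
  field (fun n v => c *: B n v + C n v).
Proof.
move=> [LB tB] [LC tC]; split=> [n|v].
  by apply: add_linear => //; exact: scaled_linear.
have [[M hM] [N hN]] := (tB v, tC v).
exists (Order.max M N) => n; rewrite ge_max => /andP[Mn Nn].
by rewrite hM // hN // scaler0 addr0.
Qed.

Lemma field_shift (B : int -> F -> F) (a : int) : field B -> field (fun n => B (n + a)).
Proof.
move=> [LB tB]; split=> // v; have [N hN] := tB v.
by exists (N - a) => n hn; apply: hN; lia.
Qed.

Lemma NO0 i j n v : NO i j (fun _ _ => 0) n v = 0.
Proof.
by rewrite /NO !nsum0 ?addr0 // => k; rewrite ?(lin0 (L _ _)) scaler0.
Qed.

Lemma field_sum N (c : nat -> K) (B : nat -> int -> F -> F) :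
  (forall q, field (B q)) -> field (fun n v => \sum_(q < N) c q *: B q n v).
Proof.
move=> hB; elim: N => [|N IH].
  have -> : (fun n v => \sum_(q < 0) c q *: B q n v) = (fun _ _ => 0).
    by apply/funext => n; apply/funext => v; rewrite big_ord0.
  exact: field0.
have -> : (fun n v => \sum_(q < N.+1) c q *: B q n v) =
  (fun n v => c N *: B N n v + \sum_(q < N) c q *: B q n v).
  by apply/funext => n; apply/funext => v; rewrite big_ord_recr addrC.
exact: field_lin.
Qed.

Lemma NO_sum i j N (c : nat -> K) (B : nat -> int -> F -> F) n v :
  (forall q, field (B q)) ->
  NO i j (fun n v => \sum_(q < N) c q *: B q n v) n v =
  \sum_(q < N) c q *: NO i j (B q) n v.
Proof.
move=> hB; elim: N => [|N IH].
  by rewrite big_ord0 (@eq_NO _ _ _ (fun _ _ => 0)) ?NO0 // => *; rewrite big_ord0.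
rewrite (@eq_NO _ _ _ (fun n v => c N *: B N n v + \sum_(q < N) c q *: B q n v)).
  by rewrite NO_linB ?IH //; [rewrite big_ord_recr addrC|exact: field_sum].
by move=> *; rewrite big_ord_recr addrC.
Qed.

(** The recursion holds for every state [u] and not only for monomials. *)
Lemma Y_create i j u n v : Y (am i (Negz j) u) n v = NO i j (Y u) n v.
Proof.
elim/based_ind: u => [|c u w Eu Ew|s]; last first.
- by rewrite /am /fcreate mextU !Y_basis Ymon1D.
- rewrite L (Y_linl n v) Eu Ew -NO_linB; try exact: Y_field.
  by apply: eq_NO => m z; rewrite (Y_linl m z).
- rewrite (lin0 (L _ _)) (lin0 (Y_linl n v)) (@eq_NO _ _ _ (fun _ _ => 0)) ?NO0 //.
  by move=> m z; rewrite (lin0 (Y_linl m z)).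
Qed.

Lemma Y_vac n v : Y fvac n v = Y1 n v.
Proof. by rewrite Y_basis Ymon0. Qed.

Lemma Y_gen i n v : Y (am i (Negz 0) fvac) n v = am i n v.
Proof.
rewrite Y_create (@eq_NO _ _ _ Y1); last exact: Y_vac.
rewrite /NO; case: n => n.
  rewrite nsum0 ?add0r => [|k]; last first.
    by rewrite /Y1 (_ : _ == _ = false) ?(lin0 (L _ _)) ?scaler0 //; lia.
  rewrite (@nsum1 _ _ _ n) => [|k kn]; last first.
    by rewrite /Y1 (_ : _ == _ = false) ?scaler0 //; lia.
  by rewrite /Y1 binz0 scale1r (_ : _ == _ = true) //; lia.
rewrite addrC nsum0 ?add0r => [|k]; last first.
  by rewrite /Y1 (_ : _ == _ = false) ?scaler0 //; lia.
rewrite (@nsum1 _ _ _ n) => [|k kn]; last first.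
  by rewrite /Y1 (_ : _ == _ = false) ?(lin0 (L _ _)) ?scaler0 //; lia.
by rewrite /Y1 bin0 scale1r (_ : _ == _ = true) //; lia.
Qed.

(** ** Commutators with the Heisenberg modes *)

(** Commuting a mode past the two factors of a normally ordered product leaves
    one contraction; the ordering does not matter for it, as it is a scalar. *)
Lemma am_NO_comm i i' p j (B C : int -> F -> F) n v : field B -> field C ->
  (forall n v, am i p (B n v) = B n (am i p v) + C n v) ->
  am i p (NO i' j B n v) = NO i' j B n (am i p v) + NO i' j C n v +
    (p%:~R * G i i' * binz K (p - 1) j) *: B (n + p - j%:Z - 1) v.
Proof.
move=> hB hC hBC; have LB := hB.1.
have e1 := NO_ev1 G i' j hB; have e2 := NO_ev2 G i' j hB.
have f1 := NO_ev1 G i' j hC; have f2 := NO_ev2 G i' j hC.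
set R := (_ * _ * _) *: _.
(* The contraction is the term k = p - 1 of the creation half when p > 0,
   and the term k = -p of the other half when p <= 0. *)
pose g1 k : F := (if p == k.+1%:Z then 1 else 0) *: R.
pose g2 k : F := (if p == - k%:Z then 1 else 0) *: R.
have E1 : ev0 g1 by exists (absz p) => k hk; rewrite /g1; case: eqP => [|_];
  [lia|rewrite scale0r].
have E2 : ev0 g2 by exists (absz p).+1 => k hk; rewrite /g2; case: eqP => [|_];
  [lia|rewrite scale0r].
have -> : R = nsum g1 + nsum g2.
  have [p0|p0] := ltP 0 p.
    rewrite [X in _ + X]nsum0 => [|k]; last by rewrite /g2; case: eqP => [|_];
      [lia|rewrite scale0r].
    rewrite addr0 (@nsum1 _ _ _ (absz p).-1) => [|k kp]; rewrite /g1.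
      by rewrite (_ : _ == _ = true) ?scale1r //; lia.
    by case: eqP => [|_]; [lia|rewrite scale0r].
  rewrite nsum0 => [|k]; last by rewrite /g1; case: eqP => [|_]; [lia|rewrite scale0r].
  rewrite add0r (@nsum1 _ _ _ (absz p)) => [|k kp]; rewrite /g2.
    by rewrite (_ : _ == _ = true) ?scale1r //; lia.
  by case: eqP => [|_]; [lia|rewrite scale0r].
rewrite /NO (linD (L _ _)) !(lin_nsum (L _ _)) //.
rewrite [X in _ = X + _]addrACA [RHS]addrACA; apply: eq_add.
  rewrite -!nsumD //; last exact: ev0D.
  apply: eq_nsum => k; rewrite (linZ (L _ _)) am_comm // hBC (linD (L _ _)) !scalerDr.
  apply: eq_add => //; rewrite /g1 (_ : (p + Negz k == 0) = (p == k.+1%:Z)); last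
    by apply/eqP/eqP; lia.
  case: eqP => [pk|_]; last by rewrite !scale0r scaler0.
  rewrite scale1r /R pk [k.+1%:Z - 1](_ : _ = k%:Z); last by lia.
  rewrite binz_nat scalerA mulrC; apply: eq_scale => //.
  by congr (B _ v); lia.
rewrite -!nsumD //; last exact: ev0D.
apply: eq_nsum => k; rewrite (linZ (L _ _)) hBC am_comm // (linD (LB _)) (linZ (LB _)).
rewrite !scalerDr addrAC; apply: eq_add => //.
rewrite /g2 (_ : (p + k%:Z == 0) = (p == - k%:Z)); last by apply/eqP/eqP; lia.
case: eqP => [pk|_]; last by rewrite !scale0r scaler0.
by rewrite scale1r /R pk scalerA mulrC; apply: eq_scale.
Qed.

(** With [f q = binz p q] this is the right-hand side of the commutator formula
    for the mode [p] of [i]; other weights [f] give further derivations. *)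
Definition Yder (f : nat -> K) i (p : int) u n v : F :=
  nsum (fun q => f q *: Y (am i q u) (n + p - q%:Z) v).

Lemma Yder_ev f i p u n v :
  ev0 (fun q : nat => f q *: Y (am i q u) (n + p - q%:Z) v).
Proof.
have [N hN] := am_ev0 G i u; exists N => q /hN ->.
by rewrite (lin0 (Y_linl _ v)) scaler0.
Qed.

Lemma Yder_sum f i p u : exists N, (forall q : nat, (N <= q)%N -> am i q u = 0) /\
  (forall n v, Yder f i p u n v =
    \sum_(q < N) f q *: Y (am i q u) (n + (p - q%:Z)) v).
Proof.
have [N hN] := am_ev0 G i u; exists N; split => // n v; rewrite /Yder (@nsumE _ _ _ N).
  by apply: eq_bigr => q _; rewrite addrA.
by move=> q /hN ->; rewrite (lin0 (Y_linl _ v)) scaler0.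
Qed.

Lemma Yder_field f i p u : field (Yder f i p u).
Proof.
have [N [_ hN]] := Yder_sum f i p u.
have -> : Yder f i p u =
    fun n v => \sum_(q < N) f q *: Y (am i q u) (n + (p - q%:Z)) v.
  by apply/funext => n; apply/funext => v.
apply: (@field_sum N f (fun q n => Y (am i q u) (n + (p - q%:Z)))) => q.
exact/field_shift/Y_field.
Qed.

Lemma Yder_linl f i p n v : linear (fun u => Yder f i p u n v).
Proof.
move=> c u w; rewrite /Yder nsumZ -?nsumD; try by [apply: Yder_ev|apply/ev0Z/Yder_ev].
by apply: eq_nsum => q; rewrite L (Y_linl _ v) scalerDr !scalerA mulrC.
Qed.

Lemma NO_Yder f i i' p j u n v :
  NO i' j (Yder f i p u) n v =
  nsum (fun q => f q *: NO i' j (Y (am i q u)) (n + p - q%:Z) v).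
Proof.
have [N [h0 hN]] := Yder_sum f i p u; rewrite (eq_NO _ _ _ _ hN).
rewrite (@NO_sum i' j N f (fun q n => Y (am i q u) (n + (p - q%:Z)))); last first.
  by move=> q; exact/field_shift/Y_field.
rewrite (@nsumE _ _ _ N) => [|q /h0 ->].
  by apply: eq_bigr => q _; rewrite NO_shift addrA.
rewrite (@eq_NO _ _ _ (fun _ _ => 0)) ?NO0 ?scaler0 // => m z.
exact: (lin0 (Y_linl _ z)).
Qed.

(** The extra term comes from the annihilation of the new factor, which only
    the mode [j + 1] contracts. *)
Lemma Yder_create f i i' p j u n v :
  Yder f i p (am i' (Negz j) u) n v = NO i' j (Yder f i p u) n v +
    (f j.+1 * (j.+1%:R * G i i')) *: Y u (n + p - j.+1%:Z) v.
Proof.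
have [N hN] := am_ev0 G i u.
pose g q : F := (if q == j.+1 then 1 else 0) *:
  ((f j.+1 * (j.+1%:R * G i i')) *: Y u (n + p - j.+1%:Z) v).
have -> : (f j.+1 * (j.+1%:R * G i i')) *: Y u (n + p - j.+1%:Z) v = nsum g.
  rewrite (@nsum1 _ _ _ j.+1) /g ?eqxx ?scale1r // => q /negbTE ->.
  by rewrite scale0r.
rewrite NO_Yder -nsumD.
- apply: eq_nsum => q; rewrite am_pos_neg (linD (Y_linl _ v)) Y_create scalerDr.
  apply: eq_add => //; rewrite (linZ (Y_linl _ v)) /g.
  by case: eqP => [->|_]; rewrite !scalerA ?mul1r // mulr0 mul0r !scale0r.
- exists N => q /hN ->; rewrite (@eq_NO _ _ _ (fun _ _ => 0)) ?NO0 ?scaler0 // => m z.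
  exact: (lin0 (Y_linl _ z)).
- exists j.+2 => q hq; rewrite /g gtn_eqF ?scale0r //.
Qed.

Lemma hom_fvac : hom 0 fvac.
Proof. by rewrite -[0]/(0%N%:Z) -(weight0 r); exact: homU. Qed.

Lemma am_fvac i (q : nat) : am i q fvac = 0.
Proof.
case: q => [|q] //; apply: hom_lt0 (@hom_am _ _ G _ i q.+1 _ _ hom_fvac); lia.
Qed.

Lemma Yder_vac f i p n v : Yder f i p fvac n v = 0.
Proof.
by apply: nsum0 => q; rewrite am_fvac (lin0 (Y_linl _ v)) scaler0.
Qed.

(** Borcherds' commutator formula when one of the two states generates the
    Heisenberg algebra. *)
Theorem am_Y_comm i p u n v :
  am i p (Y u n v) = Y u n (am i p v) + Yder (binz K p) i p u n v.
Proof.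
elim/fock_ind: u n v => [|c u w Eu Ew||i' j u IH] n v.
- by rewrite !(lin0 (Y_linl n _)) (lin0 (L _ _)) (lin0 (Yder_linl _ _ _ n v)) addr0.
- rewrite !(Y_linl n) L Eu Ew (Yder_linl _ _ _ n v) !scalerDr.
  by rewrite [LHS]addrACA.
- by rewrite Yder_vac addr0 !Y_vac /Y1; case: eqP => //; rewrite (lin0 (L _ _)).
rewrite !Y_create (@am_NO_comm _ _ _ _ (Y u) (Yder (binz K p) i p u)) //;
  [|exact: Y_field|exact: Yder_field].
rewrite Yder_create [RHS]addrA; apply: eq_add => //.
have -> : n + p - j%:Z - 1 = n + p - j.+1%:Z by lia.
by congr (_ *: _); rewrite [RHS]mulrCA [RHS]mulrA binz_absorb mulrAC.
Qed.
End VertexOperators.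

(** * Vacuum, conformal vector and leading skew symmetry *)

Section Conformal.
Variables (K : numFieldType) (r : nat) (G Q : 'I_r -> 'I_r -> K).
Hypothesis G_sym : forall i j, G i j = G j i.
Hypothesis Q_sym : forall i j, Q i j = Q j i.
Hypothesis GQ1 : forall i l, \sum_j G i j * Q j l = (i == l)%:R.
Let var : choiceType := ('I_r * nat)%type.
Let mon : choiceType := {mset var}%mset.
Variable F : based K mon.
Implicit Types (i : 'I_r) (s : mon) (x y : var) (u v w : F).
Local Notation am := (@am K r G F).
Local Notation NO := (@NO K r G F).
Local Notation L := (@am_linear K r G F).
Local Notation fvac := (@fvac K r F).
Local Notation Y := (@Y K r G F).
Local Notation LYl := (@Y_linl K r G F).
Local Notation fock_ind := (@fock_ind K r G F).
Local Notation LYr := (@Y_linr K r G F).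

(** The creation property. *)
Lemma Y_fvac u : (forall n : nat, Y u n fvac = 0) /\ Y u (-1) fvac = u.
Proof.
elim/fock_ind: u => [|c u w [IHu Eu] [IHw Ew]||i j u [IH E]].
- by split=> [n|]; rewrite (lin0 (LYl _ _)).
- by split=> [n|]; rewrite (LYl _ _) ?IHu ?IHw ?Eu ?Ew // scaler0 addr0.
- by split=> [n|]; rewrite Y_vac.
have X n : NO i j (Y u) n fvac =
    nsum (fun k => 'C(k, j)%:R *: am i (Negz k) (Y u (n + k%:Z - j%:Z) fvac)).
  rewrite /NO [X in _ + X]nsum0 ?addr0 // => k.
  by rewrite am_fvac (lin0 (LYr _ _)) scaler0.
have low (n : int) (k : nat) : 0 <= n -> 'C(k, j)%:R *: am i (Negz k) (Y u (n +
  k%:Z - j%:Z) fvac) = 0.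
  case: (ltnP k j) => kj n0; first by rewrite bin_small // scale0r.
  have -> : n + k%:Z - j%:Z = (absz (n + k%:Z - j%:Z)%R)%:Z by lia.
  by rewrite IH (lin0 (L _ _)) scaler0.
split=> [n|]; rewrite Y_create // X; first by apply: nsum0 => k; exact: low.
rewrite (@nsum1 _ _ _ j) => [|k kj].
  by rewrite addrK E binn scale1r.
case: (ltnP k j) => kj'; first by rewrite bin_small // scale0r.
have -> : -1 + k%:Z - j%:Z = (absz (-1 + k%:Z - j%:Z)%R)%:Z by lia.
by rewrite IH (lin0 (L _ _)) scaler0.
Qed.

Lemma Y_fvac_ge0 u (n : int) : 0 <= n -> Y u n fvac = 0.
Proof. by case: n => // n _; exact: (Y_fvac u).1. Qed.

Lemma Y_fvacN1 u : Y u (-1) fvac = u. Proof. exact: (Y_fvac u).2. Qed.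

(** The conformal vector: [Q] is the inverse of the Gram matrix [G], so this is
    half the sum of the u_i(-1)^2 1 over any orthonormal basis. *)
Definition fconf : F :=
  2%:R^-1 *: \sum_j \sum_l Q j l *: am j (Negz 0) (am l (Negz 0) fvac).

(** Only the mode 1 contracts a factor of the conformal vector, and by duality
    of [Q] and [G] the two contractions give back a_i(-1)1. *)
Lemma am_fconf i (q : nat) :
  am i q fconf = if q == 1%N then am i (Negz 0) fvac else 0.
Proof.
have E j l : am i q (am j (Negz 0) (am l (Negz 0) fvac)) =
  (if q == 1%N then 1 else 0) *:
    (G i l *: am j (Negz 0) fvac + G i j *: am l (Negz 0) fvac).
  rewrite am_pos_neg am_pos_neg am_fvac (lin0 (L _ _)) add0r (linZ (L _ _)).
  case: eqP => [->|_]; last by rewrite !scale0r [LHS]addr0.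
  by rewrite scale1r !mul1r.
rewrite /fconf (linZ (L _ _)) (lin_sum (L _ _)).
under eq_bigr => j _.
  rewrite (lin_sum (L _ _)).
  under eq_bigr => l _ do rewrite (linZ (L _ _)) E.
  over.
case: eqP => _; last first.
  by rewrite big1 ?scaler0 // => j _; rewrite big1 // => l _; rewrite scale0r scaler0.
have S (g : 'I_r -> F) : \sum_j \sum_l Q j l *: (G i l *: g j) = g i.
  transitivity (\sum_j (i == j)%:R *: g j).
    apply: eq_bigr => j _; rewrite -GQ1 scaler_suml; apply: eq_bigr => l _.
    by rewrite scalerA Q_sym mulrC.
  rewrite (bigD1 i) //= eqxx scale1r big1 ?addr0 // => j ji.
  by rewrite eq_sym (negbTE ji) scale0r.
rewrite (_ : \sum_j _ = 2%:R *: am i (Negz 0) fvac).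
  by rewrite scalerA mulVf ?scale1r // pnatr_eq0.
transitivity (\sum_j \sum_l Q j l *: (G i l *: am j (Negz 0) fvac) +
  \sum_j \sum_l Q j l *: (G i j *: am l (Negz 0) fvac)).
  rewrite -big_split; apply: eq_bigr => j _; rewrite -big_split.
  by apply: eq_bigr => l _; rewrite scale1r scalerDr.
rewrite scaler_nat mulr2n; apply: eq_add; first exact: S.
rewrite exchange_big /=; apply: etrans (S (fun j => am j (Negz 0) fvac)).
by apply: eq_bigr => l _; apply: eq_bigr => j _; rewrite Q_sym.
Qed.

Lemma am_Yconf i p n v :
  am i p (Y fconf n v) = Y fconf n (am i p v) + p%:~R *: am i (n + p - 1) v.
Proof.
rewrite am_Y_comm //; apply: eq_add; [by []|].
rewrite /Yder (@nsum1 _ _ _ 1%N) => [|q /negbTE q1]; last first.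
  by rewrite am_fconf q1 (lin0 (LYl _ _)) scaler0.
rewrite am_fconf /= Y_gen; congr (_ *: _).
by rewrite -[LHS]mul1r (binz_absorb K p 0) binz0 mulr1.
Qed.

(** The translation operator L(-1). *)
Definition transl v := Y fconf 0 v.

Lemma transl_linear : linear transl. Proof. exact: LYr. Qed.

Lemma transl_fvac : transl fvac = 0. Proof. exact: Y_fvac_ge0. Qed.

Lemma transl_am i p v :
  transl (am i p v) = am i p (transl v) - p%:~R *: am i (p - 1) v.
Proof. by rewrite /transl am_Yconf add0r addrK. Qed.

Lemma L0_basis s : Y fconf 1 'v_s = (weight s)%:R *: 'v_s.
Proof.
elim/mset_ind: s => [|[i j] s IH].
  by rewrite weight0 scale0r; exact: Y_fvac_ge0.
have -> : 'v_((i, j) +` s)%mset = am i (Negz j) 'v_s.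
  by rewrite /am /fcreate mextU.
have -> : Y fconf 1 (am i (Negz j) 'v_s) =
    am i (Negz j) (Y fconf 1 'v_s) - (Negz j)%:~R *: am i (Negz j) 'v_s.
  by rewrite am_Yconf (_ : 1 + Negz j - 1 = Negz j) ?addrK //; lia.
rewrite IH (linZ (L _ _)) -scalerBl weight1D /=; congr (_ *: _).
by rewrite NegzE mulrNz opprK natrD addrC.
Qed.

(** So the weight spaces of L(0) are those of the monomial grading. *)
Lemma hom_L0 d v : Y fconf 1 v = d%:~R *: v -> hom d v.
Proof.
move=> h; apply/homP => s cs.
have E w : coef s (Y fconf 1 w) = (weight s)%:R * coef s w.
  apply: (@linear_ext _ _ F K^o (fun w => coef s (Y fconf 1 w)) (fun w =>
    (weight s)%:R * coef s w)).
  - by move=> c a b; rewrite LYr coefD coefZ.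
  - by move=> c a b; rewrite coefD coefZ mulrDr mulrCA.
  move=> t; rewrite L0_basis coefZ coef_basis; case: (t =P s) => [->//|_].
  by rewrite !mulr0.
have := congr1 (coef s) h; rewrite E coefZ => /(mulIf cs) /eqP.
by rewrite pmulrn eqr_int => /eqP.
Qed.

(** ** Translation covariance *)

(** The commutator with L(-1) differentiates the field. *)
Definition covariant (B : int -> F -> F) :=
  forall n v, transl (B n v) = B n (transl v) - n%:~R *: B (n - 1) v.

(** The derivative of a normally ordered product obeys the Leibniz rule although
    it moves modes across the normal ordering: the only mode that would cross,
    a_i(0), comes with the coefficient 0. In both halves the shifted terms are
    reindexed and the binomial coefficients then agree by absorption. *)
Lemma NO_transl i j B : field B -> covariant B -> covariant (NO i j B).
Proof.
move=> hB cB n v; have LB := hB.1.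
have e1 := NO_ev1 G i j hB; have e2 := NO_ev2 G i j hB.
have T := transl_linear.
rewrite /NO (linD T) (lin_nsum T (e1 n v))
  (lin_nsum T (e2 n v)) scalerDr opprD [RHS]addrACA -!scaleNr !nsumZ; try
    by [apply: e1|apply: e2].
apply: eq_add.
  pose a k : F := am i (Negz k) (B (n - 1 + k%:Z - j%:Z) v).
  have ea (f : nat -> K) : ev0 (fun k => f k *: a k).
    apply: (@ev0_le _ _ (fun k : nat => B (n - 1 + k%:Z - j%:Z) v)).
      by move=> k; rewrite /a => ->; rewrite (lin0 (L _ _)) scaler0.
    by apply: (field_ev0 hB) (n - 1 - j%:Z) _ => k; lia.
  (* [g] are the terms where a_i is differentiated, [c] those where B is, and
     [b] those where the derivative has passed through. *)
  have [g gE] : {g : nat -> F | g = fun k => (k%:R * binz K (k%:Z - 1) j) *: a k}.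
    by eexists.
  have [b bE] : {b : nat -> F | b = fun k =>
      'C(k, j)%:R *: am i (Negz k) (B (n + k%:Z - j%:Z) (transl v))} by eexists.
  have [c cE] : {c : nat -> F | c = fun k =>
      (- ('C(k, j)%:R * (n + k%:Z - j%:Z)%:~R)) *: a k} by eexists.
  have eb : ev0 b by rewrite bE; exact: e1.
  have eg : ev0 g by rewrite gE; exact: ea.
  have ec : ev0 c by rewrite cE; exact: ea.
  have gS : nsum (fun k => g k.+1) = nsum g.
    rewrite [RHS](nsum_recl eg) (_ : g 0%N = 0) ?add0r //.
    by rewrite gE mul0r scale0r.
  have egS : ev0 (fun k => g k.+1).
    by case: eg => N hN; exists N => k kN; apply: hN; apply: leqW.
  transitivity (nsum (fun k => b k + (g k.+1 + c k))).
    apply: eq_nsum => k; rewrite (linZ T) transl_am cB (linB (L _ _))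
      (linZ (L _ _)) !scalerBr.
    rewrite bE -[LHS]addrA; apply: eq_add; [by []|]; rewrite [LHS]addrC; apply: eq_add.
      rewrite -[LHS]scaleNr [LHS]scalerA gE /a.
      have -> : Negz k - 1 = Negz k.+1 by lia.
      have -> : n - 1 + k.+1%:Z - j%:Z = n + k%:Z - j%:Z by lia.
      have -> : k.+1%:Z - 1 = k%:Z by lia.
      by rewrite binz_nat NegzE mulrNz mulrNN [X in X *: _]mulrC.
    rewrite -scaleNr scalerA cE /a mulNr.
    by have -> : n - 1 + k%:Z - j%:Z = n + k%:Z - j%:Z - 1 by lia.
  rewrite [LHS]nsumD; [|exact: eb|exact: ev0D].
  rewrite [X in _ + X]nsumD; [|exact: egS|exact: ec].
  rewrite gS; apply: eq_add; first by rewrite bE.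
  rewrite -[LHS]nsumD; [|exact: eg|exact: ec].
  apply: eq_nsum => k; rewrite gE cE -scalerDl scalerA; congr (_ *: _).
  have := binzSE K k j; rewrite binz_absorb binz_nat -(pmulrn 1 k) => ->.
  by rewrite !(intrD, rmorphN) /=; ring.
pose a k : F := B (n - 1 - k%:Z - j%:Z - 1) (am i k%:Z v).
pose bt k := binz K (- k%:Z - 1) j.
have ea (f : nat -> K) : ev0 (fun k => f k *: a k).
  have [N hN] := am_ev0 G i v; exists N => k /hN; rewrite /a => ->.
  by rewrite (lin0 (LB _)) scaler0.
have [h hE] : {h : nat -> F | h = fun k : nat =>
    (- (k%:R * bt k)) *: B (n - k%:Z - j%:Z - 1) (am i (k%:Z - 1) v)} by eexists.
have [b bE] : {b : nat -> F | b = fun k : nat =>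
    bt k *: B (n - k%:Z - j%:Z - 1) (am i k%:Z (transl v))} by eexists.
have [c cE] : {c : nat -> F | c = fun k : nat =>
    (- (bt k * (n - k%:Z - j%:Z - 1)%:~R)) *: a k} by eexists.
have [g gE] : {g : nat -> F | g = fun k : nat =>
    (- (k.+1%:R * bt k.+1)) *: a k} by eexists.
have hS k : h k.+1 = g k.
  rewrite hE gE /a; have -> : n - k.+1%:Z - j%:Z - 1 = n - 1 - k%:Z - j%:Z - 1 by lia.
  by have -> : k.+1%:Z - 1 = k%:Z by lia.
have eg : ev0 g by rewrite gE; exact: ea.
have eb : ev0 b by rewrite bE; exact: e2.
have ec : ev0 c by rewrite cE; exact: ea.
have eh : ev0 h.
  have [N hN] := eg.
  exists N.+1 => -[//|k] kN; rewrite hS; exact: hN.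
have hs : nsum h = nsum g.
  rewrite [LHS](nsum_recl eh) (_ : h 0%N = 0) ?add0r; first exact: eq_nsum.
  by rewrite hE mul0r oppr0 scale0r.
transitivity (nsum (fun k => b k + (h k + c k))).
  apply: eq_nsum => k; rewrite (linZ T) cB transl_am (linB (LB _))
    (linZ (LB _)) !scalerBr.
  rewrite bE -[LHS]addrA; apply: eq_add; [by []|]; apply: eq_add.
    by rewrite hE scalerA -scaleNr -pmulrn [bt k * _]mulrC.
  rewrite -scaleNr scalerA cE /a mulNr.
  by have -> : n - 1 - k%:Z - j%:Z - 1 = n - k%:Z - j%:Z - 1 - 1 by lia.
rewrite [LHS]nsumD; [|exact: eb|exact: ev0D].
rewrite [X in _ + X]nsumD; [|exact: eh|exact: ec].
rewrite hs; apply: eq_add; first by rewrite bE.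
rewrite -[LHS]nsumD; [|exact: eg|exact: ec].
apply: eq_nsum => k; rewrite gE cE -scalerDl scalerA /bt; congr (_ *: _).
have := binzSE K (- k%:Z - 1) j; rewrite binz_absorb.
have -> : - k%:Z - 1 - 1 = - k.+1%:Z - 1 by lia.
have -> : (- k%:Z - 1)%:~R = - k.+1%:R :> K by rewrite pmulrn -mulrNz; congr (_%:~R);
  lia.
rewrite mulNr => ->.
by rewrite !(intrD, rmorphN) /=; ring.
Qed.

Lemma Y_transl u : covariant (Y u).
Proof.
move=> n v; elim/fock_ind: u n v => [|c u w Eu Ew||i j u IH] n v.
- by rewrite !(lin0 (LYl _ _)) (lin0 transl_linear) scaler0 subr0.
- rewrite !(LYl _ _) transl_linear Eu Ew !scalerBr !scalerDr opprD [RHS]addrACA.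
  by rewrite !scalerA [_ * c]mulrC.
- rewrite !Y_vac /Y1; have [->|n1] := eqVneq n (-1).
    by rewrite (_ : (-1 - 1 == -1 :> int) = false) // scaler0 [RHS]subr0.
  rewrite (lin0 transl_linear); case: eqP => [n0|_]; last by rewrite scaler0 subr0.
  by rewrite (_ : n = 0) ?scale0r ?subr0 //; lia.
rewrite !Y_create; apply: NO_transl; [exact: Y_field|exact: IH].
Qed.
End Conformal.

(** ** Vectors killed by the annihilation operators *)

Section LowestWeight.
Variables (K : numFieldType) (r : nat) (G Q : 'I_r -> 'I_r -> K).
Hypothesis G_sym : forall i j, G i j = G j i.
Hypothesis Q_sym : forall i j, Q i j = Q j i.
Hypothesis GQ1 : forall i l, \sum_j G i j * Q j l = (i == l)%:R.
Let var : choiceType := ('I_r * nat)%type.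
Let mon : choiceType := {mset var}%mset.
Variable F : based K mon.
Implicit Types (i : 'I_r) (s : mon) (x y : var) (u v w : F).
Local Notation am := (@am K r G F).
Local Notation L := (@am_linear K r G F).
Local Notation fvac := (@fvac K r F).
Local Notation Y := (@Y K r G F).
Local Notation LYl := (@Y_linl K r G F).
Local Notation LYr := (@Y_linr K r G F).

(** [fannih x] is the partial derivative in the variable [x]. *)
Lemma coef_fannih x s v :
  coef s (fannih x v) = (s x).+1%:R * coef (x +` s)%mset v.
Proof.
apply: (@linear_ext _ _ F K^o (fun v => coef s (fannih x v))
  (fun v => (s x).+1%:R * coef (x +` s)%mset v)).
- by move=> c a b; rewrite (fannih_linear _) coefD coefZ.
- by move=> c a b; rewrite coefD coefZ mulrDr mulrCA.
move=> t; rewrite /fannih mextU coefZ !coef_basis.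
have [e|ne] := eqVneq t (x +` s)%mset.
  by rewrite e msetD1K eqxx mset1DE eqxx add1n.
have [tx|tx] := eqVneq (t x) 0%N; first by rewrite tx mul0r mulr0.
suff /negbTE -> : (t `\ x)%mset != s by rewrite !mulr0.
apply: contraNneq ne => <-; rewrite msetB1K //; by rewrite -mset_neq0.
Qed.

Lemma fannih_am x v : (forall i, am i x.2.+1%:Z v = 0) -> fannih x v = 0.
Proof.
case: x => l n /= h.
have QG j : \sum_i Q l i * G i j = (j == l)%:R.
  by rewrite -GQ1; apply: eq_bigr => i _; rewrite mulrC G_sym Q_sym.
have : \sum_i Q l i *: am i n.+1%:Z v = 0.
  by apply: big1 => i _; rewrite h scaler0.
under eq_bigr => i _ do rewrite amP scalerA mulrC -scalerA scaler_sumr.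
rewrite -scaler_sumr exchange_big /= (bigD1 l) //= [X in _ + X]big1 ?addr0.
  under eq_bigr => i _ do rewrite scalerA.
  rewrite -scaler_suml QG eqxx scale1r.
  by move/eqP; rewrite scaler_eq0 pnatr_eq0 => /eqP.
move=> j jl; under eq_bigr => i _ do rewrite scalerA.
by rewrite -scaler_suml QG (negbTE jl) scale0r.
Qed.

(** Annihilation operators jointly kill only the multiples of the vacuum, as
    they are invertible combinations of partial derivatives. *)
Lemma killed_eq0 d v : (forall i n, am i n.+1%:Z v = 0) -> hom d v -> d != 0 ->
  v = 0.
Proof.
move=> h /homP hv d0; apply: coef_inj => s; rewrite coef0.
have [//|cs] := eqVneq (coef s v) 0.
have [s0|/eqP s0] := eqVneq s mset0.
  by move: (hv _ cs) d0; rewrite s0 weight0 => <-; rewrite eqxx.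
have [x] : exists x, s x != 0%N.
  apply/not_existsP => hs; apply: s0; apply/msetP => x; rewrite mset0E.
  by apply/eqP/negPn/negP/hs.
rewrite mset_neq0 => xs.
have := coef_fannih x (s `\ x)%mset v.
rewrite fannih_am // coef0 msetB1K // => /esym /eqP.
by rewrite mulf_eq0 pnatr_eq0 => /eqP.
Qed.

(** ** Leading skew symmetry *)

(** Both coefficients are (-1)^(j + k) times a binomial coefficient of [j + k]. *)
Lemma binz_skew (j k : nat) :
  (-1) ^+ k * binz K (- k%:Z - 1) j = (-1) ^+ j * binz K (- j%:Z - 1) k.
Proof.
have -> : binz K (- k%:Z - 1) j = (-1) ^+ j * 'C(j + k, k)%:R.
  rewrite binz_neg; congr (_ * _%:R).
  by rewrite addnC -[in LHS]bin_sub ?leq_addr // addKn.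
by rewrite binz_neg mulrCA.
Qed.

Lemma signzD (a b : int) : (-1) ^ (a + b) = (-1) ^ a * (-1) ^ b :> K.
Proof. by rewrite expfzDr // oppr_eq0 oner_eq0. Qed.

(** The vacuum components of [u_(N-1) v] and [v_(N-1) u], where [N] is the total
    weight: only contractions contribute, and those are symmetric up to sign. *)
Lemma skew_basis s (e : int) v : hom e v ->
  Y 'v_s ((weight s)%:Z + e - 1) v =
  (-1) ^ ((weight s)%:Z + e) *: Y v ((weight s)%:Z + e - 1) 'v_s.
Proof.
elim/mset_ind: s e v => [|[i j] s IH] e v hv.
  rewrite weight0 add0r Y_vac /Y1; case: (ltrgtP e 0) => [e0|e0|e0].
  - by rewrite (hom_lt0 e0 hv) (lin0 (LYl _ _)) scaler0; case: ifP.
  - by rewrite Y_fvac_ge0 ?scaler0; [case: eqP => //; lia|lia].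
  by rewrite e0 Y_fvacN1 scale1r.
have E : 'v_((i, j) +` s)%mset = am i (Negz j) ('v_s : F).
  by rewrite /am /fcreate mextU.
rewrite E weight1D /=; set N := (_ + e)%R; set W := (weight s)%:Z + e.
have NE : N = W + j%:Z + 1 by rewrite /N /W; lia.
have hs := homU F s; have L0 := lin0 (L _ _).
have -> : Y v (N - 1) (am i (Negz j) 'v_s) =
    - nsum (fun k => binz K (Negz j) k *: Y (am i k v) (W - k%:Z - 1) 'v_s).
  have /eqP := am_Y_comm G_sym i (Negz j) v (N - 1) ('v_s : F).
  rewrite (_ : Y v (N - 1) 'v_s = 0) ?L0; last first.
    by apply: hom_lt0 (Y_hom G (N - 1) hv hs); rewrite NE /W; lia.
  rewrite eq_sym addr_eq0 => /eqP ->; congr (- _); apply: eq_nsum => k.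
  by have -> : N - 1 + Negz j - k%:Z = W - k%:Z - 1 by lia.
rewrite Y_create /NO nsum0 => [|k]; last first.
  rewrite (_ : Y _ _ _ = 0) ?L0 ?scaler0 //.
  by apply: hom_lt0 (Y_hom G (N - 1 + k%:Z - j%:Z) hs hv); rewrite NE /W; lia.
rewrite add0r scalerN -scaleNr.
have [M hM] := am_ev0 G i v.
rewrite nsumZ; last first.
  by exists M => k /hM ->; rewrite (lin0 (LYl _ _)) scaler0.
apply: eq_nsum => k.
have -> : N - 1 - k%:Z - j%:Z - 1 = (weight s)%:Z + (e - k%:Z) - 1 by rewrite NE /W;
  lia.
rewrite (IH _ _ (@hom_am _ _ G _ i k _ _ hv)) !scalerA.
have -> : (weight s)%:Z + (e - k%:Z) = W - k%:Z by rewrite /W; lia.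
congr (_ *: _).
have -> : (-1) ^ N = - ((-1) ^ (W - k%:Z) * (-1) ^+ k * (-1) ^+ j) :> K.
  have -> : N = W - k%:Z + k%:Z + j%:Z + 1 by rewrite NE; lia.
  by rewrite 3!signzD expr1z mulrN1.
have -> : Negz j = - j%:Z - 1 by lia.
by rewrite opprK -2![RHS]mulrA -binz_skew signrMK mulrC.
Qed.

Lemma skew_lead (d e : int) u v : hom d u -> hom e v ->
  Y u (d + e - 1) v = (-1) ^ (d + e) *: Y v (d + e - 1) u.
Proof.
move=> /homP hu hv; rewrite (basis_span u) (lin_sum (LYl _ _)) (lin_sum (LYr _ _)).
rewrite scaler_sumr big_seq [RHS]big_seq; apply: eq_bigr => s.
rewrite -coef_neq0 => /hu <-; rewrite (linZ (LYl _ _)) (linZ (LYr _ _)) skew_basis //.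
by rewrite !scalerA mulrC.
Qed.
End LowestWeight.

(** * The Borcherds identity *)

(** ** The sums in the identity *)

Section BorcherdsSums.
Variables (K : numFieldType) (V : lmodType K).
Implicit Types (A : int -> int -> V) (l m n : int).

(** [Bcomp l m n A] and [Biter l m n A] are the coefficients extracted by
    the identity from the compositions [A a b = u_a (v_b w)] and from the
    iterates [A a b = (u_a v)_b w]. *)
Definition Bcomp l m n A : V :=
  nsum (fun i => ((-1) ^+ i * binz K l i) *: A (l + m - i%:Z) (n + i%:Z)).
Definition Biter l m n A : V :=
  nsum (fun i => binz K m i *: A (l + i%:Z) (m + n - i%:Z)).

(** The truncation conditions under which [Bcomp] and [Biter] are finite sums. *)
Definition vanish_r A := exists N, forall a b, N <= b -> A a b = 0.
Definition vanish_l A := exists N, forall a b, N <= a -> A a b = 0.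

Lemma Bcomp_ev A l m n (c : nat -> K) : vanish_r A ->
  ev0 (fun i : nat => c i *: A (l + m - i%:Z) (n + i%:Z)).
Proof.
move=> [N h]; exists (absz (N - n)) => i hi; rewrite h ?scaler0 //; lia.
Qed.

Lemma Biter_ev A l m n (c : nat -> K) : vanish_l A ->
  ev0 (fun i : nat => c i *: A (l + i%:Z) (m + n - i%:Z)).
Proof.
move=> [N h]; exists (absz (N - l)) => i hi; rewrite h ?scaler0 //; lia.
Qed.

Lemma eq_Bcomp A B l m n : (forall a b, A a b = B a b) -> Bcomp l m n A = Bcomp l m n B.
Proof. by move=> h; apply: eq_nsum => i; rewrite h. Qed.

Lemma eq_Biter A B l m n : (forall a b, A a b = B a b) -> Biter l m n A = Biter l m n B.
Proof. by move=> h; apply: eq_nsum => i; rewrite h. Qed.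

Lemma nsumV_scale (c : K) (f : nat -> V) : ev0 f ->
  c *: nsum f = nsum (fun k => c *: f k).
Proof.
apply: (@lin_nsum _ _ _ (fun v : V => c *: v)) => a x y.
by rewrite scalerDr !scalerA mulrC.
Qed.

Lemma ev0_scale (c : K) (f : nat -> V) : ev0 f -> ev0 (fun k => c *: f k).
Proof. by move=> [N h]; exists N => i /h ->; rewrite scaler0. Qed.

(** Multiplication by z - w raises [l] by one in both sums. *)
Lemma Biter_shift A l m n : vanish_l A ->
  Biter l (m + 1) n A = Biter (l + 1) m n A + Biter l m (n + 1) A.
Proof.
move=> hA.
have e c := Biter_ev l m (n + 1) c hA.
have [f fE] : {f : nat -> V | f = fun i : nat => binz K m i *: A (l + i%:Z) (m + (n +
  1) - i%:Z)} by eexists.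
have [g gE] : {g : nat -> V | g = fun i : nat => binz K m i *: A (l + 1 + i%:Z) (m +
  n - i%:Z)} by eexists.
have [h hE] : {h : nat -> V | h = fun i : nat => binz K (m + 1) i *: A (l + i%:Z)
  (m + 1 + n - i%:Z)} by eexists.
have ef : ev0 f by rewrite fE; exact: e.
have eg : ev0 g by rewrite gE; exact: (Biter_ev (l + 1) m n).
have eh : ev0 h by rewrite hE; exact: (Biter_ev l (m + 1) n).
have -> : Biter l m (n + 1) A = nsum f by rewrite fE.
have -> : Biter (l + 1) m n A = nsum g by rewrite gE.
have -> : Biter l (m + 1) n A = nsum h by rewrite hE.
have efS : ev0 (fun i => f i.+1) by case: ef => N hN; exists N => i hi; apply/hN/leqW.
rewrite (nsum_recl eh) (nsum_recl ef) [RHS]addrCA; apply: eq_add.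
  by rewrite hE fE !binz0; congr (_ *: A _ _); lia.
rewrite -[RHS]nsumD //; apply: eq_nsum => i;
  rewrite hE gE fE binz_pascal scalerDl [LHS]addrC.
have -> : l + i.+1%:Z = l + 1 + i%:Z by lia.
have -> : m + 1 + n - i.+1%:Z = m + n - i%:Z by lia.
by have -> : m + (n + 1) - i.+1%:Z = m + n - i%:Z by lia.
Qed.

Lemma Bcomp_shift A l m n : vanish_r A ->
  Bcomp l (m + 1) n A = Bcomp (l + 1) m n A + Bcomp l m (n + 1) A.
Proof.
move=> hA.
have [f fE] : {f : nat -> V | f = fun i : nat => ((-1) ^+ i * binz K l i) *: A (l +
  m - i%:Z) (n + 1 + i%:Z)} by eexists.
have [g gE] : {g : nat -> V | g = fun i : nat => ((-1) ^+ i * binz K (l +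
  1) i) *: A (l + 1 + m - i%:Z) (n + i%:Z)} by eexists.
have [h hE] : {h : nat -> V | h = fun i : nat => ((-1) ^+ i * binz K l i) *: A (l +
  (m + 1) - i%:Z) (n + i%:Z)} by eexists.
have ef : ev0 f by rewrite fE; exact: Bcomp_ev.
have eg : ev0 g by rewrite gE; exact: Bcomp_ev.
have eh : ev0 h by rewrite hE; exact: Bcomp_ev.
have -> : Bcomp l m (n + 1) A = nsum f by rewrite fE.
have -> : Bcomp (l + 1) m n A = nsum g by rewrite gE.
have -> : Bcomp l (m + 1) n A = nsum h by rewrite hE.
have egS : ev0 (fun i => g i.+1) by case: eg => N hN; exists N => i hi; apply/hN/leqW.
rewrite (nsum_recl eh) (nsum_recl eg) -[RHS]addrA; apply: eq_add.
  by rewrite hE gE !binz0; congr (_ *: A _ _); lia.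
rewrite -[RHS]nsumD //; apply: eq_nsum => i; rewrite hE gE fE binz_pascal.
have -> : l + (m + 1) - i.+1%:Z = l + m - i%:Z by lia.
have -> : l + 1 + m - i.+1%:Z = l + m - i%:Z by lia.
have -> : n + i.+1%:Z = n + 1 + i%:Z by lia.
by rewrite -scalerDl; congr (_ *: _); rewrite exprS; ring.
Qed.

(** The effect of L(-1) on both sums: translation acts as the sum of the
    derivatives in the two variables z and w. *)
Lemma Biter_deriv A l m n : vanish_l A ->
  Biter l m n (fun a b => - b%:~R *: A a (b - 1)) =
  - (m%:~R *: Biter l (m - 1) n A) - n%:~R *: Biter l m (n - 1) A.
Proof.
move=> hA; have e1 := Biter_ev l (m - 1) n _ hA; have e2 := Biter_ev l m (n - 1) _ hA.
rewrite !nsumV_scale; [|exact: e2|exact: e1].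
rewrite -!scaleN1r !nsumV_scale; [|exact/ev0_scale/e2|exact/ev0_scale/e1].
rewrite -[RHS]nsumD; [|exact/ev0_scale/ev0_scale/e1|exact/ev0_scale/ev0_scale/e2].
apply: eq_nsum => i.
have -> : m - 1 + n - i%:Z = m + n - i%:Z - 1 by lia.
have -> : m + (n - 1) - i%:Z = m + n - i%:Z - 1 by lia.
rewrite !scalerA -scalerDl; congr (_ *: _).
have := binzSE K m i; rewrite binz_absorb => h.
rewrite -[- 1 * m%:~R * _]mulrA h !(intrD, rmorphN) /=; ring.
Qed.

Lemma Bcomp_deriv A l m n : vanish_r A ->
  Bcomp l m n (fun a b => - b%:~R *: A a (b - 1) - a%:~R *: A (a - 1) b) =
  - (m%:~R *: Bcomp l (m - 1) n A) - n%:~R *: Bcomp l m (n - 1) A.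
Proof.
move=> hA.
have [f fE] : {f : nat -> V | f = fun i : nat => ((-1) ^+ i * binz K l i) *: A (l +
  (m - 1) - i%:Z) (n + i%:Z)} by eexists.
have [g gE] : {g : nat -> V | g = fun i : nat => ((-1) ^+ i * binz K l i) *: A (l +
  m - i%:Z) (n - 1 + i%:Z)} by eexists.
have ef c : ev0 (fun i => c i *: f i).
  by rewrite fE; have [N hN] := Bcomp_ev l (m - 1) n (fun i =>
    c i * ((-1) ^+ i * binz K l i)) hA; exists N => i /hN <-; rewrite scalerA.
have eg c : ev0 (fun i => c i *: g i).
  by rewrite gE; have [N hN] := Bcomp_ev l m (n - 1) (fun i =>
    c i * ((-1) ^+ i * binz K l i)) hA; exists N => i /hN <-; rewrite scalerA.
have -> : Bcomp l (m - 1) n A = nsum f by rewrite fE.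
have -> : Bcomp l m (n - 1) A = nsum g by rewrite gE.
have f0 : ev0 f by have [N hN] := ef (fun=> 1); exists N => i /hN; rewrite scale1r.
have g0 : ev0 g by have [N hN] := eg (fun=> 1); exists N => i /hN; rewrite scale1r.
(* The last two summands cancel after shifting the first of them by one. *)
transitivity (nsum (fun i => (- n%:~R : K) *: g i + (- m%:~R : K) *: f i +
   ((- i%:R : K) *: g i + (i%:R - l%:~R : K) *: f i))).
  apply: eq_nsum => i; rewrite scalerBr fE gE.
  have -> : l + (m - 1) - i%:Z = l + m - i%:Z - 1 by lia.
  have -> : n - 1 + i%:Z = n + i%:Z - 1 by lia.
  rewrite [RHS]addrACA -!scalerDl !scalerA -scaleNr; congr (_ *: _ + _ *: _).
    by rewrite !(intrD, rmorphN) /= -?pmulrn; ring.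
  by rewrite !(intrD, rmorphN) /= -?pmulrn; ring.
rewrite nsumD; [|apply: ev0D; [exact: eg|exact: ef]|apply: ev0D; [exact: eg|exact: ef]].
rewrite [X in X + _]nsumD; [|exact: eg|exact: ef].
rewrite -!nsumV_scale // !scaleNr [X in X + _]addrC.
rewrite [X in _ + X](_ : _ = 0) ?addr0 //.
rewrite nsumD; [|exact: (eg (fun i => - i%:R))|exact: (ef (fun i => i%:R - l%:~R))].
rewrite (nsum_recl (eg (fun i => - i%:R))) oppr0 scale0r add0r -nsumD; last 2 first.
- by have [N hN] := eg (fun i => - i%:R); exists N => i hi; apply: hN; apply: leqW.
- exact: (ef (fun i => i%:R - l%:~R)).
apply: nsum0 => i; rewrite fE gE !scalerA.
have -> : l + m - i.+1%:Z = l + (m - 1) - i%:Z by lia.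
have -> : n - 1 + i.+1%:Z = n + i%:Z by lia.
rewrite -scalerDl exprS.
have -> : - i.+1%:R * (-1 * (-1) ^+ i * binz K l i.+1) =
  (-1) ^+ i * (i.+1%:R * binz K l i.+1) :> K by ring.
rewrite binzSE intrD rmorphN /= -?pmulrn.
by rewrite [X in X *: _](_ : _ = 0) ?scale0r //; ring.
Qed.

End BorcherdsSums.

Section BorcherdsLinear.
Variables (K : numFieldType) (V : lmodType K).
Implicit Types (A B : int -> int -> V) (l m n : int).

Lemma vanish_r_lin c A B : vanish_r A -> vanish_r B ->
  vanish_r (fun a b => c *: A a b + B a b).
Proof.
move=> [M hM] [N hN]; exists (Order.max M N) => a b; rewrite ge_max => /andP[h1 h2].
by rewrite hM // hN // scaler0 addr0.
Qed.

Lemma vanish_l_lin c A B : vanish_l A -> vanish_l B ->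
  vanish_l (fun a b => c *: A a b + B a b).
Proof.
move=> [M hM] [N hN]; exists (Order.max M N) => a b; rewrite ge_max => /andP[h1 h2].
by rewrite hM // hN // scaler0 addr0.
Qed.

Lemma Bcomp_lin c A B l m n : vanish_r A -> vanish_r B ->
  Bcomp l m n (fun a b => c *: A a b + B a b) = c *: Bcomp l m n A + Bcomp l m n B.
Proof.
move=> hA hB; have eA := Bcomp_ev l m n (fun i => (-1) ^+ i * binz K l i) hA.
have eB := Bcomp_ev l m n (fun i => (-1) ^+ i * binz K l i) hB.
rewrite {2}/Bcomp nsumV_scale // -[RHS]nsumD //; last exact: ev0_scale.
by apply: eq_nsum => i; rewrite scalerDr !scalerA [c * _]mulrC.
Qed.

Lemma Biter_lin c A B l m n : vanish_l A -> vanish_l B ->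
  Biter l m n (fun a b => c *: A a b + B a b) = c *: Biter l m n A + Biter l m n B.
Proof.
move=> hA hB; have eA := Biter_ev l m n (fun i => binz K m i) hA.
have eB := Biter_ev l m n (fun i => binz K m i) hB.
rewrite {2}/Biter nsumV_scale // -[RHS]nsumD //; last exact: ev0_scale.
by apply: eq_nsum => i; rewrite scalerDr !scalerA [c * _]mulrC.
Qed.

Lemma Bcomp0 l m n : Bcomp l m n (fun _ _ => 0 : V) = 0.
Proof. by apply: nsum0 => i; rewrite scaler0. Qed.

Lemma Biter0 l m n : Biter l m n (fun _ _ => 0 : V) = 0.
Proof. by apply: nsum0 => i; rewrite scaler0. Qed.

Lemma vanish_r_sum N (f : nat -> K) (A : nat -> int -> int -> V) :
  (forall q, vanish_r (A q)) -> vanish_r (fun a b => \sum_(q < N) f q *: A q a b).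
Proof.
move=> hA; elim: N => [|N IH]; first by exists 0 => a b _; rewrite big_ord0.
have [M hM] := vanish_r_lin (f N) (hA N) IH; exists M => a b hb.
by rewrite big_ord_recr [LHS]addrC hM.
Qed.

Lemma vanish_l_sum N (f : nat -> K) (A : nat -> int -> int -> V) :
  (forall q, vanish_l (A q)) -> vanish_l (fun a b => \sum_(q < N) f q *: A q a b).
Proof.
move=> hA; elim: N => [|N IH]; first by exists 0 => a b _; rewrite big_ord0.
have [M hM] := vanish_l_lin (f N) (hA N) IH; exists M => a b hb.
by rewrite big_ord_recr [LHS]addrC hM.
Qed.

Lemma Bcomp_sum N (f : nat -> K) (A : nat -> int -> int -> V) l m n :
  (forall q, vanish_r (A q)) ->
  Bcomp l m n (fun a b => \sum_(q < N) f q *: A q a b) =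
  \sum_(q < N) f q *: Bcomp l m n (A q).
Proof.
move=> hA; elim: N => [|N IH].
  by rewrite big_ord0 -[RHS](Bcomp0 l m n); apply: eq_Bcomp => a b; rewrite big_ord0.
rewrite [in RHS]big_ord_recr [RHS]addrC -IH -Bcomp_lin //; last exact: vanish_r_sum.
by apply: eq_Bcomp => a b; rewrite big_ord_recr [LHS]addrC.
Qed.

Lemma Biter_sum N (f : nat -> K) (A : nat -> int -> int -> V) l m n :
  (forall q, vanish_l (A q)) ->
  Biter l m n (fun a b => \sum_(q < N) f q *: A q a b) =
  \sum_(q < N) f q *: Biter l m n (A q).
Proof.
move=> hA; elim: N => [|N IH].
  by rewrite big_ord0 -[RHS](Biter0 l m n); apply: eq_Biter => a b; rewrite big_ord0.
rewrite [in RHS]big_ord_recr [RHS]addrC -IH -Biter_lin //; last exact: vanish_l_sum.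
by apply: eq_Biter => a b; rewrite big_ord_recr [LHS]addrC.
Qed.

Lemma Bcomp_shift1 A t l m n :
  Bcomp l m n (fun a b => A (a + t) b) = Bcomp l (m + t) n A.
Proof.
apply: eq_nsum => i.
by have -> : l + m - i%:Z + t = l + (m + t) - i%:Z by lia.
Qed.

Lemma Bcomp_shift2 A t l m n :
  Bcomp l m n (fun a b => A a (b + t)) = Bcomp l m (n + t) A.
Proof.
apply: eq_nsum => i.
by have -> : n + i%:Z + t = n + t + i%:Z by lia.
Qed.

Lemma Biter_shift2 A t l m n :
  Biter l m n (fun a b => A a (b + t)) = Biter l m (n + t) A.
Proof.
apply: eq_nsum => i.
by have -> : m + n - i%:Z + t = m + (n + t) - i%:Z by lia.
Qed.

(** Iterating the sum adds the exponents: this is Vandermonde's identity. *)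
Lemma Biter_comp A m' l m n : vanish_l A ->
  Biter l m n (fun a b => Biter a m' b A) = Biter l (m + m') n A.
Proof.
move=> [N hN].
pose t i q := (binz K m i * binz K m' q) *: A (l + (i + q)%N%:Z) (m + m' + n - (i +
  q)%N%:Z).
transitivity (nsum (fun i => nsum (fun q => t i q))).
  apply: eq_nsum => i; rewrite /Biter nsumV_scale; last first.
    by apply: Biter_ev; exists N.
  apply: eq_nsum => q; rewrite scalerA /t.
  have -> : l + i%:Z + q%:Z = l + (i + q)%N%:Z by lia.
  by have -> : m' + (m + n - i%:Z) - q%:Z = m + m' + n - (i + q)%N%:Z by lia.
rewrite (@nsum_antidiag _ _ t (absz (N - l))) => [|j q hjq]; last first.
  by rewrite /t hN ?scaler0 //; lia.
apply: eq_nsum => k; rewrite -binz_vandermonde scaler_suml; apply: eq_bigr => j _.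
by rewrite /t subnKC // -ltnS.
Qed.

Lemma linear_Bcomp (T : V -> V) A l m n : linear T -> vanish_r A ->
  T (Bcomp l m n A) = Bcomp l m n (fun a b => T (A a b)).
Proof.
move=> hT hA; rewrite (lin_nsum hT); last exact: Bcomp_ev.
by apply: eq_nsum => i; rewrite (linZ hT).
Qed.

Lemma linear_Biter (T : V -> V) A l m n : linear T -> vanish_l A ->
  T (Biter l m n A) = Biter l m n (fun a b => T (A a b)).
Proof.
move=> hT hA; rewrite (lin_nsum hT); last exact: Biter_ev.
by apply: eq_nsum => i; rewrite (linZ hT).
Qed.

Lemma vanish_r_deriv A : vanish_r A ->
  vanish_r (fun a b => - b%:~R *: A a (b - 1) - a%:~R *: A (a - 1) b).
Proof.
move=> [N hN]; exists (N + 1) => a b hb; rewrite !hN ?scaler0 ?subr0 //; lia.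
Qed.

Lemma vanish_l_deriv A : vanish_l A ->
  vanish_l (fun a b => - b%:~R *: A a (b - 1)).
Proof. by move=> [N hN]; exists N => a b hb; rewrite !hN ?scaler0. Qed.

Lemma nsum_addn (f : nat -> V) k : (forall i, (i < k)%N -> f i = 0) -> ev0 f ->
  nsum f = nsum (fun i => f (i + k)%N).
Proof.
elim: k f => [|k IH] f h ef; first by apply: eq_nsum => i; rewrite addn0.
rewrite (nsum_recl ef) h // add0r IH; last 2 first.
- by move=> i ik; apply: h.
- by case: ef => N hN; exists N => i hi; apply/hN/leqW.
by apply: eq_nsum => i; rewrite addnS.
Qed.

End BorcherdsLinear.

Lemma add3 (V : zmodType) (a a' b b' d d' : V) :
  a + a' - (b + b' - (d + d')) = a - (b - d) + (a' - (b' - d')).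
Proof. by rewrite !opprB opprD [X in _ + X = _]addrACA [LHS]addrACA. Qed.

Lemma combine3 (K : numFieldType) (V : lmodType K) (c e : K) (a a' b b' d d' : V) :
  c *: a + a' - (c *: b + b' - e *: (c *: d + d')) =
  c *: (a - (b - e *: d)) + (a' - (b' - e *: d')).
Proof. by rewrite scalerDr add3 !scalerBr !scalerA [e * c]mulrC. Qed.

Lemma combine_deriv (K : numFieldType) (V : lmodType K) (m n e : K)
    (a a' b b' d d' : V) :
  - (m *: a) - n *: a' - (- (m *: b) - n *: b' - e *: (- (n *: d') - m *: d)) =
  - (m *: (a - (b - e *: d))) - n *: (a' - (b' - e *: d')).
Proof.
rewrite [- (n *: d') - _]addrC scalerDr add3 -!(scaleNr m) -!(scaleNr n).
by rewrite !scalerBr !scalerA [e * - m]mulrC [e * - n]mulrC.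
Qed.

(** ** The defect of the identity and its covariance *)

Section Defect.
Variables (K : numFieldType) (r : nat) (G Q : 'I_r -> 'I_r -> K).
Hypothesis G_sym : forall i j, G i j = G j i.
Hypothesis Q_sym : forall i j, Q i j = Q j i.
Hypothesis GQ1 : forall i l, \sum_j G i j * Q j l = (i == l)%:R.
Let var : choiceType := ('I_r * nat)%type.
Let mon : choiceType := {mset var}%mset.
Variable F : based K mon.
Implicit Types (i : 'I_r) (s : mon) (x y : var) (u v w : F) (l m n p : int).
Local Notation am := (@am K r G F).
Local Notation L := (@am_linear K r G F).
Local Notation fvac := (@fvac K r F).
Local Notation Y := (@Y K r G F).
Local Notation Yder := (@Yder K r G F).
Local Notation LYl := (@Y_linl K r G F).
Local Notation LYr := (@Y_linr K r G F).

Definition comps u v w a b := Y u a (Y v b w).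
Definition iters u v w a b := Y (Y u a v) b w.

Lemma comps_vanish u v w : vanish_r (comps u v w).
Proof.
by have [N hN] := Y_trunc G v w; exists N => a b /hN; rewrite /comps => ->;
  rewrite (lin0 (LYr _ _)).
Qed.

Lemma iters_vanish u v w : vanish_l (iters u v w).
Proof.
by have [N hN] := Y_trunc G u v; exists N => a b /hN; rewrite /iters => ->;
  rewrite (lin0 (LYl _ _)).
Qed.

(** The two sides of the identity are subtracted because only their difference
    is rigid enough to be determined by its commutators and its vacuum value. *)
Definition defect u v l m n w : F :=
  Biter l m n (iters u v w) -
  (Bcomp l m n (comps u v w) - (-1) ^ l *: Bcomp l n m (comps v u w)).

Lemma defect_linl v l m n w : linear (fun u => defect u v l m n w).
Proof.
move=> c u u'; have hc := comps_vanish; have hi := iters_vanish.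
rewrite /defect (@eq_Biter _ _ _ (fun a b => c *: iters u v w a b +
  iters u' v w a b)); last first.
  by move=> a b; rewrite /iters LYl LYl.
rewrite (@eq_Bcomp _ _ (comps (c *: u + u') v w) (fun a b => c *: comps u v w a b +
  comps u' v w a b)); last first.
  by move=> a b; rewrite /comps LYl.
rewrite (@eq_Bcomp _ _ (comps v (c *: u + u') w) (fun a b => c *: comps v u w a b +
  comps v u' w a b)); last first.
  by move=> a b; rewrite /comps LYl LYr.
rewrite Biter_lin ?Bcomp_lin //.
exact: combine3.
Qed.

Lemma defect_linw u v l m n : linear (defect u v l m n).
Proof.
move=> c w w'; have hc := comps_vanish; have hi := iters_vanish.
rewrite /defect (@eq_Biter _ _ _ (fun a b => c *: iters u v w a b +
  iters u v w' a b)); last first.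
  by move=> a b; rewrite /iters LYr.
rewrite (@eq_Bcomp _ _ (comps u v _) (fun a b => c *: comps u v w a b +
  comps u v w' a b)); last first.
  by move=> a b; rewrite /comps !LYr.
rewrite (@eq_Bcomp _ _ (comps v u _) (fun a b => c *: comps v u w a b +
  comps v u w' a b)); last first.
  by move=> a b; rewrite /comps !LYr.
rewrite Biter_lin ?Bcomp_lin //; exact: combine3.
Qed.

Lemma defect_linr u l m n w : linear (fun v => defect u v l m n w).
Proof.
move=> c v v'; have hc := comps_vanish; have hi := iters_vanish.
rewrite /defect (@eq_Biter _ _ _ (fun a b => c *: iters u v w a b +
  iters u v' w a b)); last first.
  by move=> a b; rewrite /iters LYr LYl.
rewrite (@eq_Bcomp _ _ (comps u _ w) (fun a b => c *: comps u v w a b +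
  comps u v' w a b)); last first.
  by move=> a b; rewrite /comps LYl LYr.
rewrite (@eq_Bcomp _ _ (comps _ u w) (fun a b => c *: comps v u w a b +
  comps v' u w a b)); last first.
  by move=> a b; rewrite /comps LYl.
rewrite Biter_lin ?Bcomp_lin //; exact: combine3.
Qed.

(** Multiplication by z - w. *)
Lemma defect_shift u v l m n w :
  defect u v l (m + 1) n w = defect u v (l + 1) m n w + defect u v l m (n + 1) w.
Proof.
have hc := comps_vanish; have hi := iters_vanish.
rewrite /defect Biter_shift // Bcomp_shift // (@Bcomp_shift _ _ (comps v u w) l n m) //.
rewrite (signzD _ l 1) expr1z mulrN1 -add3; congr (_ - (_ - _)).
by rewrite scaleNr scalerDr addKr.
Qed.

Local Notation transl := (@transl K r G Q F).

Lemma defect_transl u v l m n w :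
  transl (defect u v l m n w) = defect u v l m n (transl w) +
    (- (m%:~R *: defect u v l (m - 1) n w) - n%:~R *: defect u v l m (n - 1) w).
Proof.
have hc := comps_vanish; have hi := iters_vanish.
have T : linear transl by exact: transl_linear.
have cov u' n' w' : transl (Y u' n' w') =
  Y u' n' (transl w') - n'%:~R *: Y u' (n' - 1) w'.
  exact: Y_transl.
have Ec u' v' l' m' n' : transl (Bcomp l' m' n' (comps u' v' w)) =
    Bcomp l' m' n' (comps u' v' (transl w)) +
    (- (m'%:~R *: Bcomp l' (m' - 1) n' (comps u' v' w)) - n'%:~R *: Bcomp l' m' (n' -
      1) (comps u' v' w)).
  rewrite linear_Bcomp // -Bcomp_deriv //.
  rewrite -[Bcomp l' m' n' (comps _ _ (transl w))]scale1r -Bcomp_lin //; last first.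
    exact: vanish_r_deriv.
  apply: eq_Bcomp => a b; rewrite /comps !cov (linB (LYr _ _)) (linZ (LYr _ _)) scale1r.
  by rewrite scaleNr addrA.
have Ei : transl (Biter l m n (iters u v w)) = Biter l m n (iters u v (transl w)) +
    (- (m%:~R *: Biter l (m - 1) n (iters u v w)) - n%:~R *: Biter l m (n - 1)
      (iters u v w)).
  rewrite linear_Biter // -Biter_deriv //.
  rewrite -[Biter l m n (iters _ _ (transl w))]scale1r -Biter_lin //; last first.
    exact: vanish_l_deriv.
  by apply: eq_Biter => a b; rewrite /iters cov scale1r scaleNr.
rewrite /defect !(linB T) (linZ T) Ei !Ec.
rewrite scalerDr add3; apply: eq_add; [by []|].
exact: combine_deriv.
Qed.

(** ** Derivations of the iterates *)

(** The weights for which [Yder f] is a derivation; the two examples are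
    [binz p] and, at [p = 0], its formal derivative with respect to [p]. *)
Definition weights (f : nat -> K) p := forall k q : nat, (0 < k)%N ->
  f (q + k)%N * 'C(q + k, k)%:R = f k * binz K (p - k%:Z) q.

(** [Yder f] applied to an iterate. Moving a_i(q) inside [u_a v] produces the
    modes a_i(k) with [k <= q]; the condition on [weights] makes the terms with
    a fixed [k] sum up to an iterate of the derived state. *)
Lemma Yder_iter f p i N u v a b w : weights f p ->
  (forall q : nat, (N <= q)%N -> am i q u = 0) ->
  (forall q : nat, (N <= q)%N -> am i q v = 0) ->
  Yder f i p (Y u a v) b w =
  \sum_(q < N) f q *: (Biter a (p - q%:Z) b (iters (am i q u) v w) +
                       iters u (am i q v) w a (b + (p - q%:Z))).
Proof.
move=> hf hu hv.
pose X (k q : nat) : F := iters (am i k u) v w (a + (q%:Z - k%:Z)) (b + p - q%:Z).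
have hX (k : nat) : exists M, forall q : nat, (M <= q)%N -> X k q = 0.
  have [M hM] := iters_vanish (am i k u) v w.
  by exists (absz (M - a + k%:Z)) => q hq; apply: hM; lia.
have eX (k : nat) (c : nat -> K) : ev0 (fun q => c q *: X k q).
  by have [M hM] := hX k; exists M => q /hM ->; rewrite scaler0.
have E (q : nat) : f q *: Y (am i q (Y u a v)) (b + p - q%:Z) w =
    f q *: iters u (am i q v) w a (b + (p - q%:Z)) +
    \sum_(k < N) (f q * 'C(q, k)%:R) *: X k q.
  rewrite am_Y_comm // /Yder (@nsumE _ _ _ N) => [|k /hu ->]; last first.
    by rewrite (lin0 (LYl _ _)) scaler0.
  rewrite (linD (LYl _ _)) scalerDr; apply: eq_add; first by rewrite addrA.
  rewrite (lin_sum (LYl _ _)) scaler_sumr; apply: eq_bigr => k _.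
  rewrite (linZ (LYl _ _)) scalerA binz_nat /X /iters.
  by rewrite -[a + q%:Z - _]addrA.
rewrite /Yder (eq_nsum E) nsumD; last 2 first.
- exists N => q /hv ->; rewrite /iters (lin0 (LYr _ _)) (lin0 (LYl _ _)) scaler0 //.
- by apply: (@ev0_sum _ _ N (fun k q => (f q * 'C(q, k)%:R) *: X k q)) => k.
rewrite (@nsumE _ _ _ N) => [|q /hv ->]; last first.
  by rewrite /iters (lin0 (LYr _ _)) (lin0 (LYl _ _)) scaler0.
rewrite addrC.
rewrite (@nsum_sum _ _ N (fun k q => (f q * 'C(q, k)%:R) *: X k q)); last first.
  by move=> k; exact: eX.
rewrite -big_split; apply: eq_bigr => k _ /=; rewrite scalerDr; apply: eq_add; [|by []].
rewrite (@nsum_addn _ _ _ k) => [|q qk|]; last 2 first.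
- by rewrite bin_small // mulr0 scale0r.
- exact: eX.
case: k => [[|k] kN] /=.
  rewrite nsum0 => [|q]; last by rewrite /X /iters am0 !(lin0 (LYl _ _)) scaler0.
  rewrite [X in _ = _ *: X]nsum0 ?scaler0 // => q.
  by rewrite /iters am0 !(lin0 (LYl _ _)) scaler0.
rewrite /Biter nsumV_scale; last by apply: Biter_ev; exact: iters_vanish.
apply: eq_nsum => q; rewrite hf // scalerA; congr (_ *: _); rewrite /X.
have -> : a + ((q + k.+1)%N%:Z - k.+1%:Z) = a + q%:Z by lia.
by have -> : b + p - (q + k.+1)%N%:Z = p - k.+1%:Z + b - q%:Z by lia.
Qed.
End Defect.

(** ** The identity holds *)

Section Borcherds.
Variables (K : numFieldType) (r : nat) (G Q : 'I_r -> 'I_r -> K).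
Hypothesis G_sym : forall i j, G i j = G j i.
Hypothesis Q_sym : forall i j, Q i j = Q j i.
Hypothesis GQ1 : forall i l, \sum_j G i j * Q j l = (i == l)%:R.
Let var : choiceType := ('I_r * nat)%type.
Let mon : choiceType := {mset var}%mset.
Variable F : based K mon.
Implicit Types (i : 'I_r) (s : mon) (x y : var) (u v w : F) (l m n p : int).
Local Notation am := (@am K r G F).
Local Notation L := (@am_linear K r G F).
Local Notation fvac := (@fvac K r F).
Local Notation Y := (@Y K r G F).
Local Notation Yder := (@Yder K r G F).
Local Notation LYl := (@Y_linl K r G F).
Local Notation LYr := (@Y_linr K r G F).
Local Notation iters := (@iters K r G F).
Local Notation comps := (@comps K r G F).
Local Notation defect := (@defect K r G F).
Local Notation transl := (@transl K r G Q F).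

Lemma Bcomp_add (A B : int -> int -> F) l m n : vanish_r A -> vanish_r B ->
  Bcomp l m n (fun a b => A a b + B a b) = Bcomp l m n A + Bcomp l m n B.
Proof.
move=> hA hB; rewrite -[Bcomp l m n A]scale1r -Bcomp_lin //.
by apply: eq_Bcomp => a b; rewrite scale1r.
Qed.

Lemma Biter_add (A B : int -> int -> F) l m n : vanish_l A -> vanish_l B ->
  Biter l m n (fun a b => A a b + B a b) = Biter l m n A + Biter l m n B.
Proof.
move=> hA hB; rewrite -[Biter l m n A]scale1r -Biter_lin //.
by apply: eq_Biter => a b; rewrite scale1r.
Qed.

Definition comps_der f i p u v w a b :=
  Yder f i p u a (Y v b w) + Y u a (Yder f i p v b w).
Definition iters_der f i p u v w a b := Yder f i p (Y u a v) b w.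

Lemma comps_der_vanish f i p u v w : vanish_r (comps_der f i p u v w).
Proof.
have [M hM] := Y_trunc G v w; have [N hN] := (Yder_field G f i p v).2 w.
exists (Order.max M N) => a b; rewrite ge_max => /andP[h1 h2].
by rewrite /comps_der hM // hN // (lin0 (LYr _ _))
  (lin0 ((Yder_field G f i p u).1 a)) addr0.
Qed.

Lemma iters_der_vanish f i p u v w : vanish_l (iters_der f i p u v w).
Proof.
have [M hM] := Y_trunc G u v; exists M => a b /hM.
by rewrite /iters_der => ->; exact: (lin0 (Yder_linl G f i p b w)).
Qed.

Section Derivation.
Variables (f : nat -> K) (i : 'I_r) (p : int) (N : nat).

Lemma Yder_fin u a w : (forall q : nat, (N <= q)%N -> am i q u = 0) ->
  Yder f i p u a w = \sum_(q < N) f q *: Y (am i q u) (a + (p - q%:Z)) w.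
Proof.
move=> hu; rewrite /Yder (@nsumE _ _ _ N).
  by apply: eq_bigr => q _; rewrite addrA.
by move=> q /hu ->; rewrite (lin0 (LYl _ _)) scaler0.
Qed.

Lemma Bcomp_der u v l m n w :
  (forall q : nat, (N <= q)%N -> am i q u = 0) ->
  (forall q : nat, (N <= q)%N -> am i q v = 0) ->
  Bcomp l m n (comps_der f i p u v w) =
  \sum_(q < N) f q *: (Bcomp l (m + (p - q%:Z)) n (comps (am i q u) v w) +
                       Bcomp l m (n + (p - q%:Z)) (comps u (am i q v) w)).
Proof.
move=> hu hv; have hc := comps_vanish.
have s1 u' v' t : vanish_r (fun a b => comps u' v' w (a + t) b).
  by have [M hM] := hc _ _ G _ u' v' w; exists M => a b hb; apply: hM.
have s2 u' v' t : vanish_r (fun a b => comps u' v' w a (b + t)).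
  by have [M hM] := hc _ _ G _ u' v' w; exists (M - t) => a b hb; apply: hM; lia.
pose A (q : nat) a b := comps (am i q u) v w (a + (p - q%:Z)) b +
  comps u (am i q v) w a (b + (p - q%:Z)).
have hA q : vanish_r (A q).
  have [M hM] := vanish_r_lin 1 (s1 (am i q u) v (p - q%:Z)) (s2 u (am i q v)
    (p - q%:Z)).
  by exists M => a b hb; rewrite -(hM a b hb) scale1r.
rewrite (@eq_Bcomp _ _ _ (fun a b => \sum_(q < N) f q *: A q a b)) => [|a b].
  rewrite Bcomp_sum //; apply: eq_bigr => q _; congr (_ *: _).
  rewrite /A Bcomp_add; [|exact: s1|exact: s2]; apply: eq_add.
    exact: (Bcomp_shift1 (comps (am i q u) v w)).
  exact: (Bcomp_shift2 (comps u (am i q v) w)).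
rewrite /comps_der !Yder_fin // (lin_sum (LYr _ _)) -big_split; apply: eq_bigr => q _.
by rewrite /= (linZ (LYr _ _)) -scalerDr.
Qed.

Lemma Biter_der u v l m n w : weights f p ->
  (forall q : nat, (N <= q)%N -> am i q u = 0) ->
  (forall q : nat, (N <= q)%N -> am i q v = 0) ->
  Biter l m n (iters_der f i p u v w) =
  \sum_(q < N) f q *: (Biter l (m + (p - q%:Z)) n (iters (am i q u) v w) +
                       Biter l m (n + (p - q%:Z)) (iters u (am i q v) w)).
Proof.
move=> hf hu hv; have hi := iters_vanish.
have s1 u' v' t : vanish_l (fun a b => Biter a t b (iters u' v' w)).
  have [M hM] := hi _ _ G _ u' v' w; exists M => a b hb; apply: nsum0 => q.
  by rewrite hM ?scaler0 //; lia.
have s2 u' v' t : vanish_l (fun a b => iters u' v' w a (b + t)).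
  by have [M hM] := hi _ _ G _ u' v' w; exists M => a b hb; apply: hM.
pose A (q : nat) a b := Biter a (p - q%:Z) b (iters (am i q u) v w) +
  iters u (am i q v) w a (b + (p - q%:Z)).
have hA q : vanish_l (A q).
  have [M hM] := vanish_l_lin 1 (s1 (am i q u) v (p - q%:Z)) (s2 u (am i q v)
    (p - q%:Z)).
  by exists M => a b hb; rewrite -(hM a b hb) scale1r.
rewrite (@eq_Biter _ _ _ (fun a b => \sum_(q < N) f q *: A q a b)) => [|a b].
  rewrite Biter_sum //; apply: eq_bigr => q _; congr (_ *: _).
  rewrite /A Biter_add; [|exact: s1|exact: s2];
    rewrite (Biter_comp _ _ _ _ (hi _ _ G _ (am i q u) v w)).
  apply: eq_add; first by [].
  exact: (Biter_shift2 (iters u (am i q v) w)).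
exact: (Yder_iter G_sym a b w hf hu hv).
Qed.

(** A derivation of all fields turns the defect of a pair of states into a
    combination of defects of derived pairs. *)
Lemma defect_der u v l m n w : weights f p ->
  (forall q : nat, (N <= q)%N -> am i q u = 0) ->
  (forall q : nat, (N <= q)%N -> am i q v = 0) ->
  Biter l m n (iters_der f i p u v w) -
  (Bcomp l m n (comps_der f i p u v w) -
     (-1) ^ l *: Bcomp l n m (comps_der f i p v u w)) =
  \sum_(q < N) f q *: (defect (am i q u) v l (m + (p - q%:Z)) n w +
                       defect u (am i q v) l m (n + (p - q%:Z)) w).
Proof.
move=> hf hu hv; rewrite Biter_der // !Bcomp_der // scaler_sumr -!sumrB.
apply: eq_bigr => q _; rewrite scalerA mulrC -scalerA -!scalerBr; congr (_ *: _).
by rewrite [X in (-1) ^ l *: X]addrC scalerDr add3.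
Qed.

End Derivation.

Lemma weights_binz p : weights (binz K p) p.
Proof. by move=> k q _; exact: binz_trinomial. Qed.

Lemma am_ev2 i u v : exists N, (forall q : nat, (N <= q)%N -> am i q u = 0) /\
  (forall q : nat, (N <= q)%N -> am i q v = 0).
Proof.
have [[M hM] [N hN]] := (am_ev0 G i u, am_ev0 G i v); exists (maxn M N).
by split=> q; rewrite geq_max => /andP[h1 h2]; [apply: hM|apply: hN].
Qed.

(** Commutators of the defect with the Heisenberg modes only involve states of
    lower weight. *)
Lemma am_defect i p N u v l m n w :
  (forall q : nat, (N <= q)%N -> am i q u = 0) ->
  (forall q : nat, (N <= q)%N -> am i q v = 0) ->
  am i p (defect u v l m n w) = defect u v l m n (am i p w) +
  \sum_(q < N) binz K p q *: (defect (am i q u) v l (m + (p - q%:Z)) n w +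
                       defect u (am i q v) l m (n + (p - q%:Z)) w).
Proof.
move=> hu hv; rewrite -defect_der //; last exact: weights_binz.
have hc := comps_vanish; have hi := iters_vanish; have LA := L i p.
have hcd := comps_der_vanish; have hid := iters_der_vanish.
have Ec u' v' l' m' n' : am i p (Bcomp l' m' n' (comps u' v' w)) =
    Bcomp l' m' n' (comps u' v' (am i p w)) +
      Bcomp l' m' n' (comps_der (binz K p) i p u' v' w).
  have h1 : vanish_r (comps u' v' w) by exact: hc.
  have h2 : vanish_r (comps u' v' (am i p w)) by exact: hc.
  have h3 : vanish_r (comps_der (binz K p) i p u' v' w) by exact: hcd.
  rewrite linear_Bcomp // -Bcomp_add //; apply: eq_Bcomp => a b.
  rewrite /comps !(am_Y_comm G_sym) (linD (LYr _ _)) -[LHS]addrA; apply: eq_add;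
    [by []|].
  by rewrite addrC.
have Ei : am i p (Biter l m n (iters u v w)) =
    Biter l m n (iters u v (am i p w)) + Biter l m n (iters_der (binz K p) i p u v w).
  have h1 : vanish_l (iters u v w) by exact: hi.
  have h2 : vanish_l (iters u v (am i p w)) by exact: hi.
  have h3 : vanish_l (iters_der (binz K p) i p u v w) by exact: hid.
  rewrite linear_Biter // -Biter_add //; apply: eq_Biter => a b.
  exact: am_Y_comm.
by rewrite /defect !(linB LA) (linZ LA) Ei !Ec scalerDr add3.
Qed.

Lemma hom_defect d e c u v l m n w : hom d u -> hom e v -> hom c w ->
  hom (c + d + e - l - m - n - 2) (defect u v l m n w).
Proof.
move=> hu hv hw; rewrite /defect.
have hN t z : hom t z -> hom t (- z) by move=> h; rewrite -scaleN1r; apply: homZ.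
have Hc d' e' u' v' m' n' : hom d' u' -> hom e' v' ->
    hom (c + d' + e' - l - m' - n' - 2) (Bcomp l m' n' (comps u' v' w)).
  move=> hu' hv'; apply: hom_nsum => i; apply: homZ.
  have := Y_hom G (l + m' - i%:Z) hu' (Y_hom G (n' + i%:Z) hv' hw).
  by congr (hom _ _); lia.
apply: homD; last apply/hN/homD; last apply/hN/homZ.
- apply: hom_nsum => i; apply: homZ.
  have := Y_hom G (m + n - i%:Z) (Y_hom G (l + i%:Z) hu hv) hw.
  by congr (hom _ _); lia.
- exact: Hc.
have := Hc _ _ _ _ n m hv hu; congr (hom _ _); lia.
Qed.

Section OnVacuum.
Variables u v : F.
Local Notation S l m n := (defect u v l m n fvac).

Lemma Bcomp_fvac0 u' v' l m n : 0 <= n -> Bcomp l m n (comps u' v' fvac) = 0.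
Proof.
move=> n0; apply: nsum0 => i; rewrite /comps Y_fvac_ge0; last by lia.
by rewrite (lin0 (LYr _ _)) scaler0.
Qed.

Lemma Bcomp_fvacN1 u' v' l m : Bcomp l m (-1) (comps u' v' fvac) = Y u' (l + m) v'.
Proof.
rewrite /Bcomp (@nsum1 _ _ _ 0) => [|[//|i] _].
  by rewrite expr0 binz0 mulr1 scale1r /comps subr0 addr0 Y_fvacN1.
rewrite /comps Y_fvac_ge0; last by lia.
by rewrite (lin0 (LYr _ _)) scaler0.
Qed.

Lemma defect_fvac_ge0 l (m : nat) n : 0 <= n -> S l m n = 0.
Proof.
move=> n0; rewrite /defect !Bcomp_fvac0 // scaler0 !subr0; apply: nsum0 => i.
rewrite binz_nat; have [mi|im] := ltnP m i; first by rewrite bin_small // scale0r.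
by rewrite /iters Y_fvac_ge0 ?scaler0 //; lia.
Qed.

Lemma defect_fvac_m1 l (m : nat) : S l m (-1) = 0.
Proof.
elim: m l => [|m IH] l; last first.
  rewrite -[m.+1]addn1 PoszD defect_shift IH add0r; exact: defect_fvac_ge0.
rewrite /defect (Bcomp_fvac0 v u l (-1) (lexx 0)) scaler0 subr0 Bcomp_fvacN1 addr0.
rewrite /Biter (@nsum1 _ _ _ 0) => [|i i0]; last first.
  by rewrite (binz_nat K 0 i) bin_small ?scale0r // lt0n.
by rewrite binz0 scale1r /iters addr0 add0r subr0 Y_fvacN1 subrr.
Qed.

Lemma transl_defect_fvac l m n : transl (S l m n) =
  - (m%:~R *: S l (m - 1) n) - n%:~R *: S l m (n - 1).
Proof.
by rewrite (@defect_transl _ _ _ Q) // transl_fvac (lin0 (defect_linw _ _ _ _ _ _))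
  add0r.
Qed.

(** For [m >= 0] translation covariance lowers [n] from -1. *)
Lemma defect_fvac_nat l (m : nat) n : S l m n = 0.
Proof.
have [n0|n0] := leP 0 n; first exact: defect_fvac_ge0.
have [k ->] : exists k : nat, n = - k%:Z - 1 by exists (absz (n + 1)); lia.
elim: k l m {n n0} => [|k IH] l m; first exact: defect_fvac_m1.
have := transl_defect_fvac l m (- k%:Z - 1);
  rewrite IH (lin0 (@transl_linear K r G Q F)).
have -> : m%:~R *: S l (m%:Z - 1) (- k%:Z - 1) = 0.
  case: m => [|m]; first by rewrite scale0r.
  have -> : m.+1%:Z - 1 = m%:Z by lia.
  by rewrite IH scaler0.
rewrite oppr0 add0r => /eqP; rewrite eq_sym oppr_eq0 scaler_eq0 intr_eq0.
by case/orP=> [|/eqP h]; [lia|rewrite -h; congr (defect _ _ _ _ _ _); lia].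
Qed.

Hypothesis kill : forall l m n i (q : nat), am i q.+1%:Z (S l m n) = 0.
Variables d e : int.
Hypotheses (hu : hom d u) (hv : hom e v).

(** The case [m = -1] is not reached by covariance. The value is killed by
    the annihilation operators, hence zero outside weight zero; in weight zero
    its vanishing is the leading skew symmetry. *)
Lemma defect_fvac_N1_nat l (n : nat) : S l (-1) n = 0.
Proof.
have [lE|lN] := eqVneq l (d + e - 1 - n%:Z); last first.
  have h : hom (d + e - 1 - n%:Z - l) (S l (-1) n).
    by have := hom_defect l (-1) n hu hv (hom_fvac F); congr (hom _ _); lia.
  by apply: (killed_eq0 G_sym Q_sym GQ1 _ h) => [i q|]; [exact: kill|lia].
rewrite /defect Bcomp_fvac0 // add0r Bcomp_fvacN1 opprK.
rewrite /Biter (@nsum1 _ _ _ n) => [|i ni]; last first.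
  rewrite /iters; case: (ltnP i n) => [lt|ge].
    by rewrite Y_fvac_ge0 ?scaler0 //; lia.
  have -> : Y u (l + i%:Z) v = 0 by apply: hom_lt0 (Y_hom G (l + i%:Z) hu hv); lia.
  by rewrite (lin0 (LYl _ _)) scaler0.
have -> : l + n%:Z = d + e - 1 by lia.
have -> : -1 + n%:Z - n%:Z = -1 by lia.
rewrite binzN1 /iters Y_fvacN1 (skew_lead _ hu hv) // scalerA -scalerDl.
rewrite [X in X *: _](_ : _ = 0) ?scale0r //.
have -> : d + e = l + n%:Z + 1 by lia.
by rewrite !signzD expr1z mulrN1 mulrN mulrCA -expr2 sqrr_sign mulr1 addNr.
Qed.

(** For [m = -1] multiplication by z - w lowers [n], and below [m = -1]
    translation covariance lowers [m]. *)
Lemma defect_fvac l m n : S l m n = 0.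
Proof.
have N1 l' n' : S l' (-1) n' = 0.
  have [n0|n0] := leP 0 n'; first by case: n' n0 => // n' _; exact: defect_fvac_N1_nat.
  have [k ->] : exists k : nat, n' = - k%:Z by exists (absz n'); lia.
  elim: k l' {n' n0} => [|k IH] l'; first by rewrite oppr0; exact: defect_fvac_N1_nat.
  have := defect_shift G u v (l' - 1) (-1) (- k.+1%:Z) fvac.
  rewrite addNr (defect_fvac_nat (l' - 1) 0) subrK.
  have -> : - k.+1%:Z + 1 = - k%:Z by lia.
  by rewrite IH addr0.
have [m0|m0] := leP 0 m; first by case: m m0 => // m _; exact: defect_fvac_nat.
have [k ->] : exists k : nat, m = - k%:Z - 1 by exists (absz (m + 1)); lia.
elim: k l n {m m0} => [|k IH] l n; first exact: N1.
have := transl_defect_fvac l (- k%:Z - 1) n;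
  rewrite !IH (lin0 (@transl_linear K r G Q F)).
rewrite scaler0 subr0 => /eqP; rewrite eq_sym oppr_eq0 scaler_eq0 intr_eq0.
by case/orP=> [|/eqP h]; [lia|rewrite -h; congr (defect _ _ _ _ _ _); lia].
Qed.
End OnVacuum.

(** By induction on the total weight the defect commutes with all Heisenberg
    modes, so it is determined by its value on the vacuum. *)
Lemma defect_hom (k : nat) (d e : nat) u v l m n w : (d + e < k)%N ->
  hom d u -> hom e v -> defect u v l m n w = 0.
Proof.
elim: k d e u v l m n w => // k IH d e u v l m n w dek hu hv.
have comm i p l' m' n' w' : am i p (defect u v l' m' n' w') =
  defect u v l' m' n' (am i p w').
  have [N [h1 h2]] := am_ev2 i u v.
  rewrite (am_defect p l' m' n' w' h1 h2) big1 ?addr0 // => q _.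
  have Z (a : nat) z : hom a z -> am i q z = 0 \/
      ((0 < q)%N /\ (q <= a)%N /\ hom (a - q)%N (am i q z)).
    move=> hz; case: (posnP q) => [->|q0]; first by left.
    have := @hom_am _ _ G _ i q _ _ hz; have [qa|aq] := leqP q a => h.
      by right; rewrite -subzn.
    by left; apply: hom_lt0 h; lia.
  have -> : defect (am i q u) v l' (m' + (p - q%:Z)) n' w' = 0.
    case: (Z _ _ hu) => [->|[q0 [qd h]]]; first exact: (lin0 (defect_linl _ _ _ _ _ _)).
    by apply: (IH _ _ _ _ _ _ _ _ _ h hv); lia.
  have -> : defect u (am i q v) l' m' (n' + (p - q%:Z)) w' = 0.
    case: (Z _ _ hv) => [->|[q0 [qe h]]]; first exact: (lin0 (defect_linr _ _ _ _ _ _)).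
    by apply: (IH _ _ _ _ _ _ _ _ _ hu h); lia.
  by rewrite addr0 scaler0.
elim/(@fock_ind _ _ G F): w l m n => [|c w w' E E'||i j w E] l m n.
- exact: (lin0 (defect_linw _ _ _ _ _ _)).
- by rewrite defect_linw E E' scaler0 addr0.
- apply: (defect_fvac _ hu hv) => l' m' n' i q.
  by rewrite comm am_fvac (lin0 (defect_linw _ _ _ _ _ _)).
by rewrite -comm E (lin0 (L _ _)).
Qed.

(** The Borcherds identity for the adjoint module of M(1,0). *)
Theorem borcherds u v l m n w : defect u v l m n w = 0.
Proof.
elim/based_ind: u => [|c u u' E E'|s]; first exact: (lin0 (defect_linl _ _ _ _ _ _)).
  by rewrite defect_linl E E' scaler0 addr0.
elim/based_ind: v => [|c v v' E E'|t]; first exact: (lin0 (defect_linr _ _ _ _ _ _)).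
  by rewrite defect_linr E E' scaler0 addr0.
exact: (defect_hom (k := (weight s + weight t).+1) _ _ _ _ (leqnn _) (homU _ _)
  (homU _ _)).
Qed.
End Borcherds.

(** * The charge-zero quotient of a conic-type subVOA *)

Section MonoidAlgebra.
Variables (K : numFieldType) (I : choiceType).

Lemma malg_span (v : {malg K[I]}) : v = \sum_(k <- msupp v) v@_k *: << k >>.
Proof.
rewrite [LHS]monalgE; apply: eq_bigr => k _; apply/malgP => k'.
by rewrite mcoeffZ !mcoeffU mulr_natr.
Qed.

Definition malg_based : based K I.
Proof.
apply: (@Based K I {malg K[I]} (fun k => << k >>) (fun k v => v@_k)
  (fun v => msupp v)).
- by move=> k c x y; rewrite mcoeffD mcoeffZ.
- by move=> k k'; rewrite mcoeffU.
- by move=> v; exact: fset_uniq.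
- by move=> v k; exact: mcoeff_neq0.
- exact: malg_span.
Defined.

End MonoidAlgebra.

Section Lext.
Variables (K : numFieldType) (L : even_lattice) (W : lmodType K).
Implicit Type f : fock_index L -> W.

Lemma lext_linear f : linear (@lext K L W f).
Proof. exact: (@mext_linear _ _ (malg_based K (fock_index L)) W f). Qed.

Lemma lext_bvec f k : lext f (bvec K k) = f k.
Proof. exact: (@mextU _ _ (malg_based K (fock_index L)) W f k). Qed.

Lemma VL_ext (A B : VL K L -> W) : linear A -> linear B ->
  (forall k, A (bvec K k) = B (bvec K k)) -> forall v, A v = B v.
Proof. exact: (@linear_ext _ _ (malg_based K (fock_index L)) W A B). Qed.

End Lext.

Lemma zsumE (K : pzRingType) (V : lmodType K) (g : int -> V) N :
  (forall m : int, (N <= absz m)%N -> g m = 0) ->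
  \sum_(m \in classical_sets.setT) g m =
  nsum (fun k => g (Negz k)) + nsum (fun k => g (Posz k)).
Proof.
move=> h; pose s := map Negz (iota 0 N) ++ map Posz (iota 0 N).
have us : uniq s.
  rewrite cat_uniq !map_inj_uniq ?iota_uniq ?andbT /=; try by move=> x y [].
  by apply/hasPn => m /mapP[k _ ->]; apply/mapP => -[].
rewrite (fsbigTE [fset m in s]%fset) => [|m]; last first.
  rewrite inE /= negb_or !inE => /andP[h1 h2]; apply: h; rewrite leqNgt.
  case: m h1 h2 => k /= h1 h2.
    by apply: contra h2 => kN; apply/mapP; exists k; rewrite ?mem_iota.
  by apply: contra h1 => kN; apply/mapP; exists k; rewrite ?mem_iota //= ltnW.
rewrite (perm_big s) /=; last by apply: uniq_perm => [|//|m];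
  rewrite ?fset_uniq ?in_fset.
rewrite big_cat !big_map; congr (_ + _); symmetry; rewrite (@nsumE _ _ _ N).
- by rewrite -(big_mkord xpredT (fun k => g (Negz k))) /index_iota subn0.
- by move=> k kN; apply: h; exact: leqW.
- by rewrite -(big_mkord xpredT (fun k => g (Posz k))) /index_iota subn0.
- by move=> k kN; apply: h.
Qed.

Section Projection.
Variables (K : numFieldType) (L : even_lattice) (F : based K {mset var L}%mset).
Variable eps : lvec L -> lvec L -> int.
Hypothesis eps0 : forall a, eps 0 a = 1.

Definition gramK (i j : 'I_(lrank L)) : K := cform (delta_mx 0 i) (delta_mx 0 j).
Local Notation am := (@am K (lrank L) gramK F).
Local Notation Y := (@Y K (lrank L) gramK F).
Local Notation fvac := (@fvac K (lrank L) F).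

(** The projection of V_L onto its part of charge zero, which is M(1,0). *)
Definition proj0 : VL K L -> F :=
  lext (fun k => if k.2 == 0 then 'v_(k.1) else 0).

Lemma proj0_linear : linear proj0. Proof. exact: lext_linear. Qed.

Lemma proj0_bvec k : proj0 (bvec K k) = if k.2 == 0 then 'v_(k.1) else 0.
Proof. exact: lext_bvec. Qed.

Lemma proj0_charged (M : {pred lvec L}) v : 0 \notin M -> v \in VM_pred M ->
  proj0 v = 0.
Proof.
move=> M0 /VM_predP hv; rewrite /proj0 /lext big_seq big1 // => k.
rewrite -mcoeff_neq0 => /hv kM; case: eqP => [k0|_]; last by rewrite scaler0.
by rewrite k0 (negbTE M0) in kM.
Qed.

Lemma heis_linear h m : linear (@heis K L h m).
Proof.
case: m => [[|n]|n]; rewrite /heis.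
- exact: lext_linear.
- by apply/scaled_linear/sum_linear => i; apply/scaled_linear/lext_linear.
- by apply/sum_linear => i; apply/scaled_linear/lext_linear.
Qed.

Lemma cformDl (h : cartan K L) i : cform h (delta_mx 0 i) =
  \sum_j h 0 j * gramK j i.
Proof.
rewrite {1}/cform -mulmxA mxE; apply: eq_bigr => j _; congr (_ * _).
by rewrite /gramK /cform -mulmxA -rowE [RHS]mxE.
Qed.

Lemma proj0_heis h m v :
  proj0 (heis h m v) = \sum_i h 0 i *: am i m (proj0 v).
Proof.
have P := proj0_linear; have La := am_linear gramK.
apply: (VL_ext (A := fun v => proj0 (heis h m v))
  (B := fun v => \sum_i h 0 i *: am i m (proj0 v))) => [c x y|c x y|[s a]] {v}.
- by rewrite heis_linear P.
- rewrite scaler_sumr -big_split; apply: eq_bigr => i _ /=.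
  by rewrite P La scalerDr !scalerA mulrC.
rewrite proj0_bvec /=; case: m => [[|n]|n] /=.
- rewrite big1 => [|i _]; last by rewrite am0 scaler0.
  rewrite lext_bvec (linZ P) proj0_bvec /=; case: eqP => [->|_]; last by
    rewrite scaler0.
  by rewrite /cform /tocartan map_mx0 trmx0 mulmx0 mxE scale0r.
- under eq_bigr => i _ do rewrite /annihilation lext_bvec.
  rewrite (linZ P) (lin_sum P).
  transitivity (n.+1%:R *: \sum_i \sum_j (h 0 j * gramK j i) *: fannih (i, n)
    (if a == 0 then 'v_s else 0 : F)).
    congr (_ *: _); apply: eq_bigr => i _; rewrite (linZ P)
      (linZ P) proj0_bvec /= cformDl scaler_suml.
    apply: eq_bigr => j _; congr (_ *: _).
    by case: eqP => _; rewrite ?(lin0 (fannih_linear _)) ?scaler0 // /fannih mextU.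
  rewrite exchange_big scaler_sumr; apply: eq_bigr => j _ /=.
  rewrite amP [RHS]scalerA [X in _ = X *: _]mulrC -[RHS]scalerA; congr (_ *: _).
  rewrite scaler_sumr.
  by apply: eq_bigr => i _; rewrite scalerA.
- under eq_bigr => i _ do rewrite /creation lext_bvec.
  rewrite (lin_sum P); apply: eq_bigr => i _; rewrite (linZ P) proj0_bvec /= amN.
  by case: eqP => _; rewrite /fcreate ?mextU // (lin0 (mext_linear _)).
Qed.

Lemma proj0_heis_delta i m v : proj0 (heis (delta_mx 0 i) m v) = am i m (proj0 v).
Proof.
rewrite proj0_heis (bigD1 i) //= mxE !eqxx scale1r big1 ?addr0 // => j ji.
by rewrite mxE (negbTE ji) andbF scale0r.
Qed.

(** *** Fields of charge zero *)

(** What is needed of a field on V_L for its normally ordered products to be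
    finite sums. *)
Definition quasi_field (B : int -> VL K L -> VL K L) :=
  (forall n, B n 0 = 0) /\
  (forall v, exists N : int, forall n, N <= n -> B n v = 0).

Lemma heis_ev0 (h : cartan K L) v : exists N, forall k : nat,
  (N <= k)%N -> heis h k v = 0.
Proof.
apply: (@based_ind _ _ (malg_based K (fock_index L))
  (fun v : VL K L => exists N, forall k : nat, (N <= k)%N -> heis h k v = 0)).
- by exists 0%N => k _; exact: (lin0 (heis_linear h k)).
- move=> c x y [M hM] [N hN]; exists (maxn M N) => k; rewrite geq_max => /andP[h1 h2].
  by apply: etrans (heis_linear h k c x y) _; rewrite hM // hN // scaler0 addr0.
move=> [s a]; exists (weight s).+2 => -[//|k] hk.
rewrite /heis big1 ?scaler0 // => i _.
have -> : annihilation (i, k) (bvec K (s, a)) = 0; last by rewrite scaler0.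
apply: etrans (lext_bvec _ _) _ => /=.
have [->|sx] := eqVneq (s (i, k)) 0%N; first by rewrite scale0r.
have := weight1D (i, k) (s `\ (i, k))%mset.
by rewrite msetB1K -?mset_neq0 //= => e; move: hk; rewrite e; lia.
Qed.

Lemma normal_order_quasi (h : cartan K L) j B : quasi_field B -> quasi_field
  (normal_order h j B).
Proof.
move=> [B0 hB]; split=> [n|v].
  rewrite /normal_order fsbig1 // => m _.
  by rewrite !B0 !(lin0 (heis_linear _ _)) B0 if_same scaler0.
have [M hM] := heis_ev0 h v.
have [N1 hN1] := hB v.
have [N2 hN2] : exists N : int, forall k : nat, (k < M)%N -> forall n,
  N <= n -> B n (heis h k v) = 0.
  elim: M {hM} => [|M [N IH]]; first by exists 0.
  have [N' hN'] := hB (heis h M v); exists (Order.max N N') => k;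
    rewrite ltnS leq_eqVlt.
  move=> /orP[/eqP->|kM] n; rewrite ge_max => /andP[h1 h2]; first exact: hN'.
  exact: IH.
exists (Order.max (N1 + j%:Z) (N2 + j%:Z + M%:Z + 1)) => n; rewrite ge_max =>
  /andP[h1 h2].
rewrite /normal_order fsbig1 // => m _; case: ifP => m0.
  by rewrite hN1 ?(lin0 (heis_linear _ _)) ?scaler0 //; lia.
case: m m0 => // k _; have [kM|Mk] := ltnP k M.
  by rewrite (hN2 _ kM) ?scaler0 //; lia.
by rewrite hM // B0 scaler0.
Qed.

Lemma proj0_normal_order i j B (B' : int -> F -> F) n v : quasi_field B ->
  (forall n v, proj0 (B n v) = B' n (proj0 v)) ->
  proj0 (normal_order (delta_mx 0 i) j B n v) = NO gramK i j B' n (proj0 v).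
Proof.
move=> [B0 hB] E; have P := proj0_linear.
have [M hM] := heis_ev0 (delta_mx 0 i) v; have [N hN] := hB v.
have [g gE] : {g : int -> VL K L | g = fun m => binz K (- m - 1) j *:
    (if m < 0 then heis (delta_mx 0 i) m (B (n - m - j%:Z - 1) v)
     else B (n - m - j%:Z - 1) (heis (delta_mx 0 i) m v))} by eexists.
pose R := maxn M (absz (N - n + j%:Z + 1)%R).
have ev (m : int) : (R <= absz m)%N -> g m = 0.
  rewrite gE geq_max => /andP[h1 h2]; case: m h1 h2 => k h1 h2.
    by rewrite (_ : (Posz k < 0) = false) // hM // B0 scaler0.
  rewrite (_ : (Negz k < 0) = true) //.
  by rewrite hN ?(lin0 (heis_linear _ _)) ?scaler0 //; lia.
have e1 : ev0 (fun k => g (Negz k)) by exists R => k hk; apply: ev; exact: leqW.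
have e2 : ev0 (fun k => g (Posz k)) by exists R => k hk; apply: ev.
have -> : normal_order (delta_mx 0 i) j B n v = nsum (fun k => g (Negz k)) +
  nsum (fun k => g (Posz k)).
  by rewrite -(zsumE ev) gE.
rewrite [LHS](linD P) (lin_nsum P e1) (lin_nsum P e2).
apply: eq_add; apply: eq_nsum => k; rewrite gE (linZ P).
  rewrite proj0_heis_delta E.
  have -> : - Negz k - 1 = k%:Z by lia.
  have -> : n - Negz k - j%:Z - 1 = n + k%:Z - j%:Z by lia.
  by rewrite binz_nat.
by rewrite E proj0_heis_delta.
Qed.

(** *** The operator of the trivial exponential *)

Lemma heis0 m v : heis (0 : cartan K L) m v = 0.
Proof.
case: m => [[|n]|n]; rewrite /heis.
- rewrite /lext big1 // => k _; rewrite (_ : cform _ _ = 0) ?scale0r ?scaler0 //.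
  by rewrite /cform !mul0mx mxE.
- rewrite big1 ?scaler0 // => i _; rewrite (_ : cform _ _ = 0) ?scale0r //.
  by rewrite /cform !mul0mx mxE.
- by rewrite big1 // => i _; rewrite mxE scale0r.
Qed.

Lemma tocartan0 : tocartan K (0 : lvec L) = 0.
Proof. by apply/matrixP => i j; rewrite !mxE. Qed.

Lemma exp_coef0 (A : nat -> VL K L -> VL K L) k v : (forall n v, A n v = 0) ->
  exp_coef A k v = if k == 0%N then v else 0.
Proof.
move=> hA; rewrite /exp_coef big_ord_recl /= fact0 invr1 scale1r big1 ?addr0 // => j _.
by rewrite big1 ?scaler0 // => i _; rewrite hA.
Qed.

(** Y(e^0,z) is the identity: both exponentials have exponent zero. *)
Lemma Yexp0 n (v : VL K L) : Yexp eps 0 n v = if n == -1 then v else 0.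
Proof.
apply: (VL_ext (A := Yexp eps 0 n) (B := fun v : VL K L =>
  if n == -1 then v else 0)) => [|c x y|k] {v}.
- exact: lext_linear.
- by case: ifP => _ //; rewrite scaler0 addr0.
rewrite /Yexp lext_bvec.
have Ez : lform 0 k.2 = 0 by rewrite /lform !mul0mx mxE.
have E p q : exp_minus 0 p (exp_plus 0 q ((eps 0 k.2)%:~R *: bvec K (k.1, 0 + k.2))) =
    if (p == 0%N) && (q == 0%N) then bvec K k else 0.
  rewrite /exp_minus exp_coef0 => [|m w]; last by rewrite tocartan0 heis0 scaler0.
  rewrite /exp_plus exp_coef0 => [|m w]; last by rewrite tocartan0 heis0 scaler0 oppr0.
  by rewrite eps0 scale1r add0r -surjective_pairing; case: (p == 0%N); case: (q == 0%N).
case: eqP => [->|n1]; last first.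
  rewrite fsbig1 // => -[p q] /=; rewrite Ez E => h; case: ifP =>
    // /andP[/eqP p0 /eqP q0].
  by case: n1; move: h; rewrite p0 q0; lia.
rewrite -(fsbig_widen (set1 (0%N, 0%N))) => [|pq ->|[p q] [_ /= h]].
- by rewrite fsbig_set1 E.
- by rewrite /= Ez.
by rewrite E; case: ifP => // /andP[/eqP p0 /eqP q0]; case: h; rewrite p0 q0.
Qed.

Lemma Yexp0_quasi : quasi_field (Yexp eps 0).
Proof.
split=> [n|v]; first by rewrite Yexp0 if_same.
by exists 0 => n n0; rewrite Yexp0 (_ : n == -1 = false) //; lia.
Qed.

Lemma proj0_Ybasis s n v : proj0 (Ybasis eps (s, 0) n v) = Ymon gramK s n (proj0 v).
Proof.
rewrite /Ybasis /Ymon /=.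
suff [] : quasi_field (foldr (fun x : var L => normal_order (delta_mx 0 x.1) x.2)
  (Yexp eps 0) (enum_mset s)) /\
  forall n v, proj0 (foldr (fun x : var L => normal_order (delta_mx 0 x.1) x.2)
    (Yexp eps 0) (enum_mset s) n v) =
    foldr (fun x => NO gramK x.1 x.2) (@Y1 K (lrank L) F)
      (enum_mset s) n (proj0 v) by [].
elim: (enum_mset s) => [|x l [IH1 IH2]] /=.
  split=> [|m w]; first exact: Yexp0_quasi.
  by rewrite Yexp0 /Y1; case: eqP => // _; rewrite (lin0 proj0_linear).
split=> [|m w]; first exact: normal_order_quasi.
exact: proj0_normal_order.
Qed.

End Projection.

(** ** Lattice facts *)

Section Conic.
Variables (L : even_lattice) (C : {pred lvec L}).
Hypothesis hC : conic_type C.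

(** The coordinates in the defining basis are nonnegative, so they vanish if
    they sum to zero. *)
Lemma conic_pointed a b : a \in C -> b \in C -> a + b = 0 -> a = 0.
Proof.
case: hC => e eb hx /hx[c ->] /hx[d ->]; rewrite -big_split /= => h.
have [z [_ uz]] := eb 0.
have E1 : 0 = \sum_i e i *~ [ffun i => (c i + d i)%N%:Z] i.
  by rewrite -[LHS]h; apply: eq_bigr => i _; rewrite ffunE -mulrnDr pmulrn.
have E2 : 0 = \sum_i e i *~ [ffun i : 'I_(lrank L) => 0 : int] i.
  by rewrite big1 // => i _; rewrite ffunE mulr0z.
rewrite big1 // => i _; have := congr1 (fun f : {ffun _} => f i)
  (etrans (esym (uz _ E1)) (uz _ E2)).
by rewrite !ffunE => ei; rewrite (_ : c i = 0%N) ?mulr0n //; lia.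
Qed.

Lemma conic_neq0 : (0 < lrank L)%N -> exists2 a, a \in C & a != 0.
Proof.
move=> r0; case: hC => e eb hx; pose i0 := Ordinal r0; exists (e i0).
  apply/hx; exists (fun i => (i == i0)%N : nat); rewrite (bigD1 i0) // eqxx mulr1n.
  rewrite big1 => [|i /negbTE ->]; [exact/esym/addr0|exact: mulr0n].
apply/eqP => e0; have [z [_ uz]] := eb 0.
have E1 : 0 = \sum_i e i *~ [ffun i => (i == i0)%:Z] i.
  rewrite (bigD1 i0) // ffunE eqxx e0 mul0rz big1 => [|i /negbTE ne].
    exact/esym/addr0.
  by rewrite ffunE ne mulr0z.
have E2 : 0 = \sum_i e i *~ [ffun i : 'I_(lrank L) => 0 : int] i.
  by rewrite big1 // => i _; rewrite ffunE mulr0z.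
have := congr1 (fun f : {ffun _} => f i0) (etrans (esym (uz _ E1)) (uz _ E2)).
by rewrite !ffunE eqxx.
Qed.

End Conic.

Section Gram.
Variables (K : numFieldType) (L : even_lattice) (u : 'I_(lrank L) -> cartan K L).
Hypothesis hu : orthonormal_basis u.

Lemma gramKE i j : gramK K i j = (gram L i j)%:~R.
Proof.
by rewrite /gramK /cform -rowE mxE (bigD1 j) //= !mxE !eqxx mulr1 big1 ?addr0 // =>
  k kj;
  rewrite !mxE (negbTE kj) mulr0.
Qed.

Lemma gramK_sym i j : gramK K (L := L) i j = gramK K j i.
Proof. by rewrite !gramKE -[in LHS](gram_sym L) mxE. Qed.

Lemma gramK_diag i : gramK K (L := L) i i != 0.
Proof.
rewrite gramKE intr_eq0; have := @gram_posdef L (delta_mx 0 i).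
rewrite -rowE; set x := (X in 0 < X); have -> : x = gram L i i.
  rewrite /x mxE (bigD1 i) //= !mxE !eqxx mulr1 big1 ?addr0 // => k ki.
  by rewrite !mxE (negbTE ki) mulr0.
move=> h; rewrite gt_eqF // h //; apply/eqP => /matrixP /(_ 0 i).
by rewrite !mxE !eqxx.
Qed.

(** The inverse Gram matrix, computed from an orthonormal basis. *)
Definition dualG (j l : 'I_(lrank L)) : K := \sum_k u k 0 j * u k 0 l.

Lemma dualG_sym j l : dualG j l = dualG l j.
Proof. by apply: eq_bigr => k _; rewrite mulrC. Qed.

Lemma gramK_dualG i l : \sum_j gramK K i j * dualG j l = (i == l)%:R.
Proof.
pose U : 'M[K]_(lrank L) := \matrix_(k, j) u k 0 j.
pose Gm : 'M[K]_(lrank L) := map_mx intr (gram L).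
have UGU : U *m (Gm *m U^T) = 1%:M.
  apply/matrixP => a b; rewrite mxE [RHS]mxE -hu /cform -mulmxA mxE.
  apply: eq_bigr => k _; rewrite !mxE; congr (_ * _); apply: eq_bigr => m _.
  by rewrite !mxE.
have := congr1 (fun M : 'M_ _ => M i l) (mulmx1C UGU); rewrite -mulmxA !mxE => <-.
apply: eq_bigr => j _; rewrite mxE gramKE; congr (_ * _).
by rewrite mxE; apply: eq_bigr => k _; rewrite !mxE.
Qed.

End Gram.

(** ** The projection is a morphism *)

Section Morphism.
Variables (K : numFieldType) (L : even_lattice) (F : based K {mset var L}%mset).
Variable eps : lvec L -> lvec L -> int.
Hypothesis eps0 : forall a, eps 0 a = 1.
Variable C : addrClosed (lvec L).
Hypothesis pointed : forall a b, a \in C -> b \in C -> a + b = 0 -> a = 0.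
Local Notation gramK := (@gramK K L).
Local Notation proj0 := (@proj0 K L F).
Local Notation Y := (@Y K (lrank L) gramK F).

Definition charged : {pred lvec L} := [pred a | (a \in C) && (a != 0)].

(** A state of nonzero charge raises all charges in [C] to nonzero ones, since
    [C] is pointed. *)
Lemma Ybasis_charged s a n (v : VL K L) : a \in charged -> v \in VM_pred C ->
  Ybasis eps (s, a) n v \in VM_pred charged.
Proof.
move=> ha; have /andP[aC a0] := ha; rewrite /Ybasis /=.
elim: (enum_mset s) n v => [|x t IH] n v hv /=; last first.
  apply: rpred_sum => m _; apply: rpredZ.
  by case: ifP => _; [exact/VM_heis/IH|exact/IH/VM_heis].
apply: VM_lext hv => k kC; apply: rpred_sum => pq _.
apply: VM_exp_coef => [i x hx|]; first exact/rpredZ/VM_heis.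
apply: VM_exp_coef => [i x hx|]; first by rewrite rpredN; exact/rpredZ/VM_heis.
apply/rpredZ/VM_bvec; rewrite inE /= rpredD //=.
by apply: contraNneq a0 => /(pointed aC kC) ->.
Qed.

Lemma proj0_mode (x y : VL K L) n : x \in VM_pred C -> y \in VM_pred C ->
  proj0 (VLmode eps x n y) = Y (proj0 x) n (proj0 y).
Proof.
move=> hx hy; have P := @proj0_linear K L F; have LY := Y_linl gramK n (proj0 y).
have Ex : proj0 x = \sum_(k <- msupp x) x@_k *: (if k.2 == 0 then 'v_(k.1) else 0)
  by [].
rewrite /VLmode {1}/lext (lin_sum P) [X in Y X n _]Ex (lin_sum LY).
rewrite big_seq [RHS]big_seq; apply: eq_bigr => -[s a] kx.
have aC : a \in C by move/allP: hx => /(_ _ kx).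
rewrite (linZ P) (linZ LY) /=; congr (_ *: _); case: (eqVneq a 0) => [->|a0].
  by rewrite proj0_Ybasis // Y_basis.
rewrite (lin0 LY); apply: (@proj0_charged _ _ _ charged); first by
  rewrite inE /= eqxx andbF.
by apply: Ybasis_charged; rewrite // inE /= aC a0.
Qed.

Lemma proj0_vac : proj0 (VLvac K L) = fvac F.
Proof. by rewrite proj0_bvec eqxx. Qed.

Lemma proj0_conf u : proj0 (VLconf u) = fconf gramK (dualG u) F.
Proof.
have P := @proj0_linear K L F; have LA := am_linear gramK.
rewrite /VLconf /fconf (linZ P) (lin_sum P); congr (_ *: _).
transitivity (\sum_k \sum_j \sum_l (u k 0 j * u k 0 l) *:
   am gramK j (Negz 0) (am gramK l (Negz 0) (fvac F))).
  apply: eq_bigr => k _; rewrite !proj0_heis proj0_vac; apply: eq_bigr => j _.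
  rewrite (lin_sum (LA _ _ _)) scaler_sumr; apply: eq_bigr => l _.
  by rewrite (linZ (LA _ _ _)) scalerA.
rewrite exchange_big; apply: eq_bigr => j _ /=; rewrite exchange_big.
by apply: eq_bigr => l _; rewrite -scaler_suml.
Qed.

Definition proj (x : VM K C) : F := proj0 (VMval x).

Lemma proj_linear : linear proj.
Proof.
move=> c x y; rewrite /proj -(@proj0_linear K L F); congr proj0.
Qed.

Lemma proj_mode x n y : proj (VMmode eps x n y) = Y (proj x) n (proj y).
Proof. exact: proj0_mode (valP x) (valP y). Qed.

End Morphism.

(** * The self-extension of the vacuum module *)

(** The derivative of [binz p q] with respect to [p] at [p = 0]. *)
Definition dbinz (K : numFieldType) (q : nat) : K :=
  if q is q'.+1 then (-1) ^+ q' / q'.+1%:R else 0.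

Lemma weights_dbinz (K : numFieldType) : weights (dbinz K) 0.
Proof.
move=> [//|k] q _; rewrite sub0r addnS /dbinz.
have -> : - k.+1%:Z = - k%:Z - 1 by lia.
rewrite binz_neg (_ : 'C(k + q, q) = 'C(q + k, k)); last first.
  by rewrite addnC -[in LHS]bin_sub ?leq_addr // addKn.
have h i : (i.+1%:R : K) != 0 by rewrite pnatr_eq0.
have e : (k.+1%:R * 'C((q + k).+1, k.+1)%:R : K) = (q + k).+1%:R * 'C(q + k, k)%:R.
  by rewrite -!natrM -mul_bin_diag.
apply: (mulfI (h k)); rewrite mulrCA e exprD.
by field; rewrite !nat1r ?h -?natrD ?nat1r h.
Qed.

Section SelfExtension.
Variables (K : numFieldType) (r : nat) (G Q : 'I_r -> 'I_r -> K).
Hypothesis G_sym : forall i j, G i j = G j i.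
Hypothesis Q_sym : forall i j, Q i j = Q j i.
Hypothesis GQ1 : forall i l, \sum_j G i j * Q j l = (i == l)%:R.
Variable F : based K {mset 'I_r * nat}%mset.
Variable i0 : 'I_r.
Implicit Types (a b x y : F) (w : (F * F)%type).
Local Notation am := (@am K r G F).
Local Notation fvac := (@fvac K r F).
Local Notation Y := (@Y K r G F).
Local Notation dY := (@Yder K r G F (dbinz K) i0 0).

(** M(1,0) tensored with K[t]/(t^2), a pair being the coefficients of 1 and t,
    with the action Y(a,z) + t D(a,z), where D(a,z) is the sum over q > 0 of
    (-1)^(q-1)/q z^(-q) Y(a_i0(q) a,z), the first-order part of Li's deformation of
    a module by an element of the Cartan space. *)
Definition Yext a n w : F * F := (Y a n w.1, Y a n w.2 + dY a n w.1).

Lemma pair_ext w w' : w.1 = w'.1 -> w.2 = w'.2 -> w = w'.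
Proof. by case: w => ? ?; case: w' => ? ? /= -> ->. Qed.

Lemma Yext_linl n w : linear (fun a => Yext a n w).
Proof.
move=> c a b; apply: pair_ext; rewrite /= ?Y_linl //.
by rewrite (Yder_linl G (dbinz K) i0 0 n w.1) scalerDr addrACA.
Qed.

Lemma Yext_linr a n : linear (Yext a n).
Proof.
move=> c w w'; apply: pair_ext; rewrite /= ?Y_linr //.
by rewrite ((Yder_field G (dbinz K) i0 0 a).1 n) scalerDr addrACA.
Qed.

Lemma Yext_trunc a w : exists N : int, forall n, N <= n -> Yext a n w = 0.
Proof.
have [[M hM] [N hN]] := (Y_trunc G a w.1, Y_trunc G a w.2).
have [R hR] := (Yder_field G (dbinz K) i0 0 a).2 w.1.
exists (Order.max M (Order.max N R)) => n; rewrite !ge_max => /and3P[h1 h2 h3].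
by apply: pair_ext; rewrite /= ?hM ?hN ?hR ?addr0.
Qed.

Lemma Yext_vac n w : Yext fvac n w = if n == -1 then w else 0.
Proof.
apply: pair_ext; rewrite /= ?Yder_vac ?addr0 Y_vac /Y1; by case: ifP.
Qed.

Lemma fst_linear : linear (fst : F * F -> F). Proof. by []. Qed.
Lemma snd_linear : linear (snd : F * F -> F). Proof. by []. Qed.

Lemma fst_Biter l m n (A : int -> int -> F * F) : vanish_l A ->
  (Biter l m n A).1 = Biter l m n (fun p q => (A p q).1).
Proof.
move=> hA; rewrite (lin_nsum fst_linear); last exact: Biter_ev.
exact: eq_nsum.
Qed.

Lemma snd_Biter l m n (A : int -> int -> F * F) : vanish_l A ->
  (Biter l m n A).2 = Biter l m n (fun p q => (A p q).2).
Proof.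
move=> hA; rewrite (lin_nsum snd_linear); last exact: Biter_ev.
exact: eq_nsum.
Qed.

Lemma fst_Bcomp l m n (A : int -> int -> F * F) : vanish_r A ->
  (Bcomp l m n A).1 = Bcomp l m n (fun p q => (A p q).1).
Proof.
move=> hA; rewrite (lin_nsum fst_linear); last exact: Bcomp_ev.
exact: eq_nsum.
Qed.

Lemma snd_Bcomp l m n (A : int -> int -> F * F) : vanish_r A ->
  (Bcomp l m n A).2 = Bcomp l m n (fun p q => (A p q).2).
Proof.
move=> hA; rewrite (lin_nsum snd_linear); last exact: Bcomp_ev.
exact: eq_nsum.
Qed.

(** The coefficient of t is the derivative of the identity along D, hence a
    combination of defects of the identity on M(1,0), all of which vanish. *)
Lemma Yext_borcherds a b w l m n :
  Biter l m n (fun p q => Yext (Y a p b) q w) =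
  Bcomp l m n (fun p q => Yext a p (Yext b q w)) -
  (-1) ^ l *: Bcomp l n m (fun p q => Yext b p (Yext a q w)).
Proof.
have vl : vanish_l (fun p q => Yext (Y a p b) q w).
  have [N hN] := Y_trunc G a b; exists N => p q /hN ->.
  exact: (lin0 (Yext_linl q w)).
have vr a' b' : vanish_r (fun p q => Yext a' p (Yext b' q w)).
  have [N hN] := Yext_trunc b' w; exists N => p q /hN ->.
  exact: (lin0 (Yext_linr a' p)).
have B x := borcherds G_sym Q_sym GQ1 a b l m n x.
apply: pair_ext => /=.
  rewrite fst_Biter // !fst_Bcomp //; apply/eqP; rewrite -subr_eq0; exact/eqP/(B w.1).
rewrite snd_Biter // !snd_Bcomp //=.
have hc := @comps_vanish K r G F; have hi := @iters_vanish K r G F.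
have hcd := @comps_der_vanish K r G F; have hid := @iters_der_vanish K r G F.
rewrite (@Biter_add _ _ _ (iters G a b w.2) (iters_der G (dbinz K) i0 0 a b w.1)) //.
have E a' b' l' m' n' : Bcomp l' m' n' (fun p q => (Yext a' p (Yext b' q w)).2) =
    Bcomp l' m' n' (comps G a' b' w.2) +
      Bcomp l' m' n' (comps_der G (dbinz K) i0 0 a' b' w.1).
  rewrite -Bcomp_add //; apply: eq_Bcomp => p q /=.
  by rewrite (linD (Y_linr G _ _)) -[LHS]addrA [X in _ + X]addrC.
have [N [ha hb]] := am_ev2 G i0 a b.
have D := defect_der G_sym l m n w.1 (weights_dbinz K) ha hb.
rewrite big1 in D => [|q _]; last by rewrite !(borcherds G_sym Q_sym GQ1) addr0 scaler0.
rewrite !E scalerDr; apply/eqP; rewrite -subr_eq0 add3.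
by rewrite D addr0; apply/eqP/(B w.2).
Qed.

Lemma Yext_hom (k n : int) m a w : hom k a -> hom n w.1 -> hom n w.2 ->
  hom (n + k - m - 1) (Yext a m w).1 /\ hom (n + k - m - 1) (Yext a m w).2.
Proof.
move=> ha h1 h2; split; first exact: Y_hom.
apply: homD; first exact: Y_hom.
apply: hom_nsum => q; apply: homZ.
have := Y_hom G (m + 0 - q%:Z) (@hom_am _ _ G _ i0 q _ _ ha) h1.
by congr (hom _ _); lia.
Qed.

(** ** The weight grading of the extension *)

Definition wcomp (n : nat) x : F := mext (fun s => if weight s == n then 'v_s else 0) x.

Lemma wcomp_linear n : linear (wcomp n). Proof. exact: mext_linear. Qed.

Lemma coef_wcomp n t x : coef t (wcomp n x) = if weight t == n then coef t x else 0.
Proof.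
apply: (@linear_ext _ _ F K^o (fun x => coef t (wcomp n x))
  (fun x => if weight t == n then coef t x else 0)).
- by move=> c y z; rewrite wcomp_linear coefD coefZ.
- by move=> c y z; case: ifP => _; [rewrite coefD coefZ|rewrite scaler0 addr0].
move=> s; rewrite /wcomp mextU; have [->|st] := eqVneq s t.
  by case: ifP => // _; rewrite coef0.
by case: ifP => _; rewrite ?coef0 !coef_basis (negbTE st) ?if_same.
Qed.

Lemma hom_wcomp (n : nat) x : hom n (wcomp n x).
Proof.
by apply/homP => s; rewrite coef_wcomp; case: (weight s =P n) => [->//|_]; rewrite eqxx.
Qed.

Lemma wcomp_ev0 x : ev0 (fun n => wcomp n x).
Proof.
elim/based_ind: x => [|c x y hx hy|s].
- by exists 0%N => n _; exact: (lin0 (wcomp_linear n)).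
- have [N hN] := ev0D (ev0Z c hx) hy; exists N => n /hN.
  by rewrite wcomp_linear.
exists (weight s).+1 => n hn; rewrite /wcomp mextU.
by case: eqP => // e; move: hn; rewrite e ltnn.
Qed.

Definition wgrade (n : nat) : classical_sets.set (F * F) :=
  fun w => hom n w.1 /\ hom n w.2.

Lemma subspace_wgrade n : subspace (wgrade n).
Proof.
split; first by split; exact: hom0.
by move=> c w w' [h1 h2] [h1' h2']; split; apply/homD => //; exact: homZ.
Qed.

Lemma finite_ev0 (V : lmodType K) (f : nat -> V) :
  finite_set (fun i => f i != 0) -> ev0 f.
Proof.
move=> fin; pose A := fset_set (fun i => f i != 0).
exists (\max_(i <- A) i).+1 => i hi; apply/eqP/negPn/negP => fi.
have iA : i \in A by rewrite in_fset_set // inE.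
by have := @leq_bigmax_seq nat (enum_fset A) xpredT (fun i : nat => i) i iA isT;
  rewrite leqNgt hi.
Qed.

(** The coefficient of a monomial in a sum of homogeneous vectors comes from the
    summand of its weight. *)
Lemma wgrade_sum_coef (f : nat -> F * F) (pr : F * F -> F) t : linear pr ->
  (forall n : nat, hom n (pr (f n))) -> ev0 f ->
  coef t (pr (nsum f)) = coef t (pr (f (weight t))).
Proof.
move=> lpr hf ef; pose g (w : F * F) : K^o := coef t (pr w).
have lg : linear g by move=> c w w'; rewrite /g lpr coefD coefZ.
rewrite -[LHS]/(g (nsum f)) (lin_nsum lg ef) (@nsum1 _ _ _ (weight t)) // => n nt.
apply/eqP/negPn/negP => h; have /homP /(_ t h) := hf n.
by move=> [e]; rewrite e eqxx in nt.
Qed.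

Lemma direct_sum_wgrade : direct_sum wgrade (fun _ => True).
Proof.
split=> // w _; pose f n : F * F := (wcomp n w.1, wcomp n w.2).
have [N1 h1] := wcomp_ev0 w.1; have [N2 h2] := wcomp_ev0 w.2.
have fE n : (maxn N1 N2 <= n)%N -> f n = 0.
  by rewrite geq_max => /andP[n1 n2]; rewrite /f h1 ?h2.
have ef : ev0 f by exists (maxn N1 N2).
have S (g : nat -> F * F) : (\sum_(i \in classical_sets.setT) g i)%R = nsum g.
  by rewrite nsum.unlock.
exists f; split; first split.
- by move=> n; split; exact: hom_wcomp.
- apply: (@sub_finite_set _ _ (fun n => n < maxn N1 N2)%N); last exact: finite_II.
  by move=> n /=; rewrite ltnNge; apply: contraNN => /fE ->.
- rewrite S; apply: pair_ext; apply: coef_inj => t.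
    rewrite (wgrade_sum_coef _ fst_linear) // => [|n]; last exact: hom_wcomp.
    by rewrite coef_wcomp eqxx.
  rewrite (wgrade_sum_coef _ snd_linear) // => [|n]; last exact: hom_wcomp.
  by rewrite coef_wcomp eqxx.
move=> g [gw /finite_ev0 eg wE]; apply/funext => n.
have hg (pr : F * F -> F) t : linear pr -> (forall k : nat, hom k (pr (g k))) ->
    coef t (wcomp n (pr w)) = coef t (pr (g n)).
  move=> lpr hgn; rewrite coef_wcomp wE S (wgrade_sum_coef _ lpr) //.
  case: eqP => [->//|tn]; apply/esym/eqP/negPn/negP => h.
  by have /homP /(_ t h) [] := hgn n.
apply: pair_ext; apply: coef_inj => t /=.
  by apply: (hg _ _ fst_linear) => k; case: (gw k).
by apply: (hg _ _ snd_linear) => k; case: (gw k).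
Qed.

(** ** Failure of semisimplicity *)

(** Multiplication by t. *)
Definition nilp w : F * F := (0, w.1).

Lemma nilp_linear : linear nilp.
Proof. by move=> c w w'; apply: pair_ext; rewrite //= scaler0 addr0. Qed.

Lemma Yext_nilp a n w : Yext a n (nilp w) = nilp (Yext a n w).
Proof.
apply: pair_ext => /=; first exact: (lin0 (Y_linr G a n)).
by rewrite (lin0 ((Yder_field G (dbinz K) i0 0 a).1 n)) addr0.
Qed.

(** The zero mode of a_i0(-1)1 is zero on M(1,0), and its deformation picks up
    the contraction of a_i0(1) with a_i0(-1). *)
Lemma Yext_gen0 w : Yext (am i0 (Negz 0) fvac) 0 w = G i0 i0 *: nilp w.
Proof.
apply: pair_ext => /=; rewrite Y_gen am0 ?scaler0 // add0r.
rewrite /Yder (@nsum1 _ _ _ 1%N) => [|q q1].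
  rewrite am_pos_neg am_fvac (lin0 (am_linear _ _ _)) add0r mul1r.
  rewrite (linZ (Y_linl G _ _)) Y_vac /Y1 /= expr0 divr1 scale1r //.
rewrite am_pos_neg am_fvac (lin0 (am_linear _ _ _)) add0r (negbTE q1) scale0r.
by rewrite (lin0 (Y_linl G _ _)) scaler0.
Qed.

End SelfExtension.

(** * Conic-type subVOAs are neither simple nor rational *)

Section ConicTypeVOA.
Variables (K : numFieldType) (L : even_lattice).
Hypothesis r0 : (0 < lrank L)%N.
Variable eps : lvec L -> lvec L -> int.
Hypothesis heps : lattice_cocycle eps.
Variable u : 'I_(lrank L) -> cartan K L.
Hypothesis hu : orthonormal_basis u.
Variable C : addrClosed (lvec L).
Hypothesis hC : conic_type C.

Let V := submonoid_voa eps u C.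
Variable F : based K {mset var L}%mset.
Let i0 : 'I_(lrank L) := Ordinal r0.
Local Notation gramK := (@gramK K L).
Local Notation pr := (@proj K L F C).
Local Notation Y := (@Y K (lrank L) gramK F).

Let eps0 a : eps 0 a = 1. Proof. by case: heps => _ _ _ /(_ a)[]. Qed.

Let G_sym i j : gramK i j = gramK j i. Proof. exact: gramK_sym. Qed.

(** Projecting to charge zero is a morphism onto M(1,0); its kernel is the ideal
    spanned by the other charges. *)
Lemma pr_mode x n y : pr (vmode (v := V) x n y) = Y (pr x) n (pr y).
Proof. exact: (proj_mode F eps0 (conic_pointed hC)). Qed.

Lemma pr_linear : linear (pr : V -> F). Proof. exact: proj_linear. Qed.

Lemma fvac_neq0 : fvac F != 0.
Proof.
apply/eqP => h; have := congr1 (coef (mset0 : {mset var L}%mset)) h.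
rewrite coef_basis eqxx coef0 => /eqP; by rewrite oner_eq0.
Qed.

(** The kernel of the projection to charge zero contains e^a for nonzero [a] in
    [C], but not the vacuum. *)
Theorem conic_not_simple : ~ voa_simple V.
Proof.
have P := pr_linear.
pose J : classical_sets.set V := fun x => pr x = 0.
have hJ : voa_ideal (V := V) J.
  split; first split.
  - exact: (lin0 P).
  - by move=> c x y hx hy; rewrite /J P hx hy scaler0 addr0.
  move=> x y n hy; split; rewrite /J pr_mode hy.
    exact: (lin0 (Y_linr gramK (pr x) n)).
  exact: (lin0 (Y_linl gramK n (pr x))).
move=> /(_ J hJ)[JE|JE].
  have [a aC a0] := conic_neq0 hC r0.
  have hb : bvec K (mset0, a) \in VM_pred C by exact: VM_bvec.
  have : J (MkVM hb : V) by rewrite /J /pr proj0_bvec /= (negbTE a0).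
  rewrite JE => /(congr1 (@VMval K L C)) /= h.
  have := congr1 (fun v : VL K L => v@_(mset0, a)) h.
  by rewrite mcoeffUU mcoeff0 => /eqP; rewrite oner_eq0.
have : J (vvac V) by rewrite JE.
by rewrite /J /pr proj0_vac => /eqP; rewrite (negbTE fvac_neq0).
Qed.

Let W : lmodType K := (F * F)%type.
Let YW (x : V) (n : int) (w : W) : W := Yext gramK i0 (pr x) n w.

Lemma weak_module_YW : weak_module YW.
Proof.
have P := pr_linear; split.
- by move=> n w c x y; rewrite /YW P Yext_linl.
- by move=> x n; exact: Yext_linr.
- by move=> x w; exact: Yext_trunc.
- by move=> n w; rewrite /YW /pr proj0_vac Yext_vac.
move=> x y w l m n.
have S (f : nat -> W) : (\sum_(i \in classical_sets.setT) f i)%R = nsum f.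
  by rewrite nsum.unlock.
rewrite !S.
have -> : nsum (fun i => binz K m i *: YW (vmode x (l + i%:Z) y) (m + n - i%:Z) w) =
    Biter l m n (fun p q => Yext gramK i0 (Y (pr x) p (pr y)) q w).
  by apply: eq_nsum => i; rewrite /YW pr_mode.
rewrite (Yext_borcherds G_sym (dualG_sym u) (gramK_dualG hu)); congr (_ - _).
rewrite nsumV_scale; first by apply: eq_nsum => i; rewrite scalerA mulrA.
apply: (@Bcomp_ev K W (fun p q => Yext gramK i0 (pr y) p (Yext gramK i0 (pr x) q w))
  l n m (fun i => (-1) ^+ i * binz K l i)).
have [N hN] := Yext_trunc gramK i0 (pr x) w.
by exists N => p q /hN ->; exact: (lin0 (Yext_linr gramK i0 (pr y) p)).
Qed.

Lemma pr_weight (k : int) (x : V) : has_weight k x -> hom k (pr x).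
Proof.
rewrite /has_weight => /(congr1 pr); rewrite pr_mode (linZ pr_linear).
rewrite {1}/pr proj0_conf; exact: (hom_L0 G_sym (dualG_sym u) (gramK_dualG hu)).
Qed.

Lemma admissible_YW : admissible YW classical_sets.setT.
Proof.
exists (@wgrade K (lrank L) F); split.
- exact: subspace_wgrade.
- exact: direct_sum_wgrade.
move=> x k m n w /pr_weight hx [h1 h2].
have [] := Yext_hom gramK i0 m hx h1 h2; rewrite /YW.
case: (n%:Z + k - m - 1) => d g1 g2 /=; first by [].
by apply: pair_ext; [exact: hom_lt0 g1|exact: hom_lt0 g2].
Qed.

(** An irreducible submodule is killed by [nilp], which acts on it through a
    mode and has square zero. *)
Lemma irreducible_nilp N : irreducible YW N -> forall w, N w -> nilp w = 0.
Proof.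
case=> [[[N0 Nlin] Nmode] _ Nmin] w Nw.
have hb : bvec K ([mset (i0, 0%N)]%mset, 0) \in VM_pred C by apply/VM_bvec/rpred0.
have E : pr (MkVM hb) = am gramK i0 (Negz 0) (fvac F).
  by rewrite /pr proj0_bvec eqxx amN /fcreate mextU msetD0.
have Nnil z : N z -> N (nilp z).
  move=> /(Nmode (MkVM hb : V) 0); rewrite /YW E Yext_gen0 // => h.
  have := Nlin (gramK i0 i0)^-1 _ _ h N0.
  by rewrite addr0 scalerA mulVf ?scale1r // gramK_diag.
pose N' : classical_sets.set W := fun z => N z /\ nilp z = 0.
have hN' : submodule YW N'.
  split; first split.
  - by split=> //; exact: (lin0 (@nilp_linear K (lrank L) F)).
  - move=> c y z [Ny Ey] [Nz Ez]; split; first exact: Nlin.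
    by rewrite nilp_linear Ey Ez scaler0 addr0.
  move=> x n z [Nz Ez]; split; first exact: Nmode.
  by rewrite /YW -Yext_nilp Ez (lin0 (Yext_linr gramK i0 (pr x) n)).
have [|E'|E'] := Nmin N' hN'; first by move=> z [].
  have : N' (nilp w) by split; [exact: Nnil|].
  by rewrite E'.
have [] // : N' w by rewrite E'.
Qed.

(** Multiplication by t kills every irreducible summand, but it maps the vacuum
    to t times the vacuum. *)
Theorem conic_not_rational : ~ voa_rational V.
Proof.
move=> /(_ W YW weak_module_YW admissible_YW) [I [N [irr [_ dec]]]].
have [f [[fN _ wE] _]] := dec (fvac F, 0) Logic.I.
have /(congr1 snd) /= /eqP : nilp ((fvac F, 0) : W) = 0.
  rewrite wE (lin_sum (@nilp_linear K (lrank L) F)) big1 // => i _.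
  exact: (irreducible_nilp (irr i).1 (fN i)).
by rewrite (negbTE fvac_neq0).
Qed.

End ConicTypeVOA.

Theorem proposition4p4 (R : realType) (L : even_lattice)
    (hL : (0 < lrank L)%N)
    (eps : lvec L -> lvec L -> int) (heps : lattice_cocycle eps)
    (u : 'I_(lrank L) -> cartan (complex R) L) (hu : orthonormal_basis u)
    (C : addrClosed (lvec L)) (hC : conic_type C) :
  ~ voa_simple (submonoid_voa eps u C) /\ ~ voa_rational (submonoid_voa eps u C).
Proof.
have F := malg_based (complex R) {mset var L}%mset.
split.
  exact: (conic_not_simple hL heps (u := u) hC F).
exact: (conic_not_rational hL heps hu hC F).
Qed.
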